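(* Let $k$ be an arbitrary field, let $H=\langle 4,9,15\rangle$, let $S=k[x,y,z]$, and let $\varphi_H\colon S\to k[H]=k[t^4,t^9,t^{15}]\subseteq k[t]$ be the $k$-algebra homomorphism with $x\mapsto t^4$, $y\mapsto t^9$, $z\mapsto t^{15}$. Let $$I=I_{25}=\varphi_H^{-1}\bigl(t^{25}k[t]\cap k[H]\bigr)=(yz-x^6,\ x^7,\ x^4y,\ x^2y^2,\ x^3z,\ y^3,\ z^2).$$ Then the Rees algebra $\mathcal R(I)$ is a Cohen--Macaulay normal domain.
   Context: $\langle 4,9,15\rangle$ is the submonoid of $\mathbb N$ generated by $4,9,15$. For an ideal $I$ of a commutative ring $S$, the Rees algebra of $I$ is $\mathcal R(I)=S[IT]=\bigoplus_{n\geq 0}I^nT^n\subseteq S[T]$, where $T$ is an indeterminate over $S$. *)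

(* Defs.v *)
From HB Require Import structures.
From mathcomp Require Import all_boot all_order all_algebra.
From mathcomp Require Import generic_quotient ring_quotient fraction mxpoly.
From mathcomp Require Import ring boolp.
From mathcomp.multinomials Require Import mpoly.

Set Implicit Arguments.
Unset Strict Implicit.
Unset Printing Implicit Defensive.

Import GRing.Theory.
Local Open Scope ring_scope.
Local Open Scope quotient_scope.

(* Subsets of a ring are boolean predicates, as in ring_quotient. Since        *)
(* boolp.asbool decides every proposition, these are all the subsets, so       *)
(* [idealr R] is the type of all proper ideals of R and [prime_idealr R] that  *)
(* of all prime ideals.                                                        *)

Section Ideals.
Variable R : comNzRingType.

Definition in_ideal (s : seq R) (x : R) : Prop :=
  exists c : 'I_(size s) -> R, x = \sum_i c i * s`_i.

Definition ideal_mul (I J : R -> Prop) (x : R) : Prop :=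
  exists2 s : seq (R * R),
    {in s, forall u, I u.1 /\ J u.2} & x = \sum_(u <- s) u.1 * u.2.

Fixpoint ideal_pow (I : R -> Prop) (n : nat) : R -> Prop :=
  if n is n'.+1 then ideal_mul I (ideal_pow I n') else fun=> True.

(* The unit ideal, which is not an [idealr], is generated by 1. *)
Definition noetherian : Prop :=
  forall I : idealr R, exists s : seq R, forall x, x \in I <-> in_ideal s x.

Definition maximal_ideal (m : idealr R) : Prop :=
  forall J : idealr R, {subset m <= J} -> J =i m.

Definition local_ring (m : idealr R) : Prop :=
  maximal_ideal m /\ forall n : idealr R, maximal_ideal n -> n =i m.

Definition prime_chain (n : nat) : Prop :=
  exists P : 'I_n.+1 -> prime_idealr R,
    forall i j : 'I_n.+1, (i < j)%N ->
      {subset P i <= P j} /\ ~ {subset P j <= P i}.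

Definition krull_dim (n : nat) : Prop :=
  prime_chain n /\ forall n', prime_chain n' -> (n' <= n)%N.

(* Each s_i is a nonzerodivisor on R/(s_0, ..., s_{i-1}), and R/(s) <> 0. *)
Definition regular_seq (s : seq R) : Prop :=
  (forall i, (i < size s)%N ->
     forall x, in_ideal (take i s) (s`_i * x) -> in_ideal (take i s) x)
  /\ ~ in_ideal s 1.

Definition depth (m : idealr R) (n : nat) : Prop :=
  (exists s : seq R, [/\ regular_seq s, {subset s <= m} & size s = n])
  /\ forall s : seq R, regular_seq s -> {subset s <= m} -> (size s <= n)%N.

Definition cm_local_ring : Prop :=
  noetherian /\
  exists2 m : idealr R, local_ring m & exists2 d, krull_dim d & depth m d.

End Ideals.

(* Localization at a prime ideal p: (a, s) ~ (b, t) iff u (a t - b s) = 0 for  *)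
(* some u outside p.                                                           *)

Section Localization.
Variables (R : comNzRingType) (p : prime_idealr R).

Record preloc := PreLoc { pl_val :> R * R; pl_valP : pl_val.2 \notin p }.

HB.instance Definition _ := [isSub for pl_val].
HB.instance Definition _ := [Choice of preloc by <:].

Definition loc_equiv (x y : preloc) : bool :=
  `[< exists2 u, u \notin p & u * (x.1 * y.2 - y.1 * x.2) = 0 >].

Lemma notin_primeM u v : u \notin p -> v \notin p -> u * v \notin p.
Proof. by move=> pu pv; rewrite prime_idealrM negb_or pu pv. Qed.

Lemma notin_prime1 : 1 \notin p.
Proof. by rewrite idealr1. Qed.

Lemma loc_equivP (x y : preloc) :
  reflect (exists2 u, u \notin p & u * (x.1 * y.2) = u * (y.1 * x.2))
          (loc_equiv x y).
Proof.
apply: (iffP (asboolP _)) => -[u pu e]; exists u => //.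
  by apply/eqP; rewrite -subr_eq0 -mulrBr e.
by rewrite mulrBr e subrr.
Qed.

Lemma loc_equiv_refl : reflexive loc_equiv.
Proof. by move=> x; apply/loc_equivP; exists 1; rewrite ?notin_prime1. Qed.

Lemma loc_equiv_sym : ssrbool.symmetric loc_equiv.
Proof. by move=> x y; apply/loc_equivP/loc_equivP => -[u pu e]; exists u. Qed.

Lemma loc_equiv_trans : transitive loc_equiv.
Proof.
move=> y x z /loc_equivP[u pu e] /loc_equivP[v pv f]; apply/loc_equivP.
exists (u * v * y.2); first by rewrite !notin_primeM ?(pl_valP y).
have -> : u * v * y.2 * (x.1 * z.2) = v * z.2 * (u * (x.1 * y.2)) by ring.
rewrite e.
have -> : v * z.2 * (u * (y.1 * x.2)) = u * x.2 * (v * (y.1 * z.2)) by ring.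
by rewrite f; ring.
Qed.

Canonical loc_equiv_rel :=
  EquivRel loc_equiv loc_equiv_refl loc_equiv_sym loc_equiv_trans.

Definition localization := {eq_quot loc_equiv}.

HB.instance Definition _ := EqQuotient.on localization.
HB.instance Definition _ := Choice.on localization.

Lemma loc_eqP (x y : preloc) :
  \pi_localization x = \pi_localization y <->
  exists2 u, u \notin p & u * (x.1 * y.2) = u * (y.1 * x.2).
Proof. by split=> [/eqmodP/loc_equivP|e]; last exact/eqmodP/loc_equivP. Qed.

Definition loc_frac (a s : R) (ps : s \notin p) : localization :=
  \pi_localization (PreLoc (pl_val := (a, s)) ps).

Definition loc_preadd (x y : preloc) : preloc :=
  @PreLoc (x.1 * y.2 + y.1 * x.2, x.2 * y.2)
          (notin_primeM (pl_valP x) (pl_valP y)).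
Definition loc_preopp (x : preloc) : preloc :=
  @PreLoc (- x.1, x.2) (pl_valP x).
Definition loc_premul (x y : preloc) : preloc :=
  @PreLoc (x.1 * y.1, x.2 * y.2) (notin_primeM (pl_valP x) (pl_valP y)).

Definition loc_add (a b : localization) : localization :=
  \pi_localization (loc_preadd (repr a) (repr b)).
Definition loc_opp (a : localization) : localization :=
  \pi_localization (loc_preopp (repr a)).
Definition loc_mul (a b : localization) : localization :=
  \pi_localization (loc_premul (repr a) (repr b)).
Definition loc0 : localization := loc_frac 0 notin_prime1.
Definition loc1 : localization := loc_frac 1 notin_prime1.

Lemma loc_addE x y : loc_add (\pi_localization x) (\pi_localization y) = \pi_localization (loc_preadd x y).
Proof.
rewrite /loc_add; case: piP => x' /loc_eqP[u pu e].
case: piP => y' /loc_eqP[v pv f]; apply/loc_eqP.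
exists (u * v) => /=; first exact: notin_primeM.
transitivity (v * y'.2 * y.2 * (u * (x'.1 * x.2))
  + u * x'.2 * x.2 * (v * (y'.1 * y.2))); first by ring.
by rewrite -e -f; ring.
Qed.

Lemma loc_oppE x : loc_opp (\pi_localization x) = \pi_localization (loc_preopp x).
Proof.
rewrite /loc_opp; case: piP => x' /loc_eqP[u pu e]; apply/loc_eqP.
by exists u => //=; rewrite !mulNr !mulrN e.
Qed.

Lemma loc_mulE x y : loc_mul (\pi_localization x) (\pi_localization y) = \pi_localization (loc_premul x y).
Proof.
rewrite /loc_mul; case: piP => x' /loc_eqP[u pu e].
case: piP => y' /loc_eqP[v pv f]; apply/loc_eqP.
exists (u * v) => /=; first exact: notin_primeM.
transitivity (u * (x'.1 * x.2) * (v * (y'.1 * y.2))); first by ring.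
by rewrite -e -f; ring.
Qed.

Let eq1 (x y : preloc) : x.1 * y.2 = y.1 * x.2 ->
  \pi_localization x = \pi_localization y.
Proof. by move=> e; apply/loc_eqP; exists 1; rewrite ?notin_prime1 ?e. Qed.

Lemma loc_addA : associative loc_add.
Proof.
elim/quotW=> x; elim/quotW=> y; elim/quotW=> z.
by rewrite (loc_addE x y) (loc_addE y z) !loc_addE; apply: eq1 => /=; ring.
Qed.

Lemma loc_addC : commutative loc_add.
Proof.
elim/quotW=> x; elim/quotW=> y.
by rewrite !loc_addE; apply: eq1 => /=; ring.
Qed.

Lemma loc_add0 : left_id loc0 loc_add.
Proof. by elim/quotW=> x; rewrite loc_addE; apply: eq1 => /=; ring. Qed.

Lemma loc_addN : left_inverse loc0 loc_opp loc_add.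
Proof.
by elim/quotW=> x; rewrite loc_oppE (loc_addE (loc_preopp x) x); apply: eq1 => /=; ring.
Qed.

HB.instance Definition _ :=
  GRing.isZmodule.Build localization loc_addA loc_addC loc_add0 loc_addN.

Lemma loc_mulA : associative loc_mul.
Proof.
elim/quotW=> x; elim/quotW=> y; elim/quotW=> z.
by rewrite (loc_mulE x y) (loc_mulE y z) !loc_mulE; apply: eq1 => /=; ring.
Qed.

Lemma loc_mulC : commutative loc_mul.
Proof.
elim/quotW=> x; elim/quotW=> y.
by rewrite !loc_mulE; apply: eq1 => /=; ring.
Qed.

Lemma loc_mul1 : left_id loc1 loc_mul.
Proof. by elim/quotW=> x; rewrite loc_mulE; apply: eq1 => /=; ring. Qed.

Lemma loc_mulDl : left_distributive loc_mul loc_add.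
Proof.
elim/quotW=> x; elim/quotW=> y; elim/quotW=> z.
rewrite (loc_addE x y) (loc_mulE x z) (loc_mulE y z) loc_addE loc_mulE.
by apply: eq1 => /=; ring.
Qed.

Lemma loc1_neq0 : loc1 != loc0.
Proof.
apply/eqP => /loc_eqP[u pu /=]; rewrite !mulr1 mulr0 => u0.
by move: pu; rewrite u0 idealr0.
Qed.

HB.instance Definition _ := GRing.Zmodule_isComNzRing.Build localization
  loc_mulA loc_mulC loc_mul1 loc_mulDl loc1_neq0.

End Localization.

(* Maximal ideals are prime, so this ranges over all maximal ideals of R. *)
Definition cohen_macaulay (R : comNzRingType) : Prop :=
  noetherian R /\
  forall p : prime_idealr R, maximal_ideal p -> cm_local_ring (localization p).

(* That R is a domain is carried by its type. *)
Definition normal_domain (R : idomainType) : Prop :=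
  forall z : {fraction R},
    integralOver (@FracField.tofrac R) z -> exists r : R, z = FracField.tofrac r.

(* The Rees algebra R[IT], with {poly R} playing the role of R[T]. A subring   *)
(* of R[T], it is a domain. It contains the units of R[T], which are constant, *)
(* so it is closed under the total inverse of R[T]; this gives [rees] its      *)
(* idomainType structure.                                                      *)

Section Rees.
Variables (R : idomainType) (I : {pred R}).

Definition rees_pred : {pred {poly R}} :=
  fun f => `[< forall n, ideal_pow (fun x => x \in I) n f`_n >].

Local Notation pow := (ideal_pow (fun x => x \in I)).

Lemma ideal_pow0 n : pow n 0.
Proof. by case: n => //= n; exists [::]; rewrite ?big_nil. Qed.

Lemma ideal_powD n x y : pow n x -> pow n y -> pow n (x + y).
Proof.
case: n => //= n [s hs ->] [t ht ->]; exists (s ++ t); last by rewrite big_cat.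
by move=> u; rewrite mem_cat => /orP[/hs|/ht].
Qed.

Lemma ideal_powZ n a x : pow n x -> pow n (a * x).
Proof.
elim: n x => //= n IHn x [s hs ->].
exists [seq (u.1, a * u.2) | u <- s].
  by move=> _ /mapP[u us ->] /=; case: (hs u us) => I1 I2; split=> //; apply: IHn.
by rewrite big_map mulr_sumr; apply: eq_bigr => u _ /=; rewrite mulrCA.
Qed.

Lemma ideal_powM m n x y : pow m x -> pow n y -> pow (m + n) (x * y).
Proof.
elim: m x => [|m IHm] x; first by move=> _; apply: ideal_powZ.
move=> [s hs ->] hy /=; exists [seq (u.1, u.2 * y) | u <- s].
  by move=> _ /mapP[u us ->] /=; case: (hs u us) => I1 I2; split=> //; apply: IHm.
by rewrite big_map mulr_suml; apply: eq_bigr => u _ /=; rewrite mulrA.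
Qed.

Lemma rees_polyC c : c%:P \in rees_pred.
Proof.
by apply/asboolP => -[|n] //; rewrite coefC; apply: ideal_pow0.
Qed.

Lemma rees_divring_closed : divring_closed rees_pred.
Proof.
have memM f g : f \in rees_pred -> g \in rees_pred -> f * g \in rees_pred.
  move=> /asboolP hf /asboolP hg; apply/asboolP => n; rewrite coefM.
  elim/big_ind: _ => [|x y|i _]; [exact: ideal_pow0|exact: ideal_powD|].
  by rewrite -{1}(subnKC (ltn_ord i : (i <= n)%N)); apply: ideal_powM.
split=> [|f g /asboolP hf /asboolP hg|f g hf hg].
- by rewrite -polyC1 rees_polyC.
- apply/asboolP => n; rewrite coefB -mulN1r.
  by apply: ideal_powD => //; apply: ideal_powZ.
apply: memM => //; rewrite [g^-1]/(poly_inv g) /poly_inv.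
by case: ifP => // _; apply: rees_polyC.
Qed.

HB.instance Definition _ :=
  GRing.isDivringClosed.Build {poly R} rees_pred rees_divring_closed.

Record rees := Rees { rees_val :> {poly R}; rees_valP : rees_val \in rees_pred }.

HB.instance Definition _ := [isSub for rees_val].
HB.instance Definition _ := [Choice of rees by <:].
HB.instance Definition _ := [SubChoice_isSubIntegralDomain of rees by <:].

End Rees.

Inductive submonoid_gen (A : seq nat) : nat -> Prop :=
| submonoid0 : submonoid_gen A 0%N
| submonoid_in n : n \in A -> submonoid_gen A n
| submonoidD m n :
    submonoid_gen A m -> submonoid_gen A n -> submonoid_gen A (m + n)%N.

Definition sgH : nat -> Prop := submonoid_gen [:: 4; 9; 15]%N.

Section Ideal25.
Variable k : fieldType.

(* k[H] inside k[t] = {poly k}: the polynomials supported on H. *)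
Definition kH : {pred {poly k}} :=
  fun f => `[< forall n, f`_n != 0 -> sgH n >].

Definition vx : {mpoly k[3]} := 'X_(@Ordinal 3 0 isT).
Definition vy : {mpoly k[3]} := 'X_(@Ordinal 3 1 isT).
Definition vz : {mpoly k[3]} := 'X_(@Ordinal 3 2 isT).

Definition phiH (f : {mpoly k[3]}) : {poly k} :=
  mmap (@polyC k) (fun i : 'I_3 => 'X^(nth 0%N [:: 4; 9; 15]%N i)) f.

Definition I25 : {pred {mpoly k[3]}} :=
  fun f => ('X^25 %| phiH f) && (phiH f \in kH).

Definition I25_gens : seq {mpoly k[3]} :=
  [:: vy * vz - vx ^+ 6; vx ^+ 7; vx ^+ 4 * vy; vx ^+ 2 * vy ^+ 2;
      vx ^+ 3 * vz; vy ^+ 3; vz ^+ 2].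

End Ideal25.

Arguments I25 k f : clear implicits.
Arguments I25_gens k : clear implicits.

(* Main.v *)
From HB Require Import structures.
From mathcomp Require Import all_boot all_algebra.
From mathcomp Require Import ring_quotient fraction mxpoly.
From mathcomp Require Import ring zify boolp.
From mathcomp Require classical_sets.
From mathcomp.multinomials Require Import ssrcomplements mpoly.
Require Import Defs.

Set Implicit Arguments.
Unset Strict Implicit.
Unset Printing Implicit Defensive.

Import GRing.Theory.
Local Open Scope ring_scope.

(**
Let w = yz - x^6, b = z^2 - x^4 y and c = y^3 - x^3 z. Under x -> st, y -> s^6,
z -> t^6 + omega, which sends w to s^6 omega, the power I^n is the set of the
polynomials whose image has values at least 12n, 78n and 18n for the weights
(1,1,6), (5,7,48) and (1,2,12) of (s,t,omega); setting omega = 0 embeds S/(w)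
into k[s,t]. Hence R(I) is the intersection of S[T] with valuation rings, so it is
completely integrally closed, hence normal.

R(I) has dimension at most 4, because five elements of k[x,y,z,T] are
algebraically dependent over k. So it suffices to find a regular sequence of
length 4 in every localization at a maximal ideal P. For every element a of R(I)
there is a monic polynomial p over k with p(a) in P.
- If P does not contain some f in I, then R(I)_f = k[x,y,z,fT]_f, and the sequence
  is p1(x), p2(y), p3(z), p4(fT).
- If P contains I but not fT for some f in I, then f generates I R(I)_P, and the
  graded ring R(I) / I R(I) is treated by wT, bT, cT: the sequence is
  f, p1(wT), p2(bT), p3(cT), by comparison of leading forms.
- If P contains I and IT, the sequence is wT, w - bT, b - cT, c, where
  1 - x^5 is invertible.
The colon computations use: w f in I^(n+1) implies f in I^n; the same for b modulo
w; c is regular modulo (b, w); and (1 - x^5) I^n is contained in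
b I^(n-1) + c I^(n-1) + (w) for n >= 2.
*)

#[local] Arguments ideal_pow : simpl never.

(** * Weights on polynomials *)

(** The weights of s and t are the normals of the three compact edges of the Newton polygon of I
    S/(w), whose vertices are (0,12), (3,9), (10,4), (18,0). The weight of omega is the edge value
    minus 6 times the weight of s, so that w has exactly the value required of I. The elements b and
    c take alternate vertices, so every edge has one end in each; this makes (b, c) a reduction of I
    S/(w) near the origin. The factor 1 - x^5 accounts for the other common zeros of b and c on w =
    0, all of which satisfy x^5 = 1.

    The field is arbitrary, so a maximal ideal need not be rational and coordinates cannot be
    translated to it. Monic polynomials over k, supplied by Zariski's lemma, replace linear forms,
    and regularity passes from an element to its monic polynomials through leading forms.

    No height theory is used: a regular sequence of length n yields a strict chain of n + 1 primes.
    Hence one sequence of length 4 and the upper bound on chains determine the dimension and the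
    depth of each localization together. *)

Lemma coef_low_divl (E : idomainType) (P Q : {poly E}) N M :
  ~ (forall d, (d <= N)%N -> P`_d = 0) ->
  (forall d, (d < N + M)%N -> (P * Q)`_d = 0) ->
  forall d, (d < M)%N -> Q`_d = 0.
Proof.
move=> hP hPQ.
have ex : exists d, (d <= N)%N && (P`_d != 0).
  apply: contrapT => h; apply: hP => d dN.
  by apply: contrapT => /eqP pd; apply: h; exists d; rewrite dN.
(* With d0 the order of P at 0, minimality of d0 and induction on d reduce the coefficient of P Q in
   degree d0 + d to the product of the coefficients of P in degree d0 and of Q in degree d. *)
case: (ex_minnP ex) => d0 /andP[d0N Pd0] dmin d.
elim/ltn_ind: d => d IHd dM.
have lt0 : (d0 < (d0 + d).+1)%N by rewrite ltnS leq_addr.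
have := hPQ (d0 + d)%N; rewrite -addnS => /(_ (leq_add d0N dM)).
rewrite coefM (bigD1 (Ordinal lt0)) //= addKn big1 => [|i ni].
  by move/eqP; rewrite addr0 mulf_eq0 (negbTE Pd0) => /eqP.
have {}ni : (i : nat) != d0 by apply: contraNneq ni => e; apply/eqP/val_inj.
have [id0|d0i] := ltnP i d0.
  have [->|Pi] := eqVneq P`_i 0; first by rewrite mul0r.
  by have := dmin i; rewrite Pi (leq_trans (ltnW id0)) // leqNgt id0 => /(_ isT).
have di : (d0 + d - i < d)%N by move: (ltn_ord i) ni d0i => /=; clear; lia.
by rewrite IHd ?mulr0 // (ltn_trans di dM).
Qed.

Section WeightOrder.
Variables (n : nat) (k : fieldType) (v : 'I_n -> nat).
Implicit Types (m : 'X_{1..n}) (p q : {mpoly k[n]}).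

Definition mwt m : nat := \sum_(i < n) (v i * m i)%N.

(** Only lower bounds for the value are used, so that 0 needs no infinite value. *)
Definition wge (N : nat) p : Prop := forall m, p@_m != 0 -> (N <= mwt m)%N.

Lemma mwtD m1 m2 : mwt (m1 + m2)%MM = (mwt m1 + mwt m2)%N.
Proof.
by rewrite /mwt -big_split /=; apply: eq_bigr => i _; rewrite mnmDE mulnDr.
Qed.

Lemma mwt0 : mwt 0%MM = 0%N.
Proof. by rewrite /mwt big1 // => i _; rewrite mnm0E muln0. Qed.

Lemma mwtU i : mwt U_(i)%MM = v i.
Proof.
rewrite /mwt (bigD1 i) //= mnm1E eqxx muln1 big1 ?addn0 // => j ji.
by rewrite mnm1E eq_sym (negbTE ji) muln0.
Qed.

Lemma wgeW N M p : (M <= N)%N -> wge N p -> wge M p.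
Proof. by move=> MN hp m /hp; apply: leq_trans. Qed.

Lemma wge0 N : wge N 0.
Proof. by move=> m; rewrite mcoeff0 eqxx. Qed.

Lemma wge_le0 p : wge 0 p.
Proof. by []. Qed.

Lemma wgeD N p q : wge N p -> wge N q -> wge N (p + q).
Proof.
move=> hp hq m; rewrite mcoeffD => h.
have [p0|/hp//] := eqVneq p@_m 0; apply: hq.
by move: h; rewrite p0 add0r.
Qed.

Lemma wgeN N p : wge N p -> wge N (- p).
Proof. by move=> hp m; rewrite mcoeffN oppr_eq0; apply: hp. Qed.

Lemma wgeB N p q : wge N p -> wge N q -> wge N (p - q).
Proof. by move=> hp hq; apply: wgeD => //; apply: wgeN. Qed.

Lemma wgeM N M p q : wge N p -> wge M q -> wge (N + M) (p * q).
Proof.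
move=> hp hq m; rewrite -mcoeff_msupp => /msuppM_le.
case/allpairsP => -[m1 m2] /= []; rewrite !mcoeff_msupp => /hp h1 /hq h2 ->.
by rewrite mwtD leq_add.
Qed.

Lemma wgeX i : wge (v i) 'X_i.
Proof.
by move=> m; rewrite mcoeffX; have [<-|] := eqVneq U_(i)%MM m; rewrite ?mwtU ?eqxx.
Qed.

Lemma wgeXn N e p : wge N p -> wge (e * N) (p ^+ e).
Proof.
move=> hp; elim: e => [|e IHe]; first exact: wge_le0.
by rewrite exprS mulSn; apply: wgeM.
Qed.

Lemma wgeC N c p : wge N p -> wge N (c *: p).
Proof.
by move=> hp m; rewrite mcoeffZ mulf_eq0 negb_or => /andP[_ /hp].
Qed.

(** Replacing each X_i by X_i T^(v i) turns weights into orders in T, hence additivity of values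
    into a fact about univariate polynomials over a domain. *)
Definition wtau : {mpoly k[n]} -> {poly {mpoly k[n]}} :=
  mmap (polyC \o @mpolyC n k) (fun i => ('X_i)%:P * 'X^(v i)).

HB.instance Definition _ := GRing.RMorphism.on wtau.

Lemma wtauX m : wtau 'X_[m] = ('X_[m])%:P * 'X^(mwt m).
Proof.
rewrite /wtau mmapX /mmap1 /mwt (mpolyXE_id _ m) rmorph_prod /=.
rewrite (big_morph (fun d => 'X^d) (exprD 'X) (expr0 'X)) -big_split /=.
by apply: eq_bigr => i _; rewrite exprMn -exprM rmorphXn.
Qed.

Lemma coef_wtau p d :
  (wtau p)`_d = \sum_(m <- msupp p | mwt m == d) p@_m *: 'X_[m].
Proof.
rewrite {1}[p]mpolyE rmorph_sum coef_sum [RHS]big_mkcond /=.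
apply: eq_bigr => m _; rewrite -mul_mpolyC rmorphM /= wtauX.
rewrite {1}/wtau mmapC /= mulrA -polyCM mul_mpolyC.
by rewrite coefCM coefXn eq_sym; case: eqP; rewrite ?mulr1 ?mulr0.
Qed.

Lemma mcoeff_wtau p d m :
  ((wtau p)`_d)@_m = if mwt m == d then p@_m else 0.
Proof.
rewrite coef_wtau raddf_sum /=; under eq_bigr do rewrite mcoeffZ mcoeffX.
have [mp|mp] := boolP (m \in msupp p); last first.
  rewrite (memN_msupp_eq0 mp) if_same big1_seq // => m' /andP[_ m'p].
  have [e|] := eqVneq m' m; last by rewrite mulr0.
  by rewrite e (negbTE mp) in m'p.
rewrite big_mkcond (bigD1_seq m) ?msupp_uniq //= eqxx mulr1.
rewrite big1 ?addr0 // => m' /negbTE m'm.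
by rewrite m'm mulr0 if_same.
Qed.

Lemma wgeP N p : wge N p <-> forall d, (d < N)%N -> (wtau p)`_d = 0.
Proof.
split=> h.
  move=> d dN; apply/mpolyP => m; rewrite mcoeff_wtau mcoeff0.
  case: eqP => // e; apply/eqP/negPn/negP => /h.
  by rewrite e leqNgt dN.
move=> m pm; rewrite leqNgt; apply/negP => /h /(congr1 (mcoeff m)).
by rewrite mcoeff_wtau eqxx mcoeff0 => /eqP; apply/negP.
Qed.

(** The first hypothesis says that p has value at most N; a monomial weight is a valuation because
    orders in T add. *)
Lemma wge_divl N M p q : ~ wge N.+1 p -> wge (N + M) (p * q) -> wge M q.
Proof.
move=> hP; rewrite !wgeP (rmorphM wtau) /=; move: hP; rewrite wgeP.
move: (wtau p) (wtau q) => P Q hP hPQ; apply: (coef_low_divl (N := N)) hPQ.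
by move=> h; apply: hP => d; rewrite ltnS => /h.
Qed.
End WeightOrder.

Lemma wge_exact n (k : fieldType) (v : 'I_n -> nat) (p : {mpoly k[n]}) :
  p != 0 -> exists N, ~ wge v N.+1 p.
Proof.
move=> p0; exists (mwt v (mlead p)) => /(_ (mlead p)).
by rewrite mleadc_eq0 p0 ltnn => /(_ isT).
Qed.

Lemma wge_sum n (k : fieldType) (v : 'I_n -> nat) N (I : Type) (r : seq I)
    (P : pred I) (F : I -> {mpoly k[n]}) :
  (forall i, P i -> wge v N (F i)) -> wge v N (\sum_(i <- r | P i) F i).
Proof.
by move=> h; elim/big_ind: _ => //; [apply: wge0 | apply: wgeD].
Qed.

Lemma wge_mmap n n' (k : fieldType) (v : 'I_n -> nat) (v' : 'I_n' -> nat)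
    (h : 'I_n -> {mpoly k[n']}) N (p : {mpoly k[n]}) :
  (forall i, wge v' (v i) (h i)) -> wge v N p ->
  wge v' N (mmap (@mpolyC n' k) h p).
Proof.
move=> hh hp; rewrite /mmap big_seq; apply: wge_sum => m.
rewrite mcoeff_msupp => /hp hm; rewrite mul_mpolyC; apply/wgeC/(wgeW hm).
rewrite /mwt /mmap1; elim/big_ind2: _ => [|a p1 b p2|i _].
- exact: wge_le0.
- exact: wgeM.
- by rewrite mulnC; apply: wgeXn.
Qed.

(** * The ideal and its powers *)

Section Parametrization.
Variable k : fieldType.
Local Notation S := {mpoly k[3]}.
Local Notation B := {mpoly k[2]}.
Local Notation x := (vx k).
Local Notation y := (vy k).
Local Notation z := (vz k).

Definition vs : B := 'X_(@Ordinal 2 0 isT).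
Definition vt : B := 'X_(@Ordinal 2 1 isT).

Definition vw : S := y * z - x ^+ 6.

(** S/(w) is the A_5 singularity y z = x^6, the ring spanned by the monomials s^i t^j with i
    congruent to j modulo 6. *)
Definition paramB : S -> B :=
  mmap (@mpolyC 2 k) (fun i : 'I_3 => nth 0 [:: vs * vt; vs ^+ 6; vt ^+ 6] i).
HB.instance Definition _ := GRing.RMorphism.on paramB.

Lemma paramB_x : paramB x = vs * vt.
Proof. by rewrite /paramB mmapX mmap1U. Qed.
Lemma paramB_y : paramB y = vs ^+ 6.
Proof. by rewrite /paramB mmapX mmap1U. Qed.
Lemma paramB_z : paramB z = vt ^+ 6.
Proof. by rewrite /paramB mmapX mmap1U. Qed.
Lemma paramB_C c : paramB c%:MP = c%:MP.
Proof. by rewrite /paramB mmapC. Qed.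
Lemma paramB_scale c f : paramB (c *: f) = c *: paramB f.
Proof. by rewrite -mul_mpolyC rmorphM /= paramB_C mul_mpolyC. Qed.

Definition paramBE :=
  (paramB_x, paramB_y, paramB_z, paramB_C).
Let rmE := (rmorphB, rmorphD, rmorphM, rmorphXn, rmorph1).

Lemma paramB_w : paramB vw = 0.
Proof. by rewrite /vw !rmE /= !paramBE; ring. Qed.

Lemma mpolyX3 (m : 'X_{1..3}) :
  'X_[m] = x ^+ m (@Ordinal 3 0 isT) * y ^+ m (@Ordinal 3 1 isT)
           * z ^+ m (@Ordinal 3 2 isT).
Proof.
rewrite mpolyXE_id !big_ord_recl big_ord0 mulr1 mulrA.
by congr ('X_ _ ^+ m _ * 'X_ _ ^+ m _ * 'X_ _ ^+ m _); apply: val_inj.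
Qed.

Lemma mpolyX2 (m : 'X_{1..2}) :
  'X_[m] = vs ^+ m (@Ordinal 2 0 isT) * vt ^+ m (@Ordinal 2 1 isT).
Proof.
rewrite mpolyXE_id !big_ord_recl big_ord0 mulr1.
by congr ('X_ _ ^+ m _ * 'X_ _ ^+ m _); apply: val_inj.
Qed.

Definition mon2 (i j : nat) : B := vs ^+ i * vt ^+ j.

Definition mnm2 (i j : nat) : 'X_{1..2} :=
  [multinom (nth 0%N [:: i; j] l) | l < 2].

Lemma mon2E i j : mon2 i j = 'X_[mnm2 i j].
Proof. by rewrite mpolyX2 !mnmE. Qed.

Definition mod6 (i j : nat) : bool := (i %% 6 == j %% 6)%N.

(** For i and j congruent modulo 6, the only monomial over s^i t^j that is not divisible by y z. *)
Definition sect (i j : nat) : S :=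
  if (j <= i)%N then x ^+ j * y ^+ ((i - j) %/ 6) else x ^+ i * z ^+ ((j - i) %/ 6).

Lemma paramB_sect i j : mod6 i j -> paramB (sect i j) = mon2 i j.
Proof.
rewrite /mod6 /sect /mon2 => e; case: leqP => ij; rewrite !rmE /= !paramBE;
  rewrite exprMn -!exprM.
  have {2}-> : i = (j + 6 * ((i - j) %/ 6))%N by move: e; lia.
  by rewrite exprD; ring.
have {2}-> : j = (i + 6 * ((j - i) %/ 6))%N by move: e; lia.
by rewrite exprD; ring.
Qed.

Definition sectL (F : B) : S := \sum_(m <- msupp F)
  F@_m *: sect (m (@Ordinal 2 0 isT)) (m (@Ordinal 2 1 isT)).

Lemma sectL_is_linear : linear sectL.
Proof.
(* A degree bound gives [c *: F + G], [F] and [G] a common index set, on which linearity can be read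
   off termwise. *)
pose wd d F := \sum_(m : 'X_{1..2 < d})
  (F : B)@_m *: sect (m (@Ordinal 2 0 isT)) (m (@Ordinal 2 1 isT)).
have sectLE d F : (msize F <= d)%N -> sectL F = wd d F.
  move=> Fd; rewrite /sectL (big_mksub 'X_{1..2 < d}) ?msupp_uniq //=; first last.
    by move=> m /msize_mdeg_lt /leq_trans; apply.
  by rewrite big_rmcond //= => m /memN_msupp_eq0 ->; rewrite scale0r.
move=> c F G; pose d := maxn (msize (c *: F + G)) (maxn (msize F) (msize G)).
rewrite !(sectLE d) ?leq_max ?leqnn ?orbT // /wd scaler_sumr -big_split /=.
by apply: eq_bigr => m _; rewrite mcoeffD mcoeffZ scalerDl scalerA.
Qed.
HB.instance Definition _ := GRing.isLinear.Build k B S *:%R sectL sectL_is_linear.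

Lemma sectL_mon2 i j : sectL (mon2 i j) = sect i j.
Proof.
by rewrite mon2E /sectL msuppX big_seq1 mcoeffX eqxx scale1r !mnmE.
Qed.

Lemma mpoly3_ind (P : S -> Prop) :
  (forall c f g, P f -> P g -> P (c *: f + g)) ->
  (forall a b c, P (x ^+ a * y ^+ b * z ^+ c)) -> forall f, P f.
Proof.
move=> hl hX f; rewrite [f]mpolyE.
have P0 : P 0.
  by rewrite -(addNr (x ^+ 0 * y ^+ 0 * z ^+ 0)) -scaleN1r; apply: hl; apply: hX.
elim/big_rec: _ => // m g _ Pg; apply: hl => //; rewrite mpolyX3; apply: hX.
Qed.

Lemma mpoly3_ext (R : comNzRingType) (f g : {rmorphism S -> R}) :
  (forall c, f c%:MP = g c%:MP) -> f x = g x -> f y = g y -> f z = g z -> f =1 g.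
Proof.
move=> hc hx hy hz; elim/mpoly3_ind=> [c p q hp hq|a b c].
  by rewrite !rmorphD /= -!mul_mpolyC !rmorphM /= hc hp hq.
by rewrite !rmorphM /= !rmorphXn /= hx hy hz.
Qed.

(* Modulo w we have yz = x^6, and every monomial reduces to the section of its
   image. *)
Lemma sectL_paramB f : exists q, f = sectL (paramB f) + vw * q.
Proof.
elim/mpoly3_ind: f => [c f g [q ef] [q' eg]|a b c].
  exists (c *: q + q'); rewrite raddfD /= paramB_scale linearP mulrDr -scalerAr.
  by rewrite {1}ef {1}eg scalerDr addrACA.
have powE n : exists q, (y * z) ^+ n = x ^+ (6 * n) + vw * q.
  exists (\sum_(i < n) (y * z) ^+ (n.-1 - i) * (x ^+ 6) ^+ i).
  by rewrite -subrXX addrC -exprM subrK.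
have -> : paramB (x ^+ a * y ^+ b * z ^+ c) = mon2 (a + 6 * b) (a + 6 * c).
  by rewrite /mon2 !rmE /= !paramBE exprMn -!exprM !exprD; ring.
rewrite sectL_mon2 /sect leq_add2l leq_pmul2l // !subnDl -!mulnBr !mulKn //.
case: leqP => bc.
  have [q hq] := powE c; exists (x ^+ a * y ^+ (b - c) * q).
  rewrite -{1}(subnK bc) (exprD y) (exprD x a (6 * c)).
  transitivity (x ^+ a * y ^+ (b - c) * (y * z) ^+ c); first by rewrite exprMn; ring.
  by rewrite hq; ring.
have [q hq] := powE b; exists (x ^+ a * z ^+ (c - b) * q).
rewrite -{1}(subnK (ltnW bc)) (exprD z) (exprD x a (6 * b)).
transitivity (x ^+ a * z ^+ (c - b) * (y * z) ^+ b); first by rewrite exprMn; ring.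
by rewrite hq; ring.
Qed.

Lemma paramB_eq0 f : paramB f = 0 -> exists q, f = vw * q.
Proof.
by move=> f0; have [q ->] := sectL_paramB f; exists q; rewrite f0 raddf0 add0r.
Qed.

Lemma paramB_mod6 f m :
  (paramB f)@_m != 0 -> mod6 (m (@Ordinal 2 0 isT)) (m (@Ordinal 2 1 isT)).
Proof.
elim/mpoly3_ind: f m => [c f g hf hg m|a b c m].
  rewrite raddfD /= paramB_scale mcoeffD mcoeffZ.
  have [->|/hf//] := eqVneq (paramB f)@_m 0.
  by rewrite mulr0 add0r; apply: hg.
have -> : paramB (x ^+ a * y ^+ b * z ^+ c) = mon2 (a + 6 * b) (a + 6 * c).
  by rewrite /mon2 !rmE /= !paramBE exprMn -!exprM !exprD; ring.
rewrite mon2E mcoeffX; have [<-|_] := eqVneq (mnm2 _ _) m; last by rewrite eqxx.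
by rewrite !mnmE /mod6 /=; lia.
Qed.
End Parametrization.

Lemma in_ideal_ind (R : comNzRingType) (s : seq R) (P : R -> Prop) :
  P 0 -> (forall a f g, f \in s -> P g -> P (a * f + g)) ->
  forall f, in_ideal s f -> P f.
Proof.
move=> P0 hP _ [c ->]; elim/big_rec: _ => // i g _ Pg.
by apply: hP => //; rewrite mem_nth.
Qed.

Section InIdeal.
Variables (R : comNzRingType) (s : seq R).

Lemma in_ideal0 : in_ideal s 0.
Proof. by exists (fun=> 0); rewrite big1 // => i _; rewrite mul0r. Qed.

Lemma in_idealD f g : in_ideal s f -> in_ideal s g -> in_ideal s (f + g).
Proof.
move=> [c ->] [d ->]; exists (fun i => c i + d i).
by rewrite -big_split; apply: eq_bigr => i _; rewrite mulrDl.
Qed.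

Lemma in_idealMl a f : in_ideal s f -> in_ideal s (a * f).
Proof.
move=> [c ->]; exists (fun i => a * c i); rewrite mulr_sumr.
by apply: eq_bigr => i _; rewrite mulrA.
Qed.

Lemma in_idealMr a f : in_ideal s f -> in_ideal s (f * a).
Proof. by rewrite mulrC; apply: in_idealMl. Qed.

Lemma in_idealN f : in_ideal s f -> in_ideal s (- f).
Proof. by rewrite -mulN1r; apply: in_idealMl. Qed.

Lemma in_idealB f g : in_ideal s f -> in_ideal s g -> in_ideal s (f - g).
Proof. by move=> hf hg; apply: in_idealD => //; apply: in_idealN. Qed.

Lemma in_ideal_mem f : f \in s -> in_ideal s f.
Proof.
move=> fs; have i : (index f s < size s)%N by rewrite index_mem.
exists (fun j => (j == Ordinal i)%:R); rewrite (bigD1 (Ordinal i)) //= eqxx mul1r.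
by rewrite nth_index // big1 ?addr0 // => j /negbTE ->; rewrite mul0r.
Qed.

Lemma in_ideal_sum (I : Type) (r : seq I) (P : pred I) (F : I -> R) :
  (forall i, P i -> in_ideal s (F i)) -> in_ideal s (\sum_(i <- r | P i) F i).
Proof. by move=> h; elim/big_ind: _ => //; [apply: in_ideal0|apply: in_idealD]. Qed.
End InIdeal.

(** * Generators of I_25 *)

Section Ideal25Generators.
Variable k : fieldType.
Local Notation S := {mpoly k[3]}.
Local Notation x := (vx k).
Local Notation y := (vy k).
Local Notation z := (vz k).
Local Notation phi := (@phiH k).

HB.instance Definition _ := GRing.RMorphism.copy phi
  (mmap (@polyC k) (fun i : 'I_3 => 'X^(nth 0%N [:: 4; 9; 15]%N i))).
Let rmE := (rmorphB, rmorphD, rmorphM, rmorphXn, rmorph1).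

Lemma phiH_x : phi x = 'X^4.
Proof. by rewrite /phiH mmapX mmap1U. Qed.
Lemma phiH_y : phi y = 'X^9.
Proof. by rewrite /phiH mmapX mmap1U. Qed.
Lemma phiH_z : phi z = 'X^15.
Proof. by rewrite /phiH mmapX mmap1U. Qed.
Lemma phiH_scale c f : phi (c *: f) = c *: phi f.
Proof. by rewrite -mul_mpolyC rmorphM /= {1}/phiH mmapC mul_polyC. Qed.

Lemma phiH_mon a b c : phi (x ^+ a * y ^+ b * z ^+ c) = 'X^(4 * a + 9 * b + 15 * c).
Proof. by rewrite !rmE /= phiH_x phiH_y phiH_z -!exprM -!exprD. Qed.

Lemma sgH_muln m n : sgH n -> sgH (m * n).
Proof.
move=> hn; elim: m => [|m IHm]; first exact: submonoid0.
by rewrite mulSn; apply: submonoidD.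
Qed.

Lemma phiH_kH f : phi f \in @kH k.
Proof.
elim/mpoly3_ind: f => [c f g /asboolP hf /asboolP hg|a b c]; apply/asboolP => n.
  rewrite raddfD /= phiH_scale coefD coefZ.
  have [->|/hf//] := eqVneq (phi f)`_n 0.
  by rewrite mulr0 add0r; apply: hg.
rewrite phiH_mon coefXn; have [-> _|_] := eqVneq n _; last by rewrite eqxx.
apply: submonoidD; first apply: submonoidD.
- by rewrite mulnC; apply/sgH_muln/submonoid_in.
- by rewrite mulnC; apply/sgH_muln/submonoid_in.
- by rewrite mulnC; apply/sgH_muln/submonoid_in.
Qed.

Lemma mem_I25 f : (f \in I25 k) = ('X^25 %| phi f).
Proof. by rewrite /I25 unfold_in phiH_kH andbT. Qed.

Lemma mem_I25P f : reflect (forall d, (d < 25)%N -> (phi f)`_d = 0) (f \in I25 k).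
Proof.
rewrite mem_I25; apply: (iffP idP) => [/dvdpP[q ->] d d25|h].
  by rewrite coefMXn d25.
rewrite -[phi f](poly_take_drop 25) (dvdp_addl _ (dvdp_mulIr _ _)).
suff -> : take_poly 25 (phi f) = 0 by rewrite dvdp0.
by apply/polyP => d; rewrite coef_take_poly coef0; case: ifP => // /h ->.
Qed.

Local Notation J := (in_ideal (I25_gens k)).

(** The minimal monomials of weight at least 25 are the six monomial generators together with xyz
    and y^2 z; these two are reached through yz - x^6, both of whose terms have weight 24. *)
Lemma in_I25_gens_mon a b c : (25 <= 4 * a + 9 * b + 15 * c)%N ->
  J (x ^+ a * y ^+ b * z ^+ c).
Proof.
have split a0 b0 c0 : (a0 <= a)%N -> (b0 <= b)%N -> (c0 <= c)%N ->
    J (x ^+ a0 * y ^+ b0 * z ^+ c0) -> J (x ^+ a * y ^+ b * z ^+ c).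
  move=> /subnK <- /subnK <- /subnK <-.
  move=> /(in_idealMl (x ^+ (a - a0) * y ^+ (b - b0) * z ^+ (c - c0))).
  by congr in_ideal; rewrite !exprD; ring.
have mem i : (i < 7)%N -> J (nth 0 (I25_gens k) i).
  by move=> i7; apply/in_ideal_mem/mem_nth.
have Jx7 : J (x ^+ 7) := mem 1 isT.
have J0 : J (y * z - x ^+ 6) := mem 0 isT.
have J2 : J (x ^+ 4 * y) := mem 2 isT.
have J3 : J (x ^+ 2 * y ^+ 2) := mem 3 isT.
have J4 : J (x ^+ 3 * z) := mem 4 isT.
have J5 : J (y ^+ 3) := mem 5 isT.
have J6 : J (z ^+ 2) := mem 6 isT.
move=> h; have [c2|c2] := leqP 2 c.
  by apply: (split 0 0 2) => //; rewrite !mul1r.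
have [b3|b3] := leqP 3 b; first by apply: (split 0 3 0) => //; rewrite mul1r mulr1.
have [/eqP c0|c0] := boolP (c == 0)%N.
  have [b0|b0] := leqP b 0; first by apply: (split 7 0 0); rewrite ?mulr1 //; lia.
  have [b1|b1] := leqP b 1; first by apply: (split 4 1 0); rewrite ?mulr1 //; lia.
  by apply: (split 2 2 0); rewrite ?mulr1 //; lia.
have [b0|b0] := leqP b 0; first by apply: (split 3 0 1); rewrite ?mulr1 //; lia.
have [a1|a1] := leqP 1 a.
  apply: (split 1 1 1); try lia.
  have -> : x ^+ 1 * y ^+ 1 * z ^+ 1 = x * (y * z - x ^+ 6) + x ^+ 7 by ring.
  by apply: in_idealD => //; apply: in_idealMl.
apply: (split 0 2 1); try lia.
have -> : x ^+ 0 * y ^+ 2 * z ^+ 1 = y * (y * z - x ^+ 6) + x ^+ 2 * (x ^+ 4 * y) by ring.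
by apply: in_idealD; apply: in_idealMl.
Qed.

(** Below 25 the only weight shared by two of these monomials is 24, where yz precedes x^6 in the
    enumeration. Weights outside H get the default monomial 1, which is harmless because the image
    of [phiH] has no coefficient there. *)
Definition small_mon (d : nat) : nat * nat * nat :=
  nth (0, 0, 0)%N [seq u <- [seq (ab, c) |
      ab <- [seq (a, b) | a <- iota 0 7, b <- iota 0 3], c <- iota 0 2]
      | (u.1.1 * 4 + u.1.2 * 9 + u.2 * 15 == d)%N] 0.

(* Below weight 25 a monomial is determined by its weight modulo I_25. *)
Definition nf25 (g : {poly k}) : S := \sum_(d < 25)
  g`_d *: (x ^+ (small_mon d).1.1 * y ^+ (small_mon d).1.2 * z ^+ (small_mon d).2).

Lemma nf25_phiH f : J (f - nf25 (phi f)).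
Proof.
elim/mpoly3_ind: f => [e f g hf hg|a b c].
  have -> : e *: f + g - nf25 (phi (e *: f + g)) =
      e%:MP * (f - nf25 (phi f)) + (g - nf25 (phi g)).
    rewrite raddfD /= phiH_scale mul_mpolyC scalerBr addrACA -opprD; congr (_ - _).
    rewrite /nf25 [X in _ = X + _]scaler_sumr -big_split /=; apply: eq_bigr => d _.
    by rewrite coefD coefZ scalerDl scalerA.
  by apply: in_idealD => //; apply: in_idealMl.
rewrite phiH_mon; have [h|h] := leqP 25 (4 * a + 9 * b + 15 * c).
  rewrite [nf25 _]big1 ?subr0 => [|d _]; first exact: in_I25_gens_mon.
  rewrite coefXn; case: eqP => e; last by rewrite scale0r.
  by move: (ltn_ord d); rewrite e; lia.
rewrite /nf25 (bigD1 (Ordinal h)) //= coefXn eqxx scale1r big1 ?addr0.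
  have a7 : (a < 7)%N by lia.
  have b3 : (b < 3)%N by lia.
  have c2 : (c < 2)%N by lia.
  move: h; case: a a7 => [|[|[|[|[|[|[|//]]]]]]] _;
  case: b b3 => [|[|[|//]]] _; case: c c2 => [|[|//]] _ h //;
    rewrite /small_mon /= ?subrr; try exact: in_ideal0.
  (* The one case in which a monomial differs from its representative: x^6 against yz. *)
  have := in_idealN (@in_ideal_mem _ (I25_gens k) _ (mem_head _ _)).
  by congr in_ideal; rewrite !expr0 !expr1 !mul1r !mulr1 opprB.
move=> d /negP di; rewrite coefXn; case: eqP => e; last by rewrite scale0r.
by case: di; apply/eqP/val_inj.
Qed.

Lemma I25P f : f \in I25 k <-> J f.
Proof.
split=> [/mem_I25P h|].
  have := nf25_phiH f; rewrite [nf25 _]big1 ?subr0 // => d _.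
  by rewrite h ?scale0r.
move: f; apply: in_ideal_ind => [|a f g fJ]; first by apply/mem_I25P => d _; rewrite raddf0 coef0.
rewrite !mem_I25 rmorphD rmorphM /= => hg; rewrite dvdp_add // dvdp_mull //.
have phm a1 b1 c1 : (25 <= 4 * a1 + 9 * b1 + 15 * c1)%N ->
    'X^25 %| phi (x ^+ a1 * y ^+ b1 * z ^+ c1).
  by move=> h; rewrite phiH_mon dvdp_exp2l.
move: fJ; rewrite !inE => /orP[/eqP->|].
  have -> : y * z - x ^+ 6 = x ^+ 0 * y ^+ 1 * z ^+ 1 - x ^+ 6 * y ^+ 0 * z ^+ 0 by ring.
  by rewrite rmorphB /= !phiH_mon subrr dvdp0.
case/or4P => [/eqP->|/eqP->|/eqP->|/or3P[] /eqP->].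
- by have := phm 7 0 0 isT; congr (_ %| phi _); ring.
- by have := phm 4 1 0 isT; congr (_ %| phi _); ring.
- by have := phm 2 2 0 isT; congr (_ %| phi _); ring.
- by have := phm 3 0 1 isT; congr (_ %| phi _); ring.
- by have := phm 0 3 0 isT; congr (_ %| phi _); ring.
- by have := phm 0 0 2 isT; congr (_ %| phi _); ring.
Qed.
End Ideal25Generators.

(** * Powers of I as valuation ideals *)

Section Powers25.
Variable k : fieldType.
Local Notation S := {mpoly k[3]}.
Local Notation B := {mpoly k[2]}.
Local Notation pw := (ideal_pow (fun x => x \in I25 k)).
Local Notation x := (vx k).
Local Notation y := (vy k).
Local Notation z := (vz k).
Local Notation w := (vw k).
Let rmE := (rmorphB, rmorphD, rmorphM, rmorphXn, rmorph1).

(** The points of the lattice i = j modulo 6 in n times the Newton polyhedron of I S/(w). Its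
    vertices (0,12) and (18,0) lie on the axes, so the three edges are the only conditions. *)
Definition cone (n i j : nat) : bool :=
  [&& mod6 i j, (12 * n <= i + j)%N, (78 * n <= 5 * i + 7 * j)%N
    & (18 * n <= i + 2 * j)%N].

(* The images of z^2, x^3 z, x^7, x^4 y, x^2 y^2, y^3. *)
Definition cone_gens : seq (nat * nat) :=
  [:: (0, 12); (3, 9); (7, 7); (10, 4); (14, 2); (18, 0)]%N.

(** Every lattice point of the (n+1)-fold polyhedron is a generator plus a lattice point of the
    n-fold one; hence the powers of I S/(w) contain every monomial that the valuations allow. *)
Lemma cone_step n i j : cone n.+1 i j -> exists p, [/\ p \in cone_gens,
  (p.1 <= i)%N, (p.2 <= j)%N & cone n (i - p.1) (j - p.2)].
Proof.
rewrite /cone /mod6 => /and4P[/eqP m h1 h2 h3].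
have E p : p \in cone_gens -> (p.1 <= i)%N -> (p.2 <= j)%N ->
   (12 * n <= (i - p.1) + (j - p.2))%N ->
   (78 * n <= 5 * (i - p.1) + 7 * (j - p.2))%N ->
   (18 * n <= (i - p.1) + 2 * (j - p.2))%N ->
   exists p, [/\ p \in cone_gens, (p.1 <= i)%N, (p.2 <= j)%N &
     [&& ((i - p.1) %% 6 == (j - p.2) %% 6)%N, (12 * n <= (i - p.1) + (j - p.2))%N,
         (78 * n <= 5 * (i - p.1) + 7 * (j - p.2))%N &
         (18 * n <= (i - p.1) + 2 * (j - p.2))%N]].
  move=> pin pi pj a1 a2 a3; exists p; split=> //; apply/and4P; split=> //.
  move: pin pi pj; rewrite !inE.
  by do ![case/orP|move/eqP->] => /=; move: m; clear; lia.
(* Above the diagonal z^2 and x^3 z suffice; on and below it the other four generators do. *)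
have [ij|ij] := ltnP i j.
  have [c hc] : exists c, j = (i + 6 * c)%N.
    by exists ((j - i) %/ 6)%N; move: m ij; clear; lia.
  have [i2|i2] := leqP i 2; [apply: (E (0, 12)%N) | apply: (E (3, 9)%N)] => //=;
    by move: hc h1 h2 h3 ij i2; clear; lia.
have [b hb] : exists b, i = (j + 6 * b)%N.
  by exists ((i - j) %/ 6)%N; move: m ij; clear; lia.
have [j3|j3] := leqP j 3.
  have [b2|b2] := leqP b 2; [apply: (E (14, 2)%N) | apply: (E (18, 0)%N)] => //=;
    by move: hb h1 h2 h3 j3 b2; clear; lia.
have [i9|i9] := leqP i 9; [apply: (E (7, 7)%N) | apply: (E (10, 4)%N)] => //=;
  by move: hb h1 h2 h3 j3 i9; clear; lia.
Qed.

Lemma mon_I25 a b c : (25 <= 4 * a + 9 * b + 15 * c)%N ->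
  x ^+ a * y ^+ b * z ^+ c \in I25 k.
Proof. by move=> h; rewrite mem_I25 phiH_mon dvdp_exp2l. Qed.

Lemma sect_gen_I25 p : p \in cone_gens -> sect k p.1 p.2 \in I25 k.
Proof.
have my a b : (25 <= 4 * a + 9 * b)%N -> x ^+ a * y ^+ b \in I25 k.
  by move=> h; rewrite -[X in X \in _](mulr1) -(expr0 z) mon_I25 ?addn0.
have mz a c : (25 <= 4 * a + 15 * c)%N -> x ^+ a * z ^+ c \in I25 k.
  by move=> h; rewrite -[x ^+ a]mulr1 -(expr0 y) mon_I25 ?addn0.
by rewrite !inE /sect; do ![case/orP|move/eqP->]; rewrite /= ?my ?mz.
Qed.

Lemma pow_sum n (T : Type) (r : seq T) (P : pred T) (F : T -> S) :
  (forall i, P i -> pw n (F i)) -> pw n (\sum_(i <- r | P i) F i).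
Proof. by move=> h; elim/big_ind: _ => //; [apply: ideal_pow0|apply: ideal_powD]. Qed.

Lemma pow_mem n f g : f \in I25 k -> pw n g -> pw n.+1 (f * g).
Proof.
move=> hf hg; exists [:: (f, g)]; last by rewrite big_seq1.
by move=> u; rewrite inE => /eqP ->.
Qed.

Lemma pow1 f : f \in I25 k -> pw 1 f.
Proof. by move=> hf; rewrite -[f]mulr1; apply: pow_mem. Qed.

Lemma cone_lift n i j : cone n i j -> exists2 g, pw n g & paramB g = mon2 k i j.
Proof.
elim: n i j => [|n IHn] i j; first by case/and4P => m *; exists (sect k i j); rewrite ?paramB_sect.
move=> h; have [p [pin pi pj /IHn[g hg eg]]] := cone_step h.
exists (sect k p.1 p.2 * g); first by apply: pow_mem => //; apply: sect_gen_I25.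
have pm : mod6 p.1 p.2.
  by move: pin; rewrite !inE; do ![case/orP|move/eqP->].
rewrite rmorphM /= paramB_sect // eg /mon2 -{2}(subnKC pi) -{2}(subnKC pj) !exprD.
by ring.
Qed.

Definition in_cone (n : nat) (F : B) : Prop := forall m, F@_m != 0 ->
  cone n (m (@Ordinal 2 0 isT)) (m (@Ordinal 2 1 isT)).

(** Monomials lift to the n-th power one by one, and the error lies in the kernel (w) of
    [paramB]. *)
Lemma in_cone_lift n (f : S) : in_cone n (paramB f) ->
  exists g q, pw n g /\ f = g + w * q.
Proof.
move=> hf.
have [g hg eg] : exists2 g, pw n g & paramB g = paramB f.
  move: (paramB f) hf => F hF.
  suff [g hg eg] : exists2 g, pw n g &
      paramB g = \sum_(m <- msupp F | m \in msupp F) F@_m *: 'X_[m].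
    by exists g; rewrite // eg -big_seq -mpolyE.
  elim/big_rec: _ => [|m G mF [g hg eg]].
    by exists 0; rewrite ?raddf0 //; apply: ideal_pow0.
  have [|h hh eh] := @cone_lift n (m (@Ordinal 2 0 isT)) (m (@Ordinal 2 1 isT)).
    by apply: hF; rewrite -mcoeff_msupp.
  exists (F@_m *: h + g); first by apply: ideal_powD => //; rewrite -mul_mpolyC; apply: ideal_powZ.
  by rewrite raddfD /= paramB_scale eh eg mpolyX2.
have [|q hq] := @paramB_eq0 k (f - g); first by rewrite raddfB /= eg subrr.
by exists g, q; split; rewrite // -hq addrC subrK.
Qed.

(* Weights of s, t and omega for the three edges of the Newton polygon of I_25
   S/(w), and the value of I_25. *)
Definition edge_weights (l : 'I_3) : seq nat :=
  nth [::] [:: [:: 1; 1; 6]; [:: 5; 7; 48]; [:: 1; 2; 12]]%N l.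
Definition edge_value (l : 'I_3) : nat := nth 0%N [:: 12; 78; 18]%N l.
Definition wE l (i : 'I_3) : nat := nth 0%N (edge_weights l) i.
Definition wB l (i : 'I_2) : nat := nth 0%N (edge_weights l) i.

Definition es : S := 'X_(@Ordinal 3 0 isT).
Definition et : S := 'X_(@Ordinal 3 1 isT).
Definition eo : S := 'X_(@Ordinal 3 2 isT).

Definition paramE : S -> S :=
  mmap (@mpolyC 3 k) (fun i : 'I_3 => nth 0 [:: es * et; es ^+ 6; et ^+ 6 + eo] i).
HB.instance Definition _ := GRing.RMorphism.on paramE.

Lemma paramE_x : paramE x = es * et.
Proof. by rewrite /paramE mmapX mmap1U. Qed.
Lemma paramE_y : paramE y = es ^+ 6.
Proof. by rewrite /paramE mmapX mmap1U. Qed.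
Lemma paramE_z : paramE z = et ^+ 6 + eo.
Proof. by rewrite /paramE mmapX mmap1U. Qed.
Lemma paramE_w : paramE w = es ^+ 6 * eo.
Proof. by rewrite /vw !rmE /= paramE_x paramE_y paramE_z; ring. Qed.

Definition omega0 : S -> B :=
  mmap (@mpolyC 2 k) (fun i : 'I_3 => nth 0 [:: vs k; vt k; 0] i).
HB.instance Definition _ := GRing.RMorphism.on omega0.

Lemma omega0_paramE f : omega0 (paramE f) = paramB f.
Proof.
move: f; apply: (mpoly3_ext (f := omega0 \o paramE) (g := @paramB k)) => [c|||] /=.
- by rewrite /paramE /omega0 /paramB !mmapC.
- by rewrite paramE_x paramB_x rmorphM /= /omega0 !mmapX !mmap1U.
- by rewrite paramE_y paramB_y rmorphXn /= /omega0 !mmapX !mmap1U.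
- by rewrite paramE_z paramB_z rmorphD rmorphXn /= /omega0 !mmapX !mmap1U addr0.
Qed.

(** Setting omega to 0 only drops monomials, so no value decreases. *)
Lemma wge_omega0 l N F : wge (wE l) N F -> wge (wB l) N (omega0 F).
Proof.
apply: wge_mmap => -[[|[|[|//]]] i] /=; last exact: wge0.
- exact: (wgeX (wB l)).
- exact: (wgeX (wB l)).
Qed.

(** The three lists are the values of x, y and z on the three edges; that of z is 6 times the weight
    of t, since omega weighs at least as much. *)
Lemma wge_paramE_mon (l : 'I_3) a b c N :
  (N <= a * nth 0 [:: 2; 12; 3] l + b * nth 0 [:: 6; 30; 6] l
       + c * nth 0 [:: 6; 42; 12] l)%N ->
  wge (wE l) N (paramE (x ^+ a * y ^+ b * z ^+ c)).
Proof.
have hs : wge (wE l) (nth 0%N (edge_weights l) 0) es := @wgeX _ k (wE l) (@Ordinal 3 0 isT).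
have ht : wge (wE l) (nth 0%N (edge_weights l) 1) et := @wgeX _ k (wE l) (@Ordinal 3 1 isT).
have ho : wge (wE l) (nth 0%N (edge_weights l) 2) eo := @wgeX _ k (wE l) (@Ordinal 3 2 isT).
move=> h; apply: (wgeW h); rewrite !rmorphM !rmorphXn /= paramE_x paramE_y paramE_z.
apply: wgeM; first apply: wgeM; apply: wgeXn.
- by apply: (wgeW _ (wgeM hs ht)); case: (l) => [[|[|[|//]]] ?].
- by apply: (wgeW _ (wgeXn (e := 6) hs)); case: (l) => [[|[|[|//]]] ?].
apply: wgeD; first by apply: (wgeW _ (wgeXn (e := 6) ht)); case: (l) => [[|[|[|//]]] ?].
by apply: (wgeW _ ho); case: (l) => [[|[|[|//]]] ?].
Qed.

Lemma wge_paramE_I25 l f : f \in I25 k -> wge (wE l) (edge_value l) (paramE f).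
Proof.
move/I25P; move: f; apply: in_ideal_ind => [|a f g fJ hg].
  by rewrite raddf0; apply: wge0.
rewrite rmorphD rmorphM; apply: wgeD => //=; rewrite -[edge_value l]add0n.
apply: wgeM; first exact: wge_le0.
have mon a' b' c' : [&& 12 <= a' * 2 + b' * 6 + c' * 6, 78 <= a' * 12 + b' * 30 + c' * 42
   & 18 <= a' * 3 + b' * 6 + c' * 12]%N ->
   wge (wE l) (edge_value l) (paramE (x ^+ a' * y ^+ b' * z ^+ c')).
  case/and3P=> h1 h2 h3; apply: wge_paramE_mon.
  by move: h1 h2 h3; rewrite /edge_value; case: (l) => [[|[|[|//]]] ?].
move: fJ; rewrite !inE => /orP[/eqP->|].
  have := paramE_w; rewrite /vw => ->.
  have := wgeM (wgeXn (e := 6) (@wgeX _ k (wE l) (@Ordinal 3 0 isT)))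
               (@wgeX _ k (wE l) (@Ordinal 3 2 isT)).
  by apply: wgeW; case: (l) => [[|[|[|//]]] ?].
case/or4P => [/eqP->|/eqP->|/eqP->|/or3P[] /eqP->].
- by have := mon 7 0 0 isT; congr (wge _ _ (paramE _)); ring.
- by have := mon 4 1 0 isT; congr (wge _ _ (paramE _)); ring.
- by have := mon 2 2 0 isT; congr (wge _ _ (paramE _)); ring.
- by have := mon 3 0 1 isT; congr (wge _ _ (paramE _)); ring.
- by have := mon 0 3 0 isT; congr (wge _ _ (paramE _)); ring.
- by have := mon 0 0 2 isT; congr (wge _ _ (paramE _)); ring.
Qed.

Lemma wge_paramE_pow l n f : pw n f -> wge (wE l) (n * edge_value l) (paramE f).
Proof.
elim: n f => [|n IHn] f /=; first by move=> _; apply: wge_le0.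
case=> s hs ->; rewrite big_seq rmorph_sum; apply: wge_sum => u /hs[h1 h2].
by rewrite rmorphM mulSn; apply: wgeM; [apply: wge_paramE_I25 | apply: IHn].
Qed.

Lemma in_cone_paramB n f : (forall l, wge (wE l) (n * edge_value l) (paramE f)) ->
  in_cone n (paramB f).
Proof.
move=> h m fm.
have hl l : (n * edge_value l <= mwt (wB l) m)%N.
  by have /wge_omega0 := h l; rewrite omega0_paramE; apply.
apply/and4P; split; first exact: paramB_mod6 fm.
all: [> have := hl (@Ordinal 3 0 isT) | have := hl (@Ordinal 3 1 isT)
   | have := hl (@Ordinal 3 2 isT)];
  rewrite /mwt !big_ord_recl big_ord0 /= /wB /= /edge_value /=;
  set m0 := m _; set m1 := m _;
  rewrite (_ : m (@Ordinal 2 0 isT) = m0); try (by congr (m _); apply: val_inj);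
  rewrite (_ : m (@Ordinal 2 1 isT) = m1); try (by congr (m _); apply: val_inj); lia.
Qed.

Lemma in_cone_pow n f : pw n f -> in_cone n (paramB f).
Proof. by move=> hf; apply: in_cone_paramB => l; apply: wge_paramE_pow. Qed.

(** The image of w is the single monomial s^6 omega, and the weight of omega was chosen to make its
    weight the edge value. *)
Lemma wge_paramE_w l : ~ wge (wE l) (edge_value l).+1 (paramE w).
Proof.
rewrite paramE_w /es /eo mpolyXn -mpolyXD.
move=> /(_ (U_(@Ordinal 3 0 isT) *+ 6 + U_(@Ordinal 3 2 isT))%MM).
rewrite mcoeffX eqxx oner_eq0 => /(_ isT).
rewrite mwtD mwtU (_ : mwt _ _ = 6 * wE l (@Ordinal 3 0 isT))%N; last first.
  rewrite -mwtU /mwt big_distrr /=; apply: eq_bigr => i _.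
  by rewrite mulmnE mulnA mulnC.
by case: (l) => [[|[|[|//]]] ?].
Qed.

Lemma wge_paramE_divw l N f :
  wge (wE l) (edge_value l + N) (paramE (w * f)) -> wge (wE l) N (paramE f).
Proof. by rewrite rmorphM; apply: wge_divl; apply: wge_paramE_w. Qed.

(* By induction on n, since f is congruent modulo w to a combination of
   monomials of the n-th power. *)
Lemma powP n f : pw n f <-> forall l, wge (wE l) (n * edge_value l) (paramE f).
Proof.
split=> [h l|]; first exact: wge_paramE_pow.
elim: n f => // n IHn f h.
have [g [q [hg ef]]] := in_cone_lift (in_cone_paramB h).
rewrite ef; apply: ideal_powD => //; apply: pow_mem.
  by apply/I25P/in_ideal_mem; rewrite mem_head.
apply: IHn => l; apply: wge_paramE_divw; rewrite -mulSn.
have -> : w * q = f - g by rewrite ef addrC addKr.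
by rewrite rmorphB; apply: wgeB => //; apply: wge_paramE_pow.
Qed.

Lemma pow_divw n f : pw n.+1 (w * f) -> pw n f.
Proof.
move/powP=> h; apply/powP => l; apply: wge_paramE_divw.
by rewrite -mulSn; apply: h.
Qed.
End Powers25.

(** * Divisibility by w, b and c *)

Section Divisibility25.
Variable k : fieldType.
Local Notation S := {mpoly k[3]}.
Local Notation B := {mpoly k[2]}.
Local Notation pw := (ideal_pow (fun x => x \in I25 k)).
Local Notation x := (vx k).
Local Notation y := (vy k).
Local Notation z := (vz k).
Local Notation w := (vw k).
Local Notation vs := (vs k).
Local Notation vt := (vt k).

Lemma mnm2_eta (m : 'X_{1..2}) :
  m = mnm2 (m (@Ordinal 2 0 isT)) (m (@Ordinal 2 1 isT)).
Proof.
by apply/mnmP => i; rewrite !mnmE; case: i => [[|[|//]]] i; congr (m _); apply: val_inj.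
Qed.

Lemma mnm2_inj i j i' j' : (mnm2 i j == mnm2 i' j') = (i == i') && (j == j').
Proof.
apply/eqP/andP => [e|[/eqP-> /eqP->]//].
by split; apply/eqP; [have := congr1 (fun m : 'X_{1..2} => m (@Ordinal 2 0 isT)) e
  | have := congr1 (fun m : 'X_{1..2} => m (@Ordinal 2 1 isT)) e]; rewrite !mnmE.
Qed.

Lemma mwt_mnm2 (v : 'I_2 -> nat) i j :
  mwt v (mnm2 i j) = (v (@Ordinal 2 0 isT) * i + v (@Ordinal 2 1 isT) * j)%N.
Proof.
rewrite /mwt !big_ord_recl big_ord0 !mnmE addn0 /=.
by congr (v _ * _ + v _ * _)%N; apply: val_inj.
Qed.

Lemma vw_neq0 : w != 0.
Proof.
apply/eqP => w0; apply: (@wge_paramE_w k ord0).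
by rewrite w0 raddf0; apply: wge0.
Qed.

Lemma msize_w : (2 < msize w)%N.
Proof.
apply: (@leq_trans (mdeg (U_(@Ordinal 3 1 isT) + U_(@Ordinal 3 2 isT))%MM).+1).
  by rewrite mdegD !mdeg1.
apply: msize_mdeg_lt; rewrite mcoeff_msupp /vw /vx /vy /vz -mpolyXD mpolyXn mcoeffB.
rewrite !mcoeffX eqxx (_ : (_ *+ 6 == _)%MM = false) ?subr0 ?oner_eq0 //.
apply/negP => /eqP /(congr1 (fun m : 'X_{1..3} => m (@Ordinal 3 0 isT))).
by rewrite mulmnE !mnmE.
Qed.

(** A kernel element is also killed by [paramB], hence equals w q with q again in the kernel and of
    smaller degree. *)
Lemma paramE_inj (f : S) : paramE f = 0 -> f = 0.
Proof.
elim/(@ltn_ind) : {f}(msize f) {-2}f (erefl (msize f)) => d IHd f fd f0.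
have [|q fq] := @paramB_eq0 k f; first by rewrite -omega0_paramE f0 raddf0.
apply/eqP; apply: contraTT isT => fN0.
have qN0 : q != 0 by apply: contraNneq fN0 => q0; rewrite fq q0 mulr0.
have /eqP : paramE w * paramE q = 0 by rewrite -rmorphM -fq.
rewrite mulf_eq0 => /orP[/eqP pw0|/eqP q0].
  by case: (@wge_paramE_w k ord0); rewrite pw0; apply: wge0.
have dq : (msize q < d)%N.
  have := msizeM vw_neq0 qN0; rewrite -fq fd => ->; move: msize_w.
  by move: (msize w) (msize q) => a b; clear; lia.
by rewrite (IHd _ dq q erefl q0) eqxx in qN0.
Qed.

Lemma wge_expN n (v : 'I_n -> nat) e (F : {mpoly k[n]}) i :
  ~ wge v e.+1 F -> ~ wge v (i * e).+1 (F ^+ i).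
Proof.
move=> hF; elim: i => [|i IHi].
  by move=> /(_ 0%MM); rewrite expr0 mcoeff1 eqxx oner_eq0 mwt0 => /(_ isT).
by rewrite exprS mulSn -addnS => /(wge_divl hF).
Qed.

(* Each weight is a valuation: if d f^n has value at least (p + n q) c for all n,
   then f has value at least q c, whatever the value of d. *)
Lemma pow_root (p q : nat) (d f : S) : d != 0 ->
  (forall n, pw (p + n * q) (d * f ^+ n)) -> pw q f.
Proof.
move=> d0 h; apply/powP => l; apply: contrapT => nf.
have [N hN] : exists N, ~ wge (wE l) N.+1 (paramE d).
  by apply: wge_exact; apply: contraNneq d0 => /paramE_inj ->.
case qc: (q * edge_value l)%N nf => [|e] nf.
  by apply: nf; apply: wge_le0.
(* Each factor f falls short by at least 1, so N + 1 of them cannot be made up by the value of d,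
   which is at most N. *)
have := h N.+1 => /powP /(_ l); rewrite rmorphM rmorphXn /= => hw.
apply: (wge_expN (i := N.+1) nf); apply: (wge_divl hN).
by apply: wgeW hw; rewrite mulnDl -mulnA qc; lia.
Qed.

Lemma in_cone_wge n (f : S) : in_cone n (paramB f) <->
  forall l, wge (wB l) (n * edge_value l) (paramB f).
Proof.
split=> [h l m /h|h m fm].
  case/and4P=> _ h1 h2 h3; rewrite {1}(mnm2_eta m) mwt_mnm2.
  by case: l => [[|[|[|//]]] ?]; rewrite /wB /edge_value /=; lia.
have hl l : (n * edge_value l <= mwt (wB l) m)%N by apply: (h l).
have h1 := hl (@Ordinal 3 0 isT); have h2 := hl (@Ordinal 3 1 isT).
have h3 := hl (@Ordinal 3 2 isT); move: h1 h2 h3.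
rewrite {1 2 3}(mnm2_eta m) !mwt_mnm2 /wB /edge_value /= => h1 h2 h3.
by apply/and4P; split; [exact: paramB_mod6 fm | lia..].
Qed.

(** b carries the vertices (0,12) and (10,4) of the Newton polygon, and c the vertices (18,0) and
    (3,9). *)
Definition vb : S := z ^+ 2 - x ^+ 4 * y.
Definition vc : S := y ^+ 3 - x ^+ 3 * z.

Lemma paramB_b : paramB vb = mon2 k 0 12 - mon2 k 10 4.
Proof.
rewrite /vb /mon2 rmorphB [X in _ - X]rmorphM !rmorphXn /= paramB_x paramB_y paramB_z.
by ring.
Qed.

Lemma paramB_c : paramB vc = mon2 k 18 0 - mon2 k 3 9.
Proof.
rewrite /vc /mon2 rmorphB [X in _ - X]rmorphM !rmorphXn /= paramB_x paramB_y paramB_z.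
by ring.
Qed.

Lemma wge_paramB_b l : ~ wge (wB l) (edge_value l).+1 (paramB vb).
Proof.
rewrite paramB_b => h.
have h1 := h (mnm2 0 12); have h2 := h (mnm2 10 4); move: h1 h2 {h}.
rewrite !mcoeffB !mon2E !mcoeffX !mnm2_inj /= subr0 sub0r oppr_eq0 oner_eq0.
by rewrite !mwt_mnm2 => /(_ isT) + /(_ isT); case: l => [[|[|[|//]]] ?].
Qed.

(* The leading form of b on every edge is nonzero. *)
Lemma pow_divb n f g h : vb * f = w * g + h -> pw n.+1 h ->
  exists g' h', f = w * g' + h' /\ pw n h'.
Proof.
move=> e hh.
have [|h' [g' [hh' ->]]] := @in_cone_lift k n f; last by exists g', h'; rewrite addrC.
apply/in_cone_wge => l; apply: (wge_divl (@wge_paramB_b l)).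
have -> : paramB vb * paramB f = paramB h.
  by rewrite -rmorphM e rmorphD rmorphM /= paramB_w mul0r add0r.
rewrite -mulSn; move: l; apply/in_cone_wge; exact: in_cone_pow.
Qed.

Lemma paramB_subM (f g h : S) : paramB (f - g * h) = paramB f - paramB g * paramB h.
Proof. by rewrite rmorphB rmorphM. Qed.

Lemma paramBM (f g : S) : paramB (f * g) = paramB f * paramB g.
Proof. exact: rmorphM. Qed.

Lemma paramB_mulDw (f g h : S) : paramB (f * g + w * h) = paramB f * paramB g.
Proof. by rewrite rmorphD !rmorphM /= paramB_w mul0r addr0. Qed.

Lemma mon2X i j : mon2 k i j = vs ^+ i * vt ^+ j.
Proof. by []. Qed.

#[local] Opaque paramB wtau vb vc mon2 vw mnm2.

Lemma size_wtau n (v : 'I_n -> nat) (F : {mpoly k[n]}) N :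
  (forall m, F@_m != 0 -> (mwt v m < N)%N) -> (size (wtau v F) <= N)%N.
Proof.
move=> h; apply/leq_sizeP => d Nd; apply/mpolyP => m; rewrite mcoeff_wtau mcoeff0.
case: eqP => // e; apply: contraTeq Nd => /h.
by rewrite e ltnNge.
Qed.

Lemma wtau_eq0 n (v : 'I_n -> nat) (F : {mpoly k[n]}) : (wtau v F == 0) = (F == 0).
Proof.
apply/eqP/eqP => [h|->]; last exact: raddf0.
apply/mpolyP => m; have := congr1 (fun p : {poly _} => (p`_(mwt v m))@_m) h.
by rewrite mcoeff_wtau eqxx coef0 !mcoeff0.
Qed.

Let v34 (i : 'I_2) : nat := nth 0%N [:: 3; 4]%N i.

Lemma lead_coef_binomial (E : idomainType) (a a' : E) d d' : a != 0 -> (d' < d)%N ->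
  lead_coef (a%:P * 'X^d - a'%:P * 'X^d') = a.
Proof.
move=> a0 dd; rewrite lead_coefDl; first by rewrite lead_coefM lead_coefXn mulr1 lead_coefC.
rewrite size_polyN [X in (_ < X)%N]size_mulXn ?polyC_eq0 // size_polyC a0.
rewrite (leq_ltn_trans (size_polyMleq _ _)) // size_polyXn size_polyC addnS /= addn1.
by case: (a' != 0); rewrite /= ?add1n ?add0n ltnS // ltnW.
Qed.

Lemma lead_coef_wtau (i j i' j' : nat) : (3 * i' + 4 * j' < 3 * i + 4 * j)%N ->
  lead_coef (wtau v34 (mon2 k i j - mon2 k i' j')) = mon2 k i j.
Proof.
move=> h; rewrite raddfB /= !mon2E !wtauX !mwt_mnm2; apply: lead_coef_binomial => //.
by rewrite -msize_poly_eq0 msizeX.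
Qed.

Lemma mcoeffMX_neq0 n (F : {mpoly k[n]}) a m : (F * 'X_[a])@_m != 0 -> (a <= m)%MM.
Proof.
by rewrite -mcoeff_msupp (perm_mem (msuppMX _ _)) => /mapP[m' _ ->]; apply: lem_addr.
Qed.

(* For the weights 3 and 4 of s and t, the leading monomials t^12 of b and s^18
   of c are coprime. *)
Lemma paramB_c_div (f g : S) : paramB vc * paramB f = paramB vb * paramB g ->
  exists h, paramB f = paramB vb * paramB h.
Proof.
pose sz (f : S) : nat := size (wtau v34 (paramB f)).
(* Division by b: subtracting b h from f and c h from g preserves the relation, and a suitable h
   cancels the leading form of f. *)
suff main N : forall f g, (sz f < N)%N -> paramB vc * paramB f = paramB vb * paramB g ->
    exists h, paramB f = paramB vb * paramB h.
  exact: (main (sz f).+1 f g (ltnSn _)).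
elim: N => // N IHN {}f {}g; rewrite ltnS => fN e.
have [f0|f0] := eqVneq (paramB f) 0; first by exists 0; rewrite f0 raddf0 mulr0.
rewrite /sz in fN; have [P eP] : exists P, P = wtau v34 (paramB f) by eexists.
rewrite -eP in fN; have P0 : P != 0 by rewrite eP wtau_eq0.
have [G eG] : exists G, G = lead_coef (wtau v34 (paramB g)) by eexists.
have lcM (F F' : B) : lead_coef (wtau v34 (F * F')) =
    lead_coef (wtau v34 F) * lead_coef (wtau v34 F').
  by rewrite rmorphM lead_coefM.
have lcb : lead_coef (wtau v34 (paramB vb)) = mon2 k 0 12.
  by rewrite paramB_b; apply: lead_coef_wtau.
have lcc : lead_coef (wtau v34 (paramB vc)) = mon2 k 18 0.
  by rewrite paramB_c; apply: lead_coef_wtau.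
have [H eH] : exists H, H = lead_coef P by eexists.
have lcE : mon2 k 18 0 * H = mon2 k 0 12 * G.
  have e' : lead_coef (wtau v34 (paramB vc * paramB f)) =
      lead_coef (wtau v34 (paramB vb * paramB g)).
    exact: (congr1 (fun F : B => lead_coef (wtau v34 F)) e).
  have {}e' := etrans (esym (lcM (paramB vc) (paramB f))) (etrans e' (lcM (paramB vb) (paramB g))).
  have lcP : lead_coef (wtau v34 (paramB f)) = H.
    exact: etrans (congr1 lead_coef (esym eP)) (esym eH).
  exact: etrans (esym (f_equal2 *%R lcc lcP)) (etrans e' (f_equal2 *%R lcb (esym eG))).
have HE m : H@_m = if mwt v34 m == (size P).-1 then (paramB f)@_m else 0.
  rewrite eH eP; exact: mcoeff_wtau.
clear lcM lcb lcc.
(* The leading forms satisfy s^18 H = t^12 G, and s^18 is coprime to t^12, so t^12 divides H. *)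
have H12 m : H@_m != 0 -> (12 <= m (@Ordinal 2 1 isT))%N.
  move=> Hm; have : (H * 'X_[mnm2 18 0])@_(mnm2 18 0 + m)%MM != 0 by rewrite mcoeffMX.
  rewrite -mon2E mulrC lcE mulrC mon2E => /mcoeffMX_neq0/mnm_lepP/(_ (@Ordinal 2 1 isT)).
  by rewrite mnmDE !mnmE.
(* A preimage of H / t^12, which exists because lowering j by 12 keeps the congruence modulo 6. *)
pose h := \sum_(m <- msupp H)
  H@_m *: sect k (m (@Ordinal 2 0 isT)) (m (@Ordinal 2 1 isT) - 12).
have hH : mon2 k 0 12 * paramB h = H.
  rewrite [RHS]mpolyE raddf_sum mulr_sumr; apply: eq_big_seq => m.
  rewrite mcoeff_msupp => Hm /=; rewrite paramB_scale paramB_sect.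
    rewrite -scalerAr mpolyX2 !mon2X; congr (_ *: _).
    by rewrite expr0 mul1r mulrCA -exprD subnKC ?H12.
  move: Hm (H12 _ Hm); rewrite HE; case: ifP => [_|_]; last by rewrite eqxx.
  by move/paramB_mod6; rewrite /mod6; lia.
have [||h' eh'] := IHN (f - vb * h) (g - vc * h).
- apply: leq_trans fN; rewrite -[X in (_ < X)%N]prednK ?size_poly_gt0 // ltnS /sz.
  (* The first summand has lost its leading form; the second has smaller weight than H because s^10
     t^4 weighs 46 and t^12 weighs 48. *)
  have -> : paramB (f - vb * h) = (paramB f - H) + mon2 k 10 4 * paramB h.
    by rewrite rmorphB rmorphM /= paramB_b -hH; ring.
  apply: size_wtau => m; rewrite mcoeffD.
  have [e0 h1|h1 _] := eqVneq (paramB f - H)@_m 0.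
    rewrite e0 add0r in h1.
    have /mcoeffMX_neq0/submK mE : (paramB h * 'X_[mnm2 10 4])@_m != 0.
      by rewrite -mon2E mulrC.
    move: h1; rewrite -mE; set m' := (m - _)%MM => h1.
    have : H@_(mnm2 0 12 + m')%MM != 0.
      by rewrite -hH mulrC mon2E mcoeffMX -(mcoeffMX _ (mnm2 10 4)) -mon2E mulrC addmC.
    rewrite HE; case: ifP => [/eqP <- _|_]; last by rewrite eqxx.
    rewrite !mwtD !mwt_mnm2 /v34 /=; lia.
  have : (paramB f)@_m != 0.
    by apply: contraNneq h1 => f0m; rewrite mcoeffB HE f0m if_same subrr.
  move: h1; rewrite mcoeffB HE; case: ifP => [_|ne _ fm]; first by rewrite subrr eqxx.
  have := ltn_neqAle (mwt v34 m) (size P).-1; rewrite ne => ->.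
  rewrite -ltnS prednK ?size_poly_gt0 // ltnNge; apply: contra fm => /leq_sizeP/(_ _ (leqnn _)).
  by move/(congr1 (mcoeff m)); rewrite eP mcoeff_wtau eqxx mcoeff0 => ->.
- have e2 := f_equal2 *%R (erefl (paramB vc)) (paramB_subM f vb h).
  have e3 := f_equal2 *%R (erefl (paramB vb)) (paramB_subM g vc h).
  apply: etrans e2 (etrans _ (esym e3)); move: e; clear.
  move: (paramB vc) (paramB f) (paramB vb) (paramB g) (paramB h) => C' F' b' G' H' e0.
  by rewrite !mulrBr e0 mulrCA.
exists (h + h'); have e2 := etrans (esym (paramB_subM f vb h)) eh'.
have -> : paramB (h + h') = paramB h + paramB h' by exact: rmorphD.
rewrite mulrDr; exact: etrans (esym (subrKC (paramB vb * paramB h) _)) (congr1 _ e2).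

Qed.

Lemma pow_divc (f g h : S) : vc * f = vb * g + w * h ->
  exists g' h', f = vb * g' + w * h'.
Proof.
move=> e; have [|g' eg] := @paramB_c_div f g.
  exact: etrans (esym (paramBM vc f)) (etrans (congr1 (@paramB k) e) (paramB_mulDw vb g h)).
have [|h' eh] := @paramB_eq0 k (f - vb * g').
  by rewrite paramB_subM eg subrr.
by exists g', h'; rewrite -eh addrC subrK.
Qed.

Lemma divb (f g : S) : vb * f = w * g -> exists g', f = w * g'.
Proof.
move=> e; apply: paramB_eq0; have /eqP : paramB vb * paramB f = 0.
  by rewrite -paramBM e paramBM paramB_w mul0r.
rewrite mulf_eq0 => /orP[/eqP b0|/eqP//].
by case: (@wge_paramB_b ord0); rewrite b0 => m; rewrite mcoeff0 eqxx.
Qed.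
End Divisibility25.

(** * The reduction (b, c) modulo w *)

Section Reduction25.
Variable k : fieldType.
Local Notation S := {mpoly k[3]}.
Local Notation B := {mpoly k[2]}.
Local Notation pw := (ideal_pow (fun x => x \in I25 k)).
Local Notation x := (vx k).
Local Notation y := (vy k).
Local Notation z := (vz k).
Local Notation w := (vw k).
Local Notation vb := (vb k).
Local Notation vc := (vc k).
Local Notation vs := (vs k).
Local Notation vt := (vt k).

Lemma cone_add n n' i j i' j' : cone n i j -> cone n' i' j' ->
  cone (n + n') (i + i') (j + j').
Proof.
rewrite /cone /mod6 => /and4P[/eqP m h1 h2 h3] /and4P[/eqP m' h1' h2' h3'].
apply/and4P; split; [apply/eqP|lia|lia|lia].
by rewrite -modnDm m m' modnDm.
Qed.

(* A move replaces z^2 by x^4 y (false) or y^3 by x^3 z (true), or back; it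
   changes a monomial by a multiple of b or c with cofactor in the cone. *)
Definition move_src (v : bool * bool) : nat * nat :=
  match v with
  | (false, false) => (0, 12) | (false, true) => (10, 4)
  | (true, false) => (18, 0) | (true, true) => (3, 9)
  end%N.

Fixpoint walk (s : nat * nat) (l : seq (bool * bool)) : option (nat * nat) :=
  if l is v :: l' then
    let a := move_src v in let b := move_src (v.1, ~~ v.2) in
    let m := (s.1 - a.1, s.2 - a.2)%N in
    if [&& (a.1 <= s.1)%N, (a.2 <= s.2)%N & cone 1 m.1 m.2]
    then walk (m.1 + b.1, m.2 + b.2)%N l' else None
  else Some s.

Definition b_fwd := (false, false). Definition b_back := (false, true).
Definition c_fwd := (true, false). Definition c_back := (true, true).
(** Up to detours that cancel, each walk consists of four moves [b_back] and three moves [c_back],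
    and 4 (-10, 8) + 3 (15, -9) = (5, 5). The four orders serve different starting points, since the
    cofactor must stay in the cone throughout. *)
Definition walks : seq (seq (bool * bool)) :=
  [:: [:: b_back; c_back; b_back; c_back; b_back; b_back; c_back];
      [:: c_back; b_back; c_back; b_back; c_back; b_back; b_back];
      [:: c_fwd; b_back; c_back; b_back; c_back; b_back; c_back; b_back; c_back];
      [:: b_fwd; c_back; b_back; b_back; c_back; c_back; b_back; b_back; b_back]].

Lemma walksP : all (fun p => all (fun q => has (fun l =>
    walk (p.1 + q.1, p.2 + q.2)%N l == Some (p.1 + q.1 + 5, p.2 + q.2 + 5)%N) walks)
  cone_gens) cone_gens.
Proof. by vm_compute. Qed.

Lemma walk_red n r1 r2 s l s' : cone n r1 r2 -> walk s l = Some s' ->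
  exists g h, [/\ pw n.+1 g, pw n.+1 h &
    mon2 k (s.1 + r1) (s.2 + r2) - mon2 k (s'.1 + r1) (s'.2 + r2) =
    paramB vb * paramB g + paramB vc * paramB h].
Proof.
move=> hr; elim: l s => [|v l IHl] s /=.
  move=> [->]; exists 0, 0; rewrite !raddf0 !mulr0 addr0 subrr.
  by split=> //; apply: ideal_pow0.
case: ifP => // /and3P[h1 h2 hm] /IHl[g [h [hg hh e]]].
have [m pm em] := cone_lift k (cone_add hm hr).
have mE i1 i2 : mon2 k (s.1 - (move_src v).1 + i1 + r1) (s.2 - (move_src v).2 + i2 + r2)
    = mon2 k i1 i2 * paramB m.
  by rewrite em /mon2 ![(_ + _ + r1)%N]addnAC ![(_ + _ + r2)%N]addnAC !exprD; ring.
have d : mon2 k (s.1 + r1) (s.2 + r2) -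
    mon2 k (s.1 - (move_src v).1 + (move_src (v.1, ~~ v.2)).1 + r1)
           (s.2 - (move_src v).2 + (move_src (v.1, ~~ v.2)).2 + r2) =
    (-1) ^+ v.2 * ((if v.1 then paramB vc else paramB vb) * paramB m).
  rewrite -{1}(subnK h1) -{1}(subnK h2) !mE -mulrBl mulrA; congr (_ * _).
  by case: v {h1 h2 hm em mE IHl e} => [[] []] /=; rewrite ?paramB_b ?paramB_c ?expr0 ?expr1; ring.
rewrite -(subrK (mon2 k (s.1 - (move_src v).1 + (move_src (v.1, ~~ v.2)).1 + r1)
   (s.2 - (move_src v).2 + (move_src (v.1, ~~ v.2)).2 + r2)) (mon2 k (s.1 + r1) (s.2 + r2))) d.
have pm' : pw n.+1 ((-1) ^+ v.2 * m) by apply: ideal_powZ.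
have sE : paramB ((-1) ^+ v.2 * m) = (-1) ^+ v.2 * paramB m.
  by rewrite rmorphM rmorphXn rmorphN rmorph1.
rewrite -addrA e; case: v.1.
  exists g, (h + (-1) ^+ v.2 * m); split=> //; first exact: ideal_powD.
  by rewrite (rmorphD _ h) /= sE; ring.
exists (g + (-1) ^+ v.2 * m), h; split=> //; first exact: ideal_powD.
by rewrite (rmorphD _ g) /= sE; ring.
Qed.

Definition vu : S := 1 - x ^+ 5.

Lemma paramB_u : paramB vu = 1 - mon2 k 5 5.
Proof. by rewrite /vu rmorphB rmorph1 rmorphXn /= paramB_x exprMn. Qed.

(* Modulo w, x^5 becomes s^5 t^5, and every product of two cone generators can be
   shifted by s^5 t^5 along a walk of moves. *)
Lemma pow_red n (f : S) : pw n.+2 f -> exists g h q,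
  [/\ pw n.+1 g, pw n.+1 h & vu * f = vb * g + vc * h + w * q].
Proof.
move=> /in_cone_pow hf.
suff [g [h [hg hh e]]] : exists g h, [/\ pw n.+1 g, pw n.+1 h &
    paramB vu * paramB f = paramB vb * paramB g + paramB vc * paramB h].
  have [|q eq] := @paramB_eq0 k (vu * f - (vb * g + vc * h)).
    by rewrite rmorphB rmorphD !rmorphM /= e subrr.
  by exists g, h, q; split; rewrite // -eq addrC subrK.
move: (paramB f) hf => F hF.
rewrite [F]mpolyE big_seq mulr_sumr.
elim/big_rec: _ => [|m G].
  by exists 0, 0; rewrite !raddf0 !mulr0 addr0; split=> //; apply: ideal_pow0.
rewrite mcoeff_msupp => /hF cm [g [h [hg hh ->]]].
(* m splits as p + q + r with generators p, q and r in the n-th cone; the walk moves p + q by (5,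
   5). *)
have [p [pin p1 p2 c1]] := cone_step cm.
have [q [qin q1 q2 c2]] := cone_step c1.
have /allP/(_ _ pin)/allP/(_ _ qin)/hasP[l _ /eqP hl] := walksP.
have [g' [h' [hg' hh']]] := walk_red c2 hl.
rewrite /= -!addnA; set i := (_ - _ - _)%N; set j := (_ - _ - _)%N.
have ei : (p.1 + (q.1 + i))%N = m (@Ordinal 2 0 isT) by rewrite /i !subnKC.
have ej : (p.2 + (q.2 + j))%N = m (@Ordinal 2 1 isT) by rewrite /j !subnKC.
rewrite ei ej (addnC 5) (addnC 5) !addnA -(addnA p.1) -(addnA p.2) ei ej.
move=> e; exists (F@_m *: g' + g), (F@_m *: h' + h); split.
- by apply: ideal_powD => //; rewrite -mul_mpolyC; apply: ideal_powZ.
- by apply: ideal_powD => //; rewrite -mul_mpolyC; apply: ideal_powZ.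
rewrite (rmorphD _ _ g) (rmorphD _ _ h) /= !paramB_scale !(mulrDr (paramB _)).
rewrite -!scalerAr addrACA -scalerDr -e.
congr (_ *: _ + _); rewrite paramB_u mpolyX2 /mon2 !exprD; ring.
Qed.
End Reduction25.

(** * Complete integral closure *)

(* Complete integral closedness, phrased with divisibility: if the powers of the
   fraction a / b have the common denominator d, then a / b lies in the ring. *)
Definition completely_closed (D : idomainType) : Prop := forall a b d : D,
  d != 0 -> b != 0 -> (forall n, exists q, d * a ^+ n = q * b ^+ n) ->
  exists q, a = q * b.

Lemma completely_closed_field (k : fieldType) : completely_closed k.
Proof. by move=> a b d _ b0 _; exists (a / b); rewrite divfK. Qed.

Lemma completely_closed_iso (D E : idomainType) (f : {rmorphism D -> E})
    (g : {rmorphism E -> D}) :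
  cancel f g -> cancel g f -> completely_closed D -> completely_closed E.
Proof.
move=> fK gK hD a b d d0 b0 h.
have [|||q hq] := hD (g a) (g b) (g d).
- by apply: contraNneq d0 => d0; rewrite -(gK d) d0 rmorph0.
- by apply: contraNneq b0 => b0; rewrite -(gK b) b0 rmorph0.
- by move=> n; have [q hq] := h n; exists (g q); rewrite -!rmorphXn -!rmorphM hq.
by exists (f q); rewrite -(gK a) hq rmorphM gK.
Qed.

Section CompletelyClosedPoly.
Variable D : idomainType.

(** Over a domain [%|] is divisibility up to a nonzero constant. Once the gcd is removed, all powers
    of the denominator divide d, so the denominator is constant. *)
Lemma dvdp_bounded_exp (a b d : {poly D}) : d != 0 -> b != 0 ->
  (forall n, b ^+ n %| d * a ^+ n) -> b %| a.
Proof.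
move=> d0 b0 h; pose g := gcdp a b.
have g0 : g != 0 by rewrite gcdp_eq0 negb_and b0 orbT.
have [ca ca0 ea] : exists2 c, c != 0 & c *: a = (a %/ g) * g.
  exists (lead_coef g ^+ scalp a g); first by rewrite expf_neq0 ?lead_coef_eq0.
  by apply/eqP; rewrite -Pdiv.WeakIdomain.dvdp_eq dvdp_gcdl.
have [cb cb0 eb] : exists2 c, c != 0 & c *: b = (b %/ g) * g.
  exists (lead_coef g ^+ scalp b g); first by rewrite expf_neq0 ?lead_coef_eq0.
  by apply/eqP; rewrite -Pdiv.WeakIdomain.dvdp_eq dvdp_gcdr.
set a' := a %/ g in ea; set b' := b %/ g in eb.
have cop : coprimep b' a' by rewrite coprimep_sym coprimep_div_gcd // b0 orbT.
have hb n : b' ^+ n %| d.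
  have : (cb *: b) ^+ n %| d * (ca *: a) ^+ n.
    rewrite !exprZn dvdpZl ?expf_neq0 //.
    by rewrite -scalerAr dvdpZr ?expf_neq0.
  rewrite ea eb !exprMn mulrA dvdp_mul2r ?expf_neq0 // Gauss_dvdpl //.
  exact: coprimep_expl (coprimep_expr _ cop).
have b'0 : b' != 0.
  apply: contraTneq isT => b'0; move: eb; rewrite b'0 mul0r => /eqP.
  by rewrite -size_poly_eq0 size_scale // size_poly_eq0 (negbTE b0).
have sb' : size b' = 1%N.
  apply/eqP; rewrite eqn_leq size_poly_gt0 b'0 andbT leqNgt; apply/negP => s1.
  have := dvdp_leq d0 (hb (size d)).
  rewrite -[X in (X <= _)%N]prednK ?size_poly_gt0 ?expf_neq0 // size_exp.
  by rewrite leqNgt ltnS leq_pmull // -subn1 subn_gt0.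
rewrite -(dvdpZr _ _ ca0) ea -(dvdpZl _ _ cb0) eb dvdp_mul2r //.
by rewrite (eqp_dvdl _ (_ : b' %= 1)) ?dvd1p // -size_poly_eq1 sb'.
Qed.

Lemma completely_closed_poly : completely_closed D -> completely_closed {poly D}.
Proof.
move=> hD a b d d0 b0 h.
have /Pdiv.WeakIdomain.dvdpP[[c q] /= c0 e] : b %| a.
  by apply: (dvdp_bounded_exp d0 b0) => n; have [q ->] := h n; apply: dvdp_mull.
have {}h n : exists r, d * q ^+ n = c ^+ n *: r.
  have [r hr] := h n; exists r; apply: (mulIf (expf_neq0 n b0)).
  by rewrite -mulrA -exprMn -e exprZn -scalerAr hr -scalerAl.
suff [r hr] : exists r, q = c *: r.
  exists r; have cP : c%:P != 0 by rewrite polyC_eq0.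
  by apply: (mulfI cP); rewrite !mul_polyC e hr scalerAl.
elim/ltn_ind: {q e}(size q) {-2}q (erefl (size q)) h => s IHs q sq h.
have [->|q0] := eqVneq q 0; first by exists 0; rewrite scaler0.
(* By multiplicativity of leading coefficients the hypothesis [h] holds for them over D, so c
   divides that of q and the leading term can be split off. *)
have [u hu] : exists u, lead_coef q = u * c.
  apply: (hD _ _ (lead_coef d)); rewrite ?lead_coef_eq0 // => n.
  have [r hr] := h n; exists (lead_coef r).
  by rewrite -lead_coef_exp -lead_coefM hr lead_coefZ mulrC.
pose m := u *: 'X^((size q).-1).
have qm : (size (q - c *: m)%R < s)%N.
  rewrite -sq -[X in (_ < X)%N]prednK ?size_poly_gt0 // ltnS.
  apply/leq_sizeP => j hj; rewrite coefB !coefZ coefXn.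
  have [ej|nj] := eqVneq j (size q).-1.
    by rewrite ej -lead_coefE hu mulr1 mulrC subrr.
  rewrite mulr0 mulr0 subr0 nth_default // -(prednK (_ : 0 < size q)%N) ?size_poly_gt0 //.
  by rewrite ltn_neqAle eq_sym nj.
have [|r hr] := IHs _ qm _ erefl; last first.
  by exists (r + m); rewrite scalerDr -hr subrK.
(* The hypothesis survives the subtraction: each term in the binomial expansion contributes c^(n -
   i) from d q^(n - i) and c^i from (c m)^i. *)
move=> n; have [f hf] := choice h.
exists (\sum_(i < n.+1) ((-1) ^+ i * f (n - i)%N * m ^+ i) *+ 'C(n, i)).
rewrite exprBn mulr_sumr scaler_sumr; apply: eq_bigr => i _.
have in' : (i <= n)%N by rewrite -ltnS.
rewrite mulrnAr -scalerMnr; congr (_ *+ _).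
transitivity ((-1) ^+ i * (d * q ^+ (n - i)) * (c *: m) ^+ i); first by ring.
have -> : c ^+ n = c ^+ (n - i) * c ^+ i by rewrite -exprD subnK.
by rewrite hf -!mul_polyC exprMn rmorphM !rmorphXn /=; ring.
Qed.
End CompletelyClosedPoly.

(** * Noetherian rings and iterated polynomial rings *)

Section PropIdeals.
Variable R : comNzRingType.

Definition prop_ideal (J : R -> Prop) : Prop :=
  [/\ J 0, forall x y, J x -> J y -> J (x + y) & forall a x, J x -> J (a * x)].

(** The unit ideal is included, since ideals of leading coefficients may be improper. *)
Definition noeth : Prop := forall J, prop_ideal J ->
  exists s : seq R, forall x, J x <-> in_ideal s x.

Lemma prop_ideal_in (s : seq R) : prop_ideal (in_ideal s).
Proof.
by split; [exact: in_ideal0|move=> x y; exact: in_idealD|move=> a x; exact: in_idealMl].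
Qed.

Lemma in_ideal_sub (J : R -> Prop) (s : seq R) : prop_ideal J ->
  (forall x, x \in s -> J x) -> forall x, in_ideal s x -> J x.
Proof.
by move=> [J0 JD JM] h; apply: in_ideal_ind => // a f g /h fJ gJ; apply/JD/gJ/JM.
Qed.

Lemma in_ideal_subset (s t : seq R) : (forall x, x \in s -> in_ideal t x) ->
  forall x, in_ideal s x -> in_ideal t x.
Proof. by apply: in_ideal_sub; apply: prop_ideal_in. Qed.

Lemma noeth_noetherian : noeth -> noetherian R.
Proof.
move=> h J; apply: (h (fun x => x \in J)); split; first exact: rpred0.
- by move=> x y; apply: rpredD.
- by move=> a x; apply: idealMr.
Qed.
End PropIdeals.

Lemma noeth_field (k : fieldType) : noeth k.
Proof.
move=> J [J0 JD JM].
have [[a Ja a0]|h] := pselect (exists2 a, J a & a != 0).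
  exists [:: a] => x; split=> [_|].
    by rewrite -(divfK a0 x); apply/in_idealMl/in_ideal_mem; rewrite mem_head.
  by move=> _; rewrite -(divfK a0 x); apply: JM.
exists [::] => x; split=> [Jx|[c ->]]; last by rewrite big_ord0.
have [->|x0] := eqVneq x 0; first exact: in_ideal0.
by case: h; exists x.
Qed.

Lemma noeth_surj (R A : comNzRingType) (f : {rmorphism R -> A}) :
  (forall y, exists x, f x = y) -> noeth R -> noeth A.
Proof.
move=> surj hR J [J0 JD JM].
have [|s hs] := hR (fun x => J (f x)).
  split=> [|x y|a x]; first by rewrite rmorph0.
  - by rewrite rmorphD; apply: JD.
  - by rewrite rmorphM; apply: JM.
exists (map f s) => y; split=> [Jy|].
  have [x xy] := surj y; rewrite -xy in Jy *.
  move/hs: Jy; move: x {xy}; apply: in_ideal_ind => [|a g h gs hh].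
    by rewrite rmorph0; apply: in_ideal0.
  by rewrite rmorphD rmorphM; apply/in_idealD/hh/in_idealMl/in_ideal_mem/map_f.
apply: in_ideal_sub; first by split.
by move=> _ /mapP[x xs ->]; apply/hs/in_ideal_mem.
Qed.

Section HilbertBasis.
Variables (R : comNzRingType) (hR : noeth R) (J : {poly R} -> Prop).
Hypothesis idJ : prop_ideal J.

Let L d a := exists p, [/\ J p, (size p <= d.+1)%N & p`_d = a].

Let idL d : prop_ideal (L d).
Proof.
have [J0 JD JM] := idJ; split.
- by exists 0; rewrite size_poly0 coef0.
- move=> a b [p [Jp sp <-]] [q [Jq sq <-]]; exists (p + q).
  rewrite coefD; split=> //; first exact: JD.
  by rewrite (leq_trans (size_polyD _ _)) // geq_max sp.
- move=> c a [p [Jp sp <-]]; exists (c%:P * p).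
  rewrite coefCM; split=> //; first exact: JM.
  by rewrite mul_polyC (leq_trans (size_scale_leq _ _)).
Qed.

Let LS d a : L d a -> L d.+1 a.
Proof.
have [J0 JD JM] := idJ; move=> [p [Jp sp <-]]; exists ('X * p).
split; [exact: JM| |by rewrite coefXM].
by rewrite (leq_trans (size_polyMleq _ _)) // size_polyX.
Qed.

Let Lle d e a : (d <= e)%N -> L d a -> L e a.
Proof. by move/subnKC <-; elim: (e - d)%N => [|i IHi]; rewrite ?addn0 ?addnS // => /IHi/LS. Qed.

Let kills (G : seq {poly R}) d := forall p, J p -> (size p <= d.+1)%N ->
  exists2 q, in_ideal G q & (size (p - q)%R <= d)%N.

(* Generators of the ideal of leading coefficients in degree d cancel the leading
   coefficients in every degree where they still generate. *)
Let kills_ge s d : (forall a, a \in s -> L d a) ->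
  exists G, (forall p, p \in G -> J p) /\ forall e', (d <= e')%N ->
    (forall a, L e' a -> in_ideal s a) -> kills G e'.
Proof.
move=> sL.
have /choice[F hF] a : exists p, L d a -> [/\ J p, (size p <= d.+1)%N & p`_d = a].
  by have [[p hp]|nL] := pselect (L d a); [exists p | exists 0].
exists (map F s); split=> [_ /mapP[a /sL/hF[? _ _] ->]//|e' de' hs p Jp sp].
have [q hq [sq eq]] : exists2 q, in_ideal (map F s) q & (size q <= e'.+1)%N /\ q`_e' = p`_e'.
  have : in_ideal s p`_e' by apply: hs; exists p.
  move: (p`_e'); apply: in_ideal_ind.
    by exists 0; [exact: in_ideal0|rewrite size_poly0 coef0].
  move=> a f g fs [q hq [sq eq]]; have [_ sF cF] := hF _ (sL _ fs).
  exists (a%:P * 'X^(e' - d) * F f + q).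
    by apply/in_idealD/hq/in_idealMl/in_ideal_mem/map_f.
  rewrite -mulrA; split.
    rewrite (leq_trans (size_polyD _ _)) // geq_max sq andbT mul_polyC.
    rewrite (leq_trans (size_scale_leq _ _)) // (leq_trans (size_polyMleq _ _)) //.
    by rewrite size_polyXn /= (leq_trans (leq_add (leqnn _) sF)) // addnS subnK.
  by rewrite coefD eq coefCM coefXnM ltnNge leq_subr subKn //= cF.
exists q => //; apply/leq_sizeP => i; rewrite leq_eqVlt => /orP[/eqP<-|ei].
  by rewrite coefB eq subrr.
by rewrite coefB !nth_default ?subrr // (leq_trans _ ei).
Qed.

(** The ideals of leading coefficients grow with the degree. Generators of their union all occur in
    one degree N, and the finitely many smaller degrees get generators of their own. *)
Lemma hilbert_basis : exists s : seq {poly R}, forall p, J p <-> in_ideal s p.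
Proof.
have [J0 JD JM] := idJ.
have [|s hs] := hR (J := fun a => exists d, L d a).
  split; first by exists 0%N; have [] := idL 0.
  - move=> a b [d Ld] [e Le]; exists (maxn d e); have [_ LD _] := idL (maxn d e).
    by apply: LD; [apply: Lle Ld; apply: leq_maxl|apply: Lle Le; apply: leq_maxr].
  - by move=> c a [d Ld]; exists d; have [_ _ LM] := idL d; apply: LM.
have [N hN] : exists N, forall a, a \in s -> L N a.
  have : forall a, a \in s -> exists d, L d a by move=> a /in_ideal_mem/hs.
  elim: (s) => [|a r IHr] h; first by exists 0%N.
  have [|N hN] := IHr; first by move=> b br; apply: h; rewrite inE br orbT.
  have [d Ld] := h a (mem_head _ _); exists (maxn d N) => b; rewrite inE => /orP[/eqP->|/hN].
    by apply: Lle Ld; apply: leq_maxl.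
  by apply: Lle; apply: leq_maxr.
have [G [GJ hG]] := kills_ge hN.
have small d : exists G, (forall p, p \in G -> J p) /\ kills G d.
  have [r hr] := hR (idL d).
  have [G' [GJ' hG']] := kills_ge (fun a ar => (hr a).2 (in_ideal_mem ar)).
  by exists G'; split=> //; apply: hG' => // a /hr.
have [K hK] := choice small.
have [T [TG [TJ TK]]] : exists T : seq {poly R}, (forall p, p \in G -> p \in T) /\
    (forall p, p \in T -> J p) /\ (forall d p, (d < N)%N -> p \in K d -> p \in T).
  elim: (N) => [|n [T [TG [TJ TK]]]]; first by exists G.
  exists (T ++ K n); split; [|split] => [p /TG|p|d p]; rewrite ?mem_cat; first by move->.
    by case/orP => [/TJ|/(hK n).1].
  by rewrite ltnS leq_eqVlt => /orP[/eqP->|/TK h /h] ->; rewrite ?orbT.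
have TKills d : kills T d.
  move=> p Jp sp; have [dN|Nd] := ltnP d N.
    have [q hq sq] := (hK d).2 p Jp sp; exists q => //.
    by apply: in_ideal_subset hq => f fK; apply/in_ideal_mem/(TK d).
  have [q hq sq] := hG d Nd (fun a La => (hs a).1 (ex_intro _ d La)) p Jp sp.
  by exists q => //; apply: in_ideal_subset hq => f /TG/in_ideal_mem.
exists T => p; split; last exact: in_ideal_sub.
move: {2}(size p) (leqnn (size p)) => d; elim: d p => [|d IHd] p sp Jp.
  by move: sp; rewrite leqn0 size_poly_eq0 => /eqP->; apply: in_ideal0.
have [q hq sq] := TKills d p Jp sp.
have Jq : J q by apply: in_ideal_sub hq.
rewrite -(subrK q p); apply: in_idealD => //; apply: IHd => //.
by apply: JD => //; rewrite -mulN1r; apply: JM.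
Qed.
End HilbertBasis.

Lemma noeth_poly (R : comNzRingType) : noeth R -> noeth {poly R}.
Proof. by move=> hR J; apply: hilbert_basis. Qed.

(** The polynomial ring in n variables, built one variable at a time so that univariate results
    extend to it by induction. *)
Fixpoint tower (k : idomainType) (n : nat) : idomainType :=
  if n is n'.+1 then ({poly tower k n'} : idomainType) else k.

Lemma noeth_tower (k : fieldType) n : noeth (tower k n).
Proof. by elim: n => [|n IHn]; [exact: noeth_field | exact: noeth_poly]. Qed.

Lemma completely_closed_tower (k : fieldType) n : completely_closed (tower k n).
Proof.
elim: n => [|n IHn]; first exact: completely_closed_field.
exact: completely_closed_poly.
Qed.

Section TowerEval.
Variables (k : idomainType) (A : comNzRingType) (f : {rmorphism k -> A}) (s : nat -> A).

Fixpoint tower_eval (n : nat) : {rmorphism tower k n -> A} :=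
  match n with
  | 0 => f
  | n'.+1 => GRing.RMorphism.clone _ _
      (horner_morph (f := tower_eval n') (u := s n') (fun a => mulrC _ _)) _
  end.

Lemma tower_evalC n c : tower_eval n.+1 (c%:P) = tower_eval n c.
Proof. exact: horner_morphC. Qed.

Lemma tower_evalX n : tower_eval n.+1 'X = s n.
Proof. exact: horner_morphX. Qed.

End TowerEval.

Section TowerVar.
Variable k : idomainType.

Fixpoint tower_var (n i : nat) : tower k n :=
  match n with
  | 0 => 0
  | n'.+1 => if i == n' then 'X else (tower_var n' i)%:P
  end.

Fixpoint tower_const (n : nat) : {rmorphism k -> tower k n} :=
  match n with
  | 0 => GRing.RMorphism.clone _ _ idfun _
  | n'.+1 => GRing.RMorphism.clone _ _ (polyC \o tower_const n') _
  end.

Lemma tower_eval_var (A : comNzRingType) (f : {rmorphism k -> A}) (s : nat -> A) n i :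
  (i < n)%N -> tower_eval f s n (tower_var n i) = s i.
Proof.
elim: n => //= n IHn; rewrite ltnS leq_eqVlt.
case: eqP => [-> _|_ /= h]; first exact: tower_evalX.
by rewrite -[LHS]/(tower_eval f s n.+1 _) tower_evalC IHn.
Qed.

Lemma tower_eval_const (A : comNzRingType) (f : {rmorphism k -> A}) (s : nat -> A) n c :
  tower_eval f s n (tower_const n c) = f c.
Proof.
by elim: n => //= n IHn; rewrite -[LHS]/(tower_eval f s n.+1 _) tower_evalC IHn.
Qed.

Lemma tower_ext (A : comNzRingType) n (g h : {rmorphism tower k n -> A}) :
  (forall c, g (tower_const n c) = h (tower_const n c)) ->
  (forall i, (i < n)%N -> g (tower_var n i) = h (tower_var n i)) -> g =1 h.
Proof.
elim: n g h => [|n IHn] g h hc hv; first by move=> c; apply: hc.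
have hC : forall c : tower k n, g c%:P = h c%:P.
  apply: (IHn (GRing.RMorphism.clone _ _ (g \o polyC) _)
              (GRing.RMorphism.clone _ _ (h \o polyC) _)) => [c|i ni] /=.
    exact: hc.
  by have := hv i (ltnW ni); rewrite /= ltn_eqF.
have hX : g 'X = h 'X by have := hv n (leqnn _); rewrite /= eqxx.
move=> p; rewrite -[p]coefK poly_def !rmorph_sum; apply: eq_bigr => i _.
by rewrite -mul_polyC !rmorphM /= hC !rmorphXn /= hX.
Qed.
End TowerVar.

Section PolynomialTower.
Variables (k : fieldType) (n : nat).
Local Notation A := {mpoly k[n]}.

Lemma mpoly_ext (C : comNzRingType) (f g : {rmorphism A -> C}) :
  (forall c, f c%:MP = g c%:MP) -> (forall i, f 'X_i = g 'X_i) -> f =1 g.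
Proof.
move=> hc hx p; rewrite [p]mpolyE !rmorph_sum; apply: eq_bigr => m _.
rewrite -mul_mpolyC !rmorphM /= hc mpolyXE_id !rmorph_prod; congr (_ * _).
by apply: eq_bigr => i _; rewrite !rmorphXn /= hx.
Qed.

Definition of_tower : {rmorphism tower k n -> A} :=
  tower_eval (GRing.RMorphism.clone _ _ (@mpolyC n k) _)
    (fun i => if insub i is Some i' then 'X_i' else 0) n.

Definition to_tower : {rmorphism A -> tower k n} :=
  GRing.RMorphism.clone _ _
    (mmap (tower_const k n) (fun i : 'I_n => tower_var k n i)) _.

Lemma of_towerK : cancel of_tower to_tower.
Proof.
apply: (tower_ext (g := GRing.RMorphism.clone _ _ (to_tower \o of_tower) _)
   (h := GRing.RMorphism.clone _ _ idfun _)) => [c|i i_n].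
  rewrite -[LHS]/(to_tower (of_tower _)) /of_tower tower_eval_const.
  by rewrite /to_tower /= mmapC.
rewrite -[LHS]/(to_tower (of_tower _)) /of_tower tower_eval_var // insubT.
by rewrite -[LHS]/(mmap _ _ 'X_ _) mmapX mmap1U.
Qed.

Lemma to_towerK : cancel to_tower of_tower.
Proof.
apply: (mpoly_ext (f := GRing.RMorphism.clone _ _ (of_tower \o to_tower) _)
   (g := GRing.RMorphism.clone _ _ idfun _)) => [c|i];
   rewrite -[LHS]/(of_tower (mmap _ _ _)).
  by rewrite mmapC /of_tower tower_eval_const.
rewrite mmapX mmap1U /of_tower tower_eval_var //.
by case: insubP => [j _ /val_inj->|] //; rewrite ltn_ord.
Qed.

Lemma completely_closed_mpoly : completely_closed A.
Proof.
exact: completely_closed_iso of_towerK to_towerK (@completely_closed_tower k n).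
Qed.
End PolynomialTower.

(** * Normality and generators of the Rees algebra *)

Section NormalRees.
Variable k : fieldType.
Local Notation S := {mpoly k[3]}.
Local Notation pw := (ideal_pow (fun x => x \in I25 k)).
Local Notation R := (rees (I25 k)).

Lemma rees_predP (f : {poly S}) :
  reflect (forall n, pw n f`_n) (f \in rees_pred (I25 k)).
Proof. exact: asboolP. Qed.

Lemma rees_monom n (c : S) : pw n c -> c *: 'X^n \in rees_pred (I25 k).
Proof.
move=> hc; apply/rees_predP => i; rewrite coefZ coefXn.
by have [->|_] := eqVneq i n; rewrite ?mulr1 ?mulr0 //; apply: ideal_pow0.
Qed.

(* The leading coefficient of q lies in the right power by pow_root; subtract
   the leading term and repeat. *)
Lemma rees_root (d q : {poly S}) : d != 0 ->
  (forall n, d * q ^+ n \in rees_pred (I25 k)) -> q \in rees_pred (I25 k).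
Proof.
move=> d0; elim/ltn_ind: {q}(size q) {-2}q (erefl (size q)) => s IHs q sq h.
have [->|q0] := eqVneq q 0; first exact: rpred0.
set e := (size q).-1.
have lcq : pw e (lead_coef q).
  apply: (pow_root (p := (size d).-1) (d := lead_coef d)).
    by rewrite lead_coef_eq0.
  move=> n; have /rees_predP/(_ ((size d).-1 + n * e)%N) := h n.
  congr (ideal_pow _ _ _); rewrite -lead_coef_exp -lead_coefM lead_coefE; congr (_`_ _).
  rewrite size_mul ?expf_neq0 // -(prednK (_ : 0 < size (q ^+ n))%N); last first.
    by rewrite size_poly_gt0 expf_neq0.
  by rewrite size_exp addnS /= mulnC -{2}(prednK (_ : 0 < size d)%N) // size_poly_gt0.
pose m : {poly S} := lead_coef q *: 'X^e.
have mR : m \in rees_pred (I25 k) by apply: rees_monom.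
have qm : (size (q - m)%R < s)%N.
  rewrite -sq -[X in (_ < X)%N]prednK ?size_poly_gt0 // ltnS.
  apply/leq_sizeP => j hj; rewrite coefB !coefZ coefXn.
  have [ej|nj] := eqVneq j e; first by rewrite ej mulr1 subrr.
  rewrite mulr0 subr0 nth_default // -(prednK (_ : 0 < size q)%N) ?size_poly_gt0 //.
  by rewrite ltn_neqAle eq_sym nj.
rewrite -(subrK m q) rpredD //; apply: (IHs _ qm _ erefl) => n.
rewrite exprBn mulr_sumr rpred_sum // => i _; rewrite mulrnAr rpredMn //.
have -> : d * ((-1) ^+ i * q ^+ (n - i) * m ^+ i) =
    (-1) ^+ i * m ^+ i * (d * q ^+ (n - i)) by ring.
by rewrite rpredM // rpredM ?rpredX // rpredN rpred1.
Qed.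

(** The quotient exists in S[T], which is completely closed, and [rees_root] brings it back into the
    Rees algebra. *)
Lemma completely_closed_rees : completely_closed R.
Proof.
move=> a b d d0 b0 h.
have v0 (r : R) : r != 0 -> rees_val r != 0.
  by apply: contraNneq => r0; apply/eqP/val_inj.
have b0' := v0 _ b0; have d0' := v0 _ d0.
have [|q hq] := completely_closed_poly (@completely_closed_mpoly k 3)
   (a := rees_val a) d0' b0'.
  move=> n; have [q /(congr1 val) hq] := h n; exists (rees_val q).
  by move: hq; rewrite !rmorphM !rmorphXn.
suff qR : q \in rees_pred (I25 k).
  by exists (Rees qR); apply: val_inj; rewrite rmorphM.
apply: (rees_root d0') => n; have [r /(congr1 val) hr] := h n.
suff -> : rees_val d * q ^+ n = rees_val r by apply: rees_valP.
apply: (mulIf (expf_neq0 n b0')); rewrite -mulrA -exprMn -hq.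
by move: hr; rewrite !rmorphM !rmorphXn.
Qed.

End NormalRees.

Lemma fraction_numden (D : idomainType) (u : {fraction D}) : exists a b : D,
  b != 0 /\ u * FracField.tofrac b = FracField.tofrac a.
Proof.
elim/quotW: u => f; exists (frac f).1, (frac f).2; split; first exact: denom_ratioP.
rewrite -[LHS]/(FracField.mul _ _) !piE; apply/eqP; rewrite FracField.equivf_def.
rewrite /FracField.mulf !numden_Ratio ?oner_eq0 ?mulr1 //=.
  by rewrite mulrC.
all: exact: denom_ratioP.
Qed.

(** An integral equation of degree e for u = a / b makes b^e a common denominator of all powers of
    u. *)
Lemma completely_closed_normal (D : idomainType) : completely_closed D -> normal_domain D.
Proof.
move=> hD u [p mon_p pu].
have [a [b [b0 eu]]] := fraction_numden u.
have b0' : FracField.tofrac b != 0 by rewrite tofrac_eq0.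
pose e := (size p).-1.
have he n : exists r, FracField.tofrac (b ^+ e) * u ^+ n = FracField.tofrac r.
  elim/ltn_ind: n => n IHn; have [ne|en] := leqP n e.
    exists (b ^+ (e - n) * a ^+ n).
    by rewrite -[in LHS](subnK ne) exprD !rmorphM !rmorphXn /= -eu exprMn; ring.
  have uE : u ^+ n = - \sum_(i < e) FracField.tofrac p`_i * u ^+ (n - e + i).
    apply/eqP; rewrite -addr_eq0.
    have : u ^+ (n - e) * (map_poly (@FracField.tofrac D) p).[u] == 0.
      by move/rootP: pu => ->; rewrite mulr0.
    rewrite horner_coef size_map_inj_poly ?raddf0 //; last first.
      by move=> ? ? /eqP; rewrite tofrac_eq => /eqP.
    rewrite -(prednK (_ : 0 < size p)%N) ?size_poly_gt0 ?monic_neq0 //.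
    rewrite big_ord_recr /= mulrDr coef_map /= -lead_coefE (eqP mon_p) rmorph1 mul1r.
    rewrite -exprD subnK ?(ltnW en) // addrC mulr_sumr.
    congr (_ + _ == 0); apply: eq_bigr => i _.
    by rewrite coef_map /= mulrCA -exprD.
  have hi (i : 'I_e) : exists r, FracField.tofrac (b ^+ e) * u ^+ (n - e + i) = FracField.tofrac r.
    by apply: IHn; move: (ltn_ord i) en; lia.
  have [r hr] := choice hi.
  exists (- \sum_(i < e) p`_i * r i).
  rewrite uE mulrN rmorphN rmorph_sum mulr_sumr; congr (- _).
  by apply: eq_bigr => i _; rewrite mulrCA hr rmorphM.
have [|||q hq] := hD a b (b ^+ e); rewrite ?expf_neq0 //.
  move=> n; have [r hr] := he n; exists r; apply/eqP; rewrite -tofrac_eq.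
  rewrite !tofracM [FracField.tofrac (a ^+ n)]tofracXn -eu exprMn.
  by rewrite [FracField.tofrac (b ^+ n)]tofracXn mulrA hr.
by exists q; apply: (mulIf b0'); rewrite eu hq rmorphM.
Qed.

Section ReesGenerators.
Variable k : fieldType.
Local Notation S := {mpoly k[3]}.
Local Notation pw := (ideal_pow (fun x => x \in I25 k)).
Local Notation R := (rees (I25 k)).

Definition reesC (c : S) : R := Rees (rees_polyC (I25 k) c).

Lemma reesC_is_zmod : zmod_morphism reesC.
Proof. by move=> a b; apply: val_inj; rewrite /= polyCB. Qed.
Lemma reesC_is_monoid : monoid_morphism reesC.
Proof. by split=> [|a b]; apply: val_inj; rewrite //= polyCM. Qed.
HB.instance Definition _ := GRing.isZmodMorphism.Build S R reesC reesC_is_zmod.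
HB.instance Definition _ := GRing.isMonoidMorphism.Build S R reesC reesC_is_monoid.

Definition reesM n (c : S) (hc : pw n c) : R := Rees (rees_monom hc).

Lemma rees_ind (P : R -> Prop) : P 0 -> (forall r s, P r -> P s -> P (r + s)) ->
  (forall n (c : S) (hc : pw n c), P (reesM hc)) -> forall r, P r.
Proof.
move=> P0 PD PM r; have hr := elimT (rees_predP _) (rees_valP r).
have -> : r = \sum_(i < size (rees_val r)) reesM (hr i).
  by apply: val_inj; rewrite rmorph_sum /= -[LHS]coefK poly_def.
by elim/big_ind: _.
Qed.

Definition rees_k : {rmorphism k -> R} :=
  GRing.RMorphism.clone _ _ (reesC \o (@mpolyC 3 k)) _.

Lemma gens_pow1 j : pw 1 (nth 0 (I25_gens k) j).
Proof.
have [j7|j7] := ltnP j (size (I25_gens k)).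
  by apply/pow1/I25P/in_ideal_mem/mem_nth.
by rewrite nth_default //; apply: ideal_pow0.
Qed.

(** x, y, z, then the seven generators of I times T, then 0. *)
Definition rees_gen (i : nat) : R :=
  if (i < 3)%N then reesC (nth 0 [:: vx k; vy k; vz k] i) else reesM (gens_pow1 (i - 3)).

Lemma rees_gen_surj N : (10 <= N)%N -> forall r, exists q, tower_eval rees_k rees_gen N q = r.
Proof.
move=> N10 r; pose of_poly := tower_eval rees_k rees_gen N.
have img_var i : (i < 10)%N -> exists p, of_poly p = rees_gen i.
  move=> i10; exists (tower_var k N i); apply: tower_eval_var.
  exact: leq_trans i10 N10.
have imgD r1 r2 : (exists p, of_poly p = r1) -> (exists p, of_poly p = r2) ->
    exists p, of_poly p = r1 + r2.
  by move=> [p <-] [q <-]; exists (p + q); rewrite rmorphD.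
have imgM r1 r2 : (exists p, of_poly p = r1) -> (exists p, of_poly p = r2) ->
    exists p, of_poly p = r1 * r2.
  by move=> [p <-] [q <-]; exists (p * q); rewrite rmorphM.
have img0 : exists p, of_poly p = 0 by exists 0; rewrite rmorph0.
have imgX r1 n : (exists p, of_poly p = r1) -> exists p, of_poly p = r1 ^+ n.
  by move=> [p <-]; exists (p ^+ n); rewrite rmorphXn.
have imgC c : exists p, of_poly p = reesC c.
  elim/mpoly3_ind: c => [a f g hf hg|a b c].
    rewrite -mul_mpolyC rmorphD rmorphM /=; apply: imgD => //; apply: imgM => //.
    by exists (tower_const k N a); apply: tower_eval_const.
  rewrite !rmorphM !rmorphXn /=; apply: (imgM _ _); first apply: (imgM _ _); apply: imgX.
  - exact: (img_var 0%N).
  - exact: (img_var 1%N).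
  - exact: (img_var 2%N).
elim/rees_ind: r => // n; elim: n => [|n IHn] c hc.
  have -> : reesM hc = reesC c by apply: val_inj; rewrite /= alg_polyC.
  exact: imgC.
move: (hc) => [s hs ec].
suff [p hp] : exists p, rees_val (of_poly p) = \sum_(u <- s | u \in s) (u.1 * u.2) *: 'X^(n.+1).
  exists p; apply: val_inj; rewrite /= hp -big_seq -scaler_suml.
  by rewrite -ec.
elim/big_rec: _ => [|u f /hs[u1 u2] [q <-]]; first by exists 0; rewrite rmorph0.
have [p hp] : exists p, rees_val (of_poly p) = u.1 *: 'X.
  move/I25P: u1; move: (u.1); apply: in_ideal_ind => [|a f' g fJ [p' hp]].
    by exists 0; rewrite rmorph0 scale0r.
  have [pa ha] := imgC a.
  have [|pj hj] := img_var (index f' (I25_gens k) + 3)%N.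
    by rewrite -[10%N]/(7 + 3)%N ltn_add2r; rewrite -index_mem in fJ.
  exists (pa * pj + p'); rewrite rmorphD rmorphM /= ha hj hp.
  rewrite /rees_gen ltnNge leq_addl /= addnK nth_index // expr1.
  by rewrite mul_polyC scalerA scalerDl.
have [q' hq'] := IHn _ u2.
exists (p * q' + q); rewrite rmorphD rmorphM /= hp hq' /=.
by rewrite -scalerAl -scalerAr scalerA -exprS.
Qed.

Lemma noeth_rees : noeth R.
Proof. exact: noeth_surj (rees_gen_surj (leqnn 10)) (@noeth_tower k 10). Qed.
End ReesGenerators.

(** * Dimension and localization *)

Section AlgebraicDependence.
Variable k : fieldType.

Section Degree.
Variable n : nat.
Local Notation A := {mpoly k[n]}.

Definition deg_le (d : nat) (f : {poly A}) : Prop :=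
  (size f <= d.+1)%N /\ forall i m, (f`_i)@_m != 0 -> (mdeg m <= d)%N.

Lemma deg_leW d e f : (d <= e)%N -> deg_le d f -> deg_le e f.
Proof.
move=> de [sf hf]; split=> [|i m /hf h]; last exact: leq_trans de.
by apply: leq_trans sf _; rewrite ltnS.
Qed.

Lemma deg_leM d e f g : deg_le d f -> deg_le e g -> deg_le (d + e) (f * g).
Proof.
move=> [sf hf] [sg hg]; split=> [|i m].
  rewrite (leq_trans (size_polyMleq _ _)) // -subn1 leq_subLR add1n -addnS -addSn.
  by rewrite leq_add.
rewrite coefM; set F := fun j : 'I_i.+1 => _; rewrite -mcoeff_msupp => /msupp_sum_le.
case/flatten_mapP => j _; rewrite mcoeff_msupp.
rewrite -mcoeff_msupp => /msuppM_le/allpairsP[[m1 m2] /= []].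
rewrite !mcoeff_msupp => /hf h1 /hg h2 ->.
by rewrite mdegD leq_add.
Qed.

Lemma deg_leX d f i : deg_le d f -> deg_le (i * d) (f ^+ i).
Proof.
move=> hf; elim: i => [|i IHi]; last by rewrite exprS mulSn; apply: deg_leM.
split=> [|i m]; first by rewrite size_poly1.
rewrite expr0 coef1; case: (i == 0)%N; last by rewrite mulr0n mcoeff0 eqxx.
by rewrite mulr1n mcoeff1; have [->|] := eqVneq m 0%MM; rewrite ?mdeg0 ?eqxx.
Qed.

Lemma deg_le_exists f : exists d, deg_le d f.
Proof.
exists (maxn (size f) (\max_(i < size f) msize f`_i)); split.
  by rewrite leqW // leq_maxl.
move=> i m; rewrite -mcoeff_msupp => h; have [fi|fi] := ltnP i (size f); last first.
  have fi0 : f`_i = 0 by rewrite nth_default.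
  by move: h; rewrite fi0 mcoeff_msupp mcoeff0 eqxx.
rewrite leq_max; apply/orP; right; apply: leq_trans (leq_bigmax (Ordinal fi)).
exact: ltnW (msize_mdeg_lt h).
Qed.
End Degree.

Lemma card_bmultinom n d : (#|{: 'X_{1..n < d}}| <= d ^ n)%N.
Proof.
case: d => [|d].
  suff -> : #|{: 'X_{1..n < 0}}| = 0%N by [].
  by apply: eq_card0 => -[m hm].
pose f (m : 'X_{1..n < d.+1}) : {ffun 'I_n -> 'I_d.+1} := [ffun i => inord (m i)].
have fI : injective f.
  move=> m m' /ffunP e; apply/val_inj/mnmP => i.
  have lt (a : 'X_{1..n < d.+1}) : (a i < d.+1)%N.
    apply: leq_ltn_trans (bmdeg a); rewrite mdegE (bigD1 i) //=; exact: leq_addr.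
  by have := e i; rewrite !ffunE => /(congr1 val) /=; rewrite !inordK.
by have := leq_card _ fI; rewrite card_ffun !card_ord.
Qed.

Lemma lin_dependent (I J : finType) (M : I -> J -> k) : (#|J| < #|I|)%N ->
  exists2 c : I -> k, exists i, c i != 0 & forall j, \sum_i c i * M i j = 0.
Proof.
move=> ltIJ; pose A := \matrix_(i < #|I|, j < #|J|) M (enum_val i) (enum_val j).
have : kermx A != 0.
  rewrite -mxrank_eq0 mxrank_ker subn_eq0 -ltnNge.
  exact: leq_ltn_trans (rank_leq_col A) ltIJ.
case/rowV0Pn=> v /sub_kermxP vA v0.
exists (fun i => v 0 (enum_rank i)).
  case/rV0Pn: v0 => i vi; exists (enum_val i); by rewrite enum_valK.
move=> j; have /matrixP/(_ 0 (enum_rank j)) := vA; rewrite !mxE => vA0; rewrite -[RHS]vA0.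
rewrite (reindex (@enum_val I predT)) /=; last first.
  by exists enum_rank => i _; rewrite ?enum_valK ?enum_rankK.
by apply: eq_bigr => i _; rewrite !mxE enum_valK enum_rankK.
Qed.

(* Monomials in n + 2 elements of k[x_1, ..., x_n][T] outnumber the monomials of
   the degrees that they involve. *)
Lemma algebraic_dependence n (F : nat -> {poly {mpoly k[n]}}) :
  exists2 q : {mpoly k[n.+2]}, q != 0 &
    mmap (polyC \o @mpolyC n k) (fun i : 'I_n.+2 => F i) q = 0.
Proof.
have [d hd] : exists d, forall i : 'I_n.+2, deg_le d (F i).
  have /choice[D hD] (i : 'I_n.+2) := deg_le_exists (F i).
  exists (\max_i D i) => i; apply: deg_leW (hD i); exact: leq_bigmax.
(* N^(n+2) products are compared with at most B^(n+1) monomials. Since B is at most N ((n+2) d + 1),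
   it is enough that N exceeds ((n+2) d + 1)^(n+1). *)
pose N := ((n.+2 * d + 1) ^ n.+1).+1; pose B := (n.+2 * (N * d)).+1.
pose mon (e : {ffun 'I_n.+2 -> 'I_N}) : 'X_{1..n.+2} := [multinom (e i : nat) | i < n.+2].
pose Fm e : {poly {mpoly k[n]}} := \prod_(i < n.+2) F i ^+ mon e i.
have Fdeg e : deg_le (n.+2 * (N * d)) (Fm e).
  apply: (@deg_leW _ (\sum_(i < n.+2) N * d)); first by rewrite sum_nat_const card_ord.
  rewrite /Fm; elim/big_ind2: _ => [||i _]; first exact: (deg_leX 0 (hd ord0)).
    by move=> ? ? ? ?; apply: deg_leM.
  apply: deg_leW (deg_leX _ (hd i)); rewrite leq_mul2r mnmE ltnW ?orbT //.
have [|c [e0 ce0] hc] := @lin_dependent {ffun 'I_n.+2 -> 'I_N}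
    ('I_B * 'X_{1..n < B})%type (fun e j => ((Fm e)`_(j.1))@_(j.2)).
  rewrite card_prod card_ord card_ffun !card_ord.
  apply: (@leq_ltn_trans (B ^ n.+1)); first by rewrite expnS leq_mul2l card_bmultinom orbT.
  apply: (@leq_ltn_trans ((N * (n.+2 * d + 1)) ^ n.+1)).
    by rewrite leq_exp2r // /B mulnDr muln1 mulnCA -addn1 leq_add2l.
  rewrite expnMn [in X in (_ < X)%N]expnSr ltn_pmul2l // expn_gt0.
  by rewrite /N.
pose q : {mpoly k[n.+2]} := \sum_e c e *: 'X_[mon e].
have monI : injective mon.
  move=> e e' /mnmP h; apply/ffunP => i; apply: val_inj.
  by have := h i; rewrite !mnmE.
exists q.
  apply/eqP => /(congr1 (mcoeff (mon e0))); rewrite mcoeff0 raddf_sum /=.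
  rewrite (bigD1 e0) //= mcoeffZ mcoeffX eqxx mulr1 big1 ?addr0 => [|e ne].
    by apply/eqP.
  by rewrite mcoeffZ mcoeffX (inj_eq monI) (negbTE ne) mulr0.
rewrite raddf_sum /=; under eq_bigr do rewrite mmapZ mmapX /=.
apply/polyP => i; rewrite coef0 coef_sum; apply/mpolyP => m; rewrite mcoeff0 raddf_sum /=.
under eq_bigr do rewrite coefCM mcoeffCM.
have zero e : (B <= i)%N || (B <= mdeg m)%N -> ((Fm e)`_i)@_m = 0.
  have [sF hF] := Fdeg e.
  case/orP => h.
    by rewrite (_ : _`_i = 0) ?mcoeff0 // nth_default // (leq_trans sF).
  apply/eqP; apply: contraTT h => /hF; rewrite -ltnS -ltnNge; exact.
have [iB|iB] := ltnP i B; last first.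
  by rewrite big1 // => e _; rewrite zero ?mulr0 ?iB.
have [mB|mB] := ltnP (mdeg m) B; last first.
  by rewrite big1 // => e _; rewrite zero ?mulr0 ?mB ?orbT.
exact: (hc (Ordinal iB, BMultinom mB)).
Qed.
End AlgebraicDependence.

Section IdealPackaging.
Variable R : comNzRingType.

Section Ideal.
Variables (J : R -> Prop) (idJ : prop_ideal J) (J1 : ~ J 1).

Lemma asbool_idealr_closed : idealr_closed [pred x | `[< J x >]].
Proof.
have [J0 JD JM] := idJ; split; rewrite ?inE; first exact/asboolP.
  by apply/asboolP.
by move=> a u v; rewrite !inE => /asboolP hu /asboolP hv; apply/asboolP/JD/hv/JM.
Qed.

Definition mk_idealr : idealr R :=
  HB.pack_for (idealr R) (fun x => `[< J x >])
    (@isIdealr.Build R (fun x => `[< J x >]) asbool_idealr_closed).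

Lemma mem_mk_idealr x : x \in mk_idealr <-> J x.
Proof. by split=> [/asboolP|h]; last exact/asboolP. Qed.

Hypothesis primeJ : forall x y, J (x * y) -> J x \/ J y.

Lemma asbool_prime_closed : prime_idealr_closed (fun x => `[< J x >]).
Proof.
move=> x y /asboolP /primeJ[h|h]; apply/orP; [left|right]; exact/asboolP.
Qed.

Definition mk_prime : prime_idealr R :=
  HB.pack_for (prime_idealr R) (fun x => `[< J x >])
    (@isIdealr.Build R (fun x => `[< J x >]) asbool_idealr_closed)
    (@isPrimeIdealrClosed.Build R (fun x => `[< J x >]) asbool_prime_closed).

Lemma mem_mk_prime x : x \in mk_prime <-> J x.
Proof. by split=> [/asboolP|h]; last exact/asboolP. Qed.
End Ideal.
End IdealPackaging.

(** * Primes disjoint from a multiplicative set *)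

Section PrimeAvoidance.
Variables (R : comNzRingType) (J M : R -> Prop).
Hypotheses (idJ : prop_ideal J) (M1 : M 1) (MM : forall x y, M x -> M y -> M (x * y)).
Hypothesis JM : forall x, J x -> ~ M x.

Let good (X : R -> Prop) :=
  [/\ prop_ideal X, forall x, J x -> X x & forall x, X x -> ~ M x].

Let adjoin (X : R -> Prop) y : R -> Prop := fun z => exists2 u, X u & exists r, z = u + r * y.

Let idJ_adjoin X y : prop_ideal X -> prop_ideal (adjoin X y).
Proof.
move=> [X0 XD XM]; split; first by exists 0 => //; exists 0; rewrite mul0r addr0.
- move=> _ _ [u Xu [r ->]] [v Xv [s ->]]; exists (u + v); first exact: XD.
  by exists (r + s); ring.
- move=> a _ [u Xu [r ->]]; exists (a * u); first exact: XM.
  by exists (a * r); ring.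
Qed.

(** An ideal maximal among those that contain J and are disjoint from the multiplicative set M is
    prime. *)
Lemma prime_avoiding : exists Q : prime_idealr R,
  (forall x, J x -> x \in Q) /\ forall x, M x -> x \notin Q.
Proof.
pose P X := (forall x, ~ X x) \/ good X.
have [F FP Ftot|A [PA Amax]] := @classical_sets.Zorn_bigcup R P.
  have [[X FX [x0 Xx0]]|none] := pselect (exists2 X, F X & exists x, X x); last first.
    by left=> x [X FX Xx]; apply: none; exists X => //; exists x.
  right; have gF Y : F Y -> (exists y, Y y) -> good Y.
    by move=> FY [y Yy]; have [/(_ y)|] := FP Y FY.
  have [[X0 XD XM] JX XdM] := gF X FX (ex_intro _ x0 Xx0).
  split=> [|x /JX Xx|x [Y FY Yx]]; [split|by exists X|].
  - by exists X.
  - move=> x y [Y FY Yx] [Z FZ Zy].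
    have [[_ YD _] _ _] := gF Y FY (ex_intro _ x Yx).
    have [[_ ZD _] _ _] := gF Z FZ (ex_intro _ y Zy).
    have [YZ|ZY] := Ftot Y Z FY FZ.
      by exists Z => //; apply: ZD => //; apply: YZ.
    by exists Y => //; apply: YD => //; apply: ZY.
  - move=> a x [Y FY Yx]; have [[_ _ YM] _ _] := gF Y FY (ex_intro _ x Yx).
    by exists Y => //; apply: YM.
  - by have [_ _ YdM] := gF Y FY (ex_intro _ x Yx); apply: YdM.
have goodJ : good J by split.
have gA : good A.
  case: PA => // A0; case: (Amax J); last by right.
  by split=> [x /A0//|JA]; apply: (A0 0); apply: JA; case: idJ.
have [idA JA AdM] := gA; have [A0 AD AM] := idA.
have A1 : ~ A 1 by move/AdM; apply.
have adj y : ~ A y -> exists2 m, M m & exists2 u, A u & exists r, m = u + r * y.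
  move=> nAy; apply: contrapT => nM; apply: (Amax (adjoin A y)).
    split=> [x Ax|sub]; first by exists x => //; exists 0; rewrite mul0r addr0.
    by apply/nAy/sub; exists 0 => //; exists 1; rewrite mul1r add0r.
  right; split; first exact: idJ_adjoin.
    by move=> x /JA Ax; exists x => //; exists 0; rewrite mul0r addr0.
  by move=> m [u Au e] Mm; apply: nM; exists m => //; exists u.
have primeA x y : A (x * y) -> A x \/ A y.
  move=> Axy; apply: contrapT => /not_orP[/adj[m Mm [u Au [r em]]] /adj[n Mn [v Av [s en]]]].
  apply: (AdM (m * n)); last exact: MM.
  have -> : m * n = n * u + (r * x * v + r * s * (x * y)) by rewrite em en; ring.
  by apply: (AD _ _ (AM _ _ Au)); apply: AD; apply: AM.
exists (mk_prime idA A1 primeA); split=> x.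
  by move/JA => h; apply/mem_mk_prime.
by move=> Mx; apply/negP => /mem_mk_prime /AdM.
Qed.
End PrimeAvoidance.

Section RegularChain.
Variable R : comNzRingType.

(* If x is regular modulo J, a prime P containing J and x contains a prime that
   contains J but not x: avoid the products of powers of x and elements outside
   P. *)
Lemma regular_prime_below (s : seq R) x (P : prime_idealr R) :
  (forall y, in_ideal s (x * y) -> in_ideal s y) -> (forall y, y \in s -> y \in P) ->
  exists Q : prime_idealr R,
    [/\ forall y, y \in s -> y \in Q, forall y, y \in Q -> y \in P & x \notin Q].
Proof.
move=> reg sP.
have sP' y : in_ideal s y -> y \in P.
  apply: (in_ideal_sub (J := fun y => y \in P)) => //; split.
  - exact: rpred0.
  - by move=> a b; apply: rpredD.
  - by move=> a b; apply: idealMr.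
have [||||Q [JQ MQ]] := @prime_avoiding R (in_ideal s)
    (fun y => exists2 u, u \notin P & exists n, y = u * x ^+ n).
- exact: prop_ideal_in.
- by exists 1; [rewrite idealr1|exists 0; rewrite mulr1].
- move=> _ _ [u uP [m ->]] [v vP [n ->]]; exists (u * v); first by rewrite prime_idealrM negb_or uP.
  by exists (m + n)%N; rewrite exprD; ring.
- move=> y hy [u uP [n e]]; move: hy; rewrite {y}e.
  elim: n => [|n IHn]; first by rewrite mulr1 => /sP'; apply/negP.
  by rewrite exprS mulrCA => /reg.
exists Q; split=> [y ys|y yQ|]; first exact/JQ/in_ideal_mem.
  apply: contraTT yQ => yP; apply: MQ; exists y => //.
  by exists 0%N; rewrite mulr1.
apply: MQ; exists 1; first by rewrite idealr1.
by exists 1%N; rewrite mul1r expr1.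
Qed.

(** Start from a prime containing s and go down: removing the last element of the sequence yields a
    strictly smaller prime over the rest. *)
Lemma regular_chain (s : seq R) : regular_seq s -> prime_chain R (size s).
Proof.
move=> [reg s1].
have [||||Q [sQ _]] := @prime_avoiding R (in_ideal s) (fun x => x = 1).
- exact: prop_ideal_in.
- by [].
- by move=> x y -> ->; rewrite mulr1.
- by move=> x sx x1; apply: s1; rewrite -x1.
have chain n (P : prime_idealr R) : (n <= size s)%N -> (forall y, y \in take n s -> y \in P) ->
    exists F : nat -> prime_idealr R, F n = P /\ forall i j, (i < j <= n)%N ->
      {subset F i <= F j} /\ ~ {subset F j <= F i}.
  elim: n P => [|n IHn] P ns sP.
    by exists (fun=> P); split=> // i j /andP[ij]; rewrite leqn0 => /eqP j0; rewrite j0 in ij.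
  have tk : take n.+1 s = rcons (take n s) s`_n by apply: take_nth.
  have [||Q' [sQ' Q'P xQ']] := @regular_prime_below (take n s) s`_n P.
  - exact: reg.
  - by move=> y yt; apply: sP; rewrite tk mem_rcons inE yt orbT.
  have xP : s`_n \in P by apply: sP; rewrite tk mem_rcons mem_head.
  have [F [Fn hF]] := IHn Q' (ltnW ns) sQ'.
  exists (fun i => if (i <= n)%N then F i else P); rewrite ltnn; split=> // i j /andP[ij].
  rewrite leq_eqVlt => /orP[/eqP ej|]; last first.
    by rewrite ltnS => jn; rewrite jn (ltnW (leq_trans ij jn)); apply: hF; rewrite ij.
  rewrite ej ltnn in ij *; rewrite ltnS in ij; rewrite ij.
  have FQ : {subset F i <= Q'}.
    move: ij; rewrite leq_eqVlt => /orP[/eqP->|ij]; first by rewrite Fn.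
    by rewrite -Fn; apply: (hF i n _).1; rewrite ij leqnn.
  split=> [y /FQ/Q'P//|sub]; move: xQ'.
  by rewrite (FQ _ (sub _ xP)).
have [F [_ hF]] := chain (size s) Q (leqnn _) (fun y ys => sQ y (in_ideal_mem (mem_take ys))).
exists (fun i => F i) => i j ij; apply: hF; rewrite ij.
by rewrite -ltnS ltn_ord.
Qed.
End RegularChain.

(** * Localization at a prime ideal *)

Section LocalizationTheory.
Variables (R : comNzRingType) (p : prime_idealr R).
Local Notation L := (localization p).
Local Notation fr := (loc_frac (p := p)).

Definition loc_of (a : R) : L := fr a (notin_prime1 p).

Lemma loc_fracP a s (hs : s \notin p) b t (ht : t \notin p) :
  fr a hs = fr b ht <-> exists2 u, u \notin p & u * (a * t) = u * (b * s).
Proof. exact: loc_eqP. Qed.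

Lemma loc_frac_eq a s (hs : s \notin p) b t (ht : t \notin p) :
  a * t = b * s -> fr a hs = fr b ht.
Proof.
by move=> e; apply/loc_fracP; exists 1; rewrite ?notin_prime1 ?e.
Qed.

Lemma loc_fracD a s (hs : s \notin p) b t (ht : t \notin p) :
  fr a hs + fr b ht = fr (a * t + b * s) (notin_primeM hs ht).
Proof. exact: loc_addE. Qed.

Lemma loc_fracN a s (hs : s \notin p) : - fr a hs = fr (- a) hs.
Proof. exact: loc_oppE. Qed.

Lemma loc_fracM a s (hs : s \notin p) b t (ht : t \notin p) :
  fr a hs * fr b ht = fr (a * b) (notin_primeM hs ht).
Proof. exact: loc_mulE. Qed.

Lemma loc_of_is_zmod : zmod_morphism loc_of.
Proof.
move=> a b; rewrite /loc_of loc_fracN loc_fracD; apply: loc_frac_eq; ring.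
Qed.
Lemma loc_of_is_monoid : monoid_morphism loc_of.
Proof. by split=> // a b; rewrite /loc_of loc_fracM; apply: loc_frac_eq; ring. Qed.
HB.instance Definition _ := GRing.isZmodMorphism.Build R L loc_of loc_of_is_zmod.
HB.instance Definition _ := GRing.isMonoidMorphism.Build R L loc_of loc_of_is_monoid.

Lemma locP (x : L) : exists a s, exists hs : s \notin p, x = fr a hs.
Proof.
by elim/quotW: x => -[[a s] hs]; exists a, s, hs.
Qed.

Lemma loc_frac_den a s (hs : s \notin p) : fr a hs * loc_of s = loc_of a.
Proof. by rewrite loc_fracM; apply: loc_frac_eq; ring. Qed.

Lemma loc_of_unit s : s \notin p -> exists t : L, loc_of s * t = 1.
Proof.
by move=> hs; exists (fr 1 hs); rewrite mulrC loc_frac_den rmorph1.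
Qed.

Lemma loc_of_eq a b : loc_of a = loc_of b <-> exists2 u, u \notin p & u * a = u * b.
Proof. by rewrite loc_fracP !mulr1. Qed.

Lemma noeth_loc : noeth R -> noeth L.
Proof.
move=> hR J [J0 JD JM].
have [|s hs] := hR (fun a => J (loc_of a)).
  split=> [|a b|a b]; first by rewrite rmorph0.
  - by rewrite rmorphD; apply: JD.
  - by rewrite rmorphM; apply: JM.
exists (map loc_of s) => x; split; last first.
  apply: in_ideal_sub; first by split.
  by move=> _ /mapP[a as_ ->]; apply/hs/in_ideal_mem.
have [a [t [ht ->]]] := locP x; move=> Jx.
have Ja : J (loc_of a) by rewrite -(loc_frac_den a ht) mulrC; apply: JM.
have [t' tt'] := loc_of_unit ht.
have -> : fr a ht = t' * loc_of a by rewrite -(loc_frac_den a ht) mulrCA (mulrC t') tt' mulr1.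
apply: in_idealMl; move/hs: Ja; move: a {Jx}; apply: in_ideal_ind => [|a f g fs hg].
  by rewrite rmorph0; apply: in_ideal0.
by rewrite rmorphD rmorphM; apply/in_idealD/hg/in_idealMl/in_ideal_mem/map_f.
Qed.

Definition loc_max (x : L) : Prop := exists a s, exists hs : s \notin p,
  a \in p /\ x = fr a hs.

Lemma loc_maxE a s (hs : s \notin p) : loc_max (fr a hs) <-> a \in p.
Proof.
split=> [[b [t [ht [bp /loc_fracP[u up e]]]]]|ap]; last by exists a, s, hs.
have : u * (a * t) \in p by rewrite e !prime_idealrM bp orbT.
by rewrite !prime_idealrM (negbTE up) (negbTE ht) orbF.
Qed.

Lemma loc_max_ideal : prop_ideal loc_max.
Proof.
split=> [|x y|x y].
- by apply/loc_maxE; apply: rpred0.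
- have [a [s [hs ->]]] := locP x; have [b [t [ht ->]]] := locP y.
  rewrite loc_fracD !loc_maxE => ap bp.
  by rewrite rpredD // prime_idealrM ?ap ?bp ?orbT.
- have [a [s [hs ->]]] := locP x; have [b [t [ht ->]]] := locP y.
  by rewrite loc_fracM !loc_maxE => bp; rewrite prime_idealrM bp orbT.
Qed.

Lemma loc_max1 : ~ loc_max 1.
Proof. by move=> /loc_maxE; rewrite idealr1. Qed.

Definition loc_maximal : idealr L := mk_idealr loc_max_ideal loc_max1.

Lemma loc_notin_unit x : x \notin loc_maximal -> exists y, x * y = 1.
Proof.
have [a [s [hs ->]]] := locP x => h.
have ap : a \notin p by apply: contra h => ap; apply/mem_mk_idealr/loc_maxE.
by exists (fr s ap); rewrite loc_fracM; apply: loc_frac_eq; ring.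
Qed.

Lemma proper_sub_loc_maximal (J : idealr L) : {subset J <= loc_maximal}.
Proof.
move=> x xJ; apply/negPn/negP => /loc_notin_unit[y xy].
by have := idealMr y xJ; rewrite mulrC xy idealr1.
Qed.

Lemma local_ring_loc : local_ring loc_maximal.
Proof.
split=> [J sub x|J Jmax x].
  by apply/idP/idP => [/proper_sub_loc_maximal|/sub].
by have /(_ x) := Jmax loc_maximal (@proper_sub_loc_maximal J).
Qed.

Lemma loc_of_maximal a : (loc_of a \in loc_maximal) = (a \in p).
Proof. by apply/idP/idP => [/mem_mk_idealr/loc_maxE|h]; last exact/mem_mk_idealr/loc_maxE. Qed.

Lemma in_ideal_loc (s : seq R) a :
  in_ideal (map loc_of s) (loc_of a) <-> exists2 u, u \notin p & in_ideal s (u * a).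
Proof.
split=> [|[u up h]].
  move=> h; suff [u up [b bs]] : exists2 u, u \notin p & exists2 b, in_ideal s b &
      loc_of a * loc_of u = loc_of b.
    rewrite -rmorphM => /loc_of_eq[v vp e]; exists (v * u); first exact: notin_primeM.
    by rewrite -mulrA (mulrC u) e; apply: in_idealMl.
  move: (loc_of a) h; apply: in_ideal_ind.
    by exists 1; [exact: notin_prime1|exists 0; rewrite ?rmorph0 ?mul0r //; apply: in_ideal0].
  move=> x _ y /mapP[f fs ->] [u up [b bs e]].
  have [c [t [ht ->]]] := locP x; exists (t * u); first exact: notin_primeM.
  exists (u * c * f + t * b).
    by apply: in_idealD; apply: in_idealMl => //; apply: in_ideal_mem.
  by rewrite rmorphD !rmorphM /= -e -(loc_frac_den c ht); ring.
have [u' uu'] := loc_of_unit up.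
have -> : loc_of a = u' * loc_of (u * a) by rewrite rmorphM mulrA (mulrC u') uu' mul1r.
apply: in_idealMl; move: (u * a) h; apply: in_ideal_ind => [|c f g fs hg].
  by rewrite rmorph0; apply: in_ideal0.
by rewrite rmorphD rmorphM; apply/in_idealD/hg/in_idealMl/in_ideal_mem/map_f.
Qed.

(** Regularity of the images in the localization, expressed in R: the colon conditions hold up to a
    factor outside p. *)
Definition loc_regular (s : seq R) : Prop := forall i, (i < size s)%N ->
  forall a, in_ideal (take i s) (s`_i * a) -> exists2 u, u \notin p & in_ideal (take i s) (u * a).

Lemma regular_seq_loc (s : seq R) : loc_regular s -> {subset s <= p} ->
  regular_seq (map loc_of s) /\ {subset map loc_of s <= loc_maximal}.
Proof.
move=> reg sp; have sub : {subset map loc_of s <= loc_maximal}.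
  by move=> _ /mapP[a as_ ->]; rewrite loc_of_maximal; apply: sp.
split=> //; split=> [i|].
  rewrite size_map => i_s x; rewrite -map_take (nth_map 0) //.
  have [a [t [ht ->]]] := locP x; have [t' tt'] := loc_of_unit ht.
  have xE : fr a ht = t' * loc_of a by rewrite -(loc_frac_den a ht) mulrCA (mulrC t') tt' mulr1.
  move/(in_idealMl (loc_of t)); rewrite mulrCA (mulrC (loc_of t)) loc_frac_den -rmorphM.
  move/in_ideal_loc=> [u up]; rewrite mulrCA => /(reg i i_s)[v vp h].
  rewrite xE; apply/in_idealMl/in_ideal_loc; exists (v * u); first exact: notin_primeM.
  by rewrite -mulrA.
move=> h; have : 1 \in loc_maximal.
  apply: (in_ideal_sub (J := fun y => y \in loc_maximal)) h => //; split.
  - exact: rpred0.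
  - by move=> a b; apply: rpredD.
  - by move=> a b; apply: idealMr.
by rewrite idealr1.
Qed.
End LocalizationTheory.

(** * The dimension bound and the Cohen-Macaulay criterion *)

Section DimensionBound.
Variables (k : idomainType) (A : comNzRingType) (f : {rmorphism k -> A}).
Hypothesis f0 : forall (c : k) (Q : prime_idealr A), c != 0 -> f c \notin Q.

(* Compare the coefficient of the lowest power of the outermost variable, which
   lies in the second but not in the first prime of the chain. *)
Lemma chain_independent n (s : nat -> A) (P : nat -> prime_idealr A) :
  (forall i, (i < n)%N -> [/\ {subset P i <= P i.+1}, s (n - i.+1)%N \in P i.+1
      & s (n - i.+1)%N \notin P i]) ->
  forall q : tower k n, q != 0 -> tower_eval f s n q \notin P 0%N.
Proof.
elim: n P => [|n IHn] P hP q q0; first exact: f0.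
have [P01 sP1 sP0] := hP 0%N isT; rewrite subn1 /= in sP1 sP0.
have [e qe hq] : exists2 e, (q : {poly tower k n})`_e != 0 &
    exists r : {poly tower k n}, q = 'X^e * (((q : {poly tower k n})`_e)%:P + 'X * r).
  have ex : exists e, (q : {poly tower k n})`_e != 0.
    by exists (size (q : {poly tower k n})).-1; rewrite -lead_coefE lead_coef_eq0.
  case: (ex_minnP ex) => e qe emin; exists e => //.
  exists (drop_poly e.+1 q); apply/polyP => j; rewrite coefXnM coefD coefC coefXM.
  case: ltnP => je; first by apply/eqP; apply: contraTT je => /emin; rewrite -leqNgt.
  rewrite subn_eq0; have [ej|ej] := leqP j e.
    have -> : j = e by apply/eqP; rewrite eqn_leq ej.
    by rewrite addr0.
  by rewrite add0r coef_drop_poly -subn1 -subnDA addn1 subnK.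
have [r hr] := hq; rewrite hr rmorphM rmorphXn rmorphD rmorphM /=.
rewrite !(tower_evalX, tower_evalC) prime_idealrM negb_or; apply/andP; split.
  by elim: (e) => [|j IHj]; rewrite ?expr0 ?idealr1 // exprS prime_idealrM negb_or sP0.
apply/negP => /P01 h; have : tower_eval f s n (q : {poly tower k n})`_e \in P 1%N.
  rewrite -(rpredDr _ (_ : s n * tower_eval f s n.+1 r \in P 1%N)) //.
  by rewrite mulrC; apply: idealMr.
apply/negP; apply: (IHn (fun i => P i.+1)) => // i ni.
by have := hP i.+1 ni; rewrite subSS.
Qed.
End DimensionBound.

Section CohenMacaulayCriterion.
Variables (k : fieldType) (R : comNzRingType) (f : {rmorphism k -> R}) (d : nat).
Hypothesis noethR : noeth R.
Hypothesis depR : forall s : nat -> R, exists2 q : tower k d.+1, q != 0 &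
  tower_eval f s d.+1 q = 0.

Lemma loc_chain_bound (p : prime_idealr R) n : prime_chain (localization p) n -> (n <= d)%N.
Proof.
move=> [P hP]; rewrite leqNgt; apply/negP => dn.
pose Pn i : prime_idealr (localization p) := P (inord i).
(* Clearing denominators gives elements of R itself that separate consecutive primes. *)
have /choice[s hs] (i : 'I_d.+1) : exists r : R,
    loc_of p r \in Pn i.+1 /\ loc_of p r \notin Pn i.
  have [sub nsub] : {subset Pn i <= Pn i.+1} /\ ~ {subset Pn i.+1 <= Pn i}.
    have i1 : (i.+1 < n.+1)%N by rewrite ltnS (leq_trans (ltn_ord i)).
    by apply: hP; rewrite !inordK // (ltn_trans _ i1).
  have [x xP xN] : exists2 x, x \in Pn i.+1 & x \notin Pn i.
    apply: contrapT => h; apply: nsub => x xP; apply: contrapT => /negP xN.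
    by apply: h; exists x.
  have [a [t [ht ex]]] := locP x; have [t' tt'] := loc_of_unit ht.
  exists a; rewrite -(loc_frac_den a ht) -ex; split; first by rewrite mulrC idealMr.
  apply: contra xN => h; have := idealMr t' h.
  by rewrite mulrCA (mulrC t') tt' mulr1.
(* Reversed order: in [chain_independent] the outermost variable belongs to the bottom of the
   chain. *)
have [q q0 hq] := depR (fun j => s (inord (d - j))).
have := @chain_independent k _ (GRing.RMorphism.clone _ _ (loc_of p \o f) _) _ d.+1
  (fun j => loc_of p (s (inord (d - j)))) Pn _ q q0.
have -> : tower_eval (GRing.RMorphism.clone _ _ (loc_of p \o f) _)
    (fun j => loc_of p (s (inord (d - j)))) d.+1 q =
    loc_of p (tower_eval f (fun j => s (inord (d - j))) d.+1 q).
  apply: (tower_ext (h := GRing.RMorphism.clone _ _ (loc_of p \o _) _)) => [c|i id].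
    by rewrite tower_eval_const -[RHS]/(loc_of p (tower_eval _ _ _ _)) tower_eval_const.
  by rewrite tower_eval_var // -[RHS]/(loc_of p (tower_eval _ _ _ _)) tower_eval_var.
rewrite hq rmorph0 rpred0 => h; suff: false by []; apply: h.
  move=> c Q c0; apply/negP => h.
  have := idealMr (loc_of p (f c^-1)) (h : loc_of p (f c) \in Q).
  by rewrite -!rmorphM mulVf // !rmorph1 idealr1.
move=> i id; have e : inord (d - (d.+1 - i.+1)) = inord i :> 'I_d.+1.
  by congr inord; rewrite subSS subKn.
rewrite e; have [h1 h2] := hs (inord i); rewrite inordK // in h1 h2; split=> //.
have i1 : (i.+1 < n.+1)%N by rewrite ltnS (leq_trans id).
by apply: (hP _ _ _).1; rewrite !inordK // (ltn_trans _ i1).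
Qed.

(** The given sequence bounds dimension and depth from below by d; the chain bound caps both, since
    regular sequences yield chains. *)
Lemma cohen_macaulay_criterion :
  (forall p : prime_idealr R, maximal_ideal p -> exists2 s : seq R,
     loc_regular p s & {subset s <= p} /\ size s = d) ->
  cohen_macaulay R.
Proof.
move=> hs; split; first exact: noeth_noetherian.
move=> p pmax; split; first exact/noeth_noetherian/noeth_loc.
exists (loc_maximal p); first exact: local_ring_loc.
have [s reg [sp ss]] := hs p pmax.
have [reg' sub] := regular_seq_loc reg sp.
exists d; split.
- by rewrite -ss -(size_map (loc_of p)); apply: regular_chain.
- exact: loc_chain_bound.
- by exists (map (loc_of p) s); split; rewrite // size_map.
- by move=> t treg _; apply/loc_chain_bound/regular_chain/treg.
Qed.
End CohenMacaulayCriterion.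

(** * Maximal ideals *)

Section IntegralScaling.
Variables (C : comNzRingType) (K : fieldType) (phi : {rmorphism C -> K}).
Local Notation int_ := (integralOver phi).

Lemma integral_exp u n : int_ u -> int_ (u ^+ n).
Proof.
move=> hu; elim: n => [|n IHn]; first exact: integral1.
by rewrite exprS; apply: integral_mul.
Qed.

Lemma integral_bigsum (I : Type) (r : seq I) (P : pred I) (F : I -> K) :
  (forall i, P i -> int_ (F i)) -> int_ (\sum_(i <- r | P i) F i).
Proof.
by move=> h; elim/big_ind: _ => //; [exact: integral0|exact: integral_add].
Qed.

(** t v is a root of the monic polynomial with coefficients t^(m - i) P_i, and these are integral
    because t P_i is. *)
Lemma integral_scale (P : {poly K}) t v : P \is monic -> root P v -> int_ t ->
  (forall i, int_ (t * P`_i)) -> int_ (t * v).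
Proof.
move=> mP rP ht hP; set m := (size P).-1.
have sP : size P = m.+1 by rewrite prednK // size_poly_gt0 monic_neq0.
have Pm : P`_m = 1 by move/monicP: mP; rewrite lead_coefE.
pose Q := \poly_(i < m.+1) (t ^+ (m - i) * P`_i).
have Qm : Q`_m = 1 by rewrite coef_poly ltnSn subnn Pm mulr1.
have sQ : size Q = m.+1.
  apply/eqP; rewrite eqn_leq size_poly ltnNge; apply/negP => h.
  by have := oner_neq0 K; rewrite -Qm nth_default // eqxx.
apply: (integral_root_monic (p := Q)).
- by rewrite monicE lead_coefE sQ Qm.
- apply/rootP; rewrite horner_coef sQ.
  transitivity (t ^+ m * P.[v]); last by rewrite (rootP rP) mulr0.
  rewrite horner_coef sP mulr_sumr; apply: eq_bigr => i _.
  rewrite coef_poly ltn_ord exprMn mulrACA -mulrA mulrCA mulrA -exprD.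
  by rewrite addnC subnK -1?ltnS // mulrA.
- apply/integral_poly => i; rewrite coef_poly; case: ltnP => im; last exact: integral0.
  move: im; rewrite ltnS leq_eqVlt => /orP[/eqP->|im].
    by rewrite subnn mul1r Pm; apply: integral1.
  by rewrite -(subnSK im) exprSr -mulrA; apply: integral_mul => //; apply: integral_exp.
Qed.

Lemma integral_lead (P : {poly K}) v : P != 0 -> root P v -> (forall i, int_ P`_i) ->
  int_ (lead_coef P * v).
Proof.
move=> P0 rP hP; have a0 : lead_coef P != 0 by rewrite lead_coef_eq0.
apply: (integral_scale (P := (lead_coef P)^-1 *: P)).
- by rewrite monicE lead_coefZ mulVf.
- by rewrite rootZ ?invr_eq0.
- by rewrite lead_coefE.
- by move=> i; rewrite coefZ mulrA mulfV // mul1r.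
Qed.

Lemma integral_scaled_horner (a al : K) (F : {poly K}) e : int_ a -> int_ (a * al) ->
  (forall i, int_ F`_i) -> (size F <= e.+1)%N -> int_ (a ^+ e * F.[al]).
Proof.
move=> ha haal hF sF; rewrite (horner_coef_wide _ sF) mulr_sumr.
apply: integral_bigsum => i _.
have -> : a ^+ e * (F`_i * al ^+ i) = F`_i * (a ^+ (e - i) * (a * al) ^+ i).
  rewrite exprMn mulrA [a ^+ (e - i) * _]mulrA -exprD subnK -1?ltnS //.
  by rewrite mulrA [a ^+ e * _]mulrC -mulrA.
by apply: integral_mul => //; apply: integral_mul; apply: integral_exp.
Qed.

(* A relation q(g) = 0 with nonzero constant term b expresses b / g as a
   polynomial in g. *)
Lemma integral_inverse g : int_ g -> g != 0 ->
  exists2 b : C, phi b != 0 & int_ (phi b / g).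
Proof.
move=> hg g0; have [q mq rq] := hg; pose Q := map_poly phi q.
have mQ : Q \is monic by rewrite monic_map.
have ex : exists s, Q`_s != 0.
  by exists (size Q).-1; rewrite -lead_coefE lead_coef_eq0 monic_neq0.
case: (ex_minnP ex) => s Qs smin; exists q`_s; first by rewrite -coef_map.
pose Q1 := drop_poly s Q.
have QE : Q = Q1 * 'X^s.
  rewrite -[LHS](poly_take_drop s) (_ : take_poly s Q = 0) ?add0r //.
  apply/polyP => j; rewrite coef_take_poly coef0; case: ltnP => // js.
  by apply/eqP; apply: contraTT js => /smin; rewrite -leqNgt.
have Q1g : Q1.[g] = 0.
  have /rootP : root Q g by [].
  by rewrite QE hornerM hornerXn => /eqP; rewrite mulf_eq0 expf_eq0 (negbTE g0) andbF orbF => /eqP.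
have Q10 : Q1`_0 = phi q`_s by rewrite coef_drop_poly add0n coef_map.
have -> : phi q`_s / g = - (drop_poly 1 Q1).[g].
  apply: (mulIf g0); rewrite divfK // mulNr; apply/eqP; rewrite -addr_eq0 -Q10; apply/eqP.
  rewrite -[RHS]Q1g -[in RHS](poly_take_drop 1 Q1) hornerD hornerM hornerXn expr1.
  congr (_ + _); rewrite (_ : take_poly 1 Q1 = (Q1`_0)%:P) ?hornerC //.
  by apply/polyP => j; rewrite coef_take_poly coefC; case: j.
apply/integral_opp; rewrite horner_coef; apply: integral_bigsum => i _.
apply: integral_mul; last exact: integral_exp.
by rewrite !coef_drop_poly coef_map; apply: integral_id.
Qed.
End IntegralScaling.

Section ZariskiStep.
Variables (C : comNzRingType) (K : fieldType) (phi : {rmorphism C -> K}) (al : K).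
Let Phi : {rmorphism {poly C} -> K} :=
  GRing.RMorphism.clone _ _ (horner_morph (f := phi) (u := al) (fun a => mulrC _ _)) _.

Let PhiE q : Phi q = (map_poly phi q).[al]. Proof. by []. Qed.

(* If al were transcendental, 1 / (1 + X f) would be integral over C[X][1/f], so
   that 1 + X f would divide a power of f. *)
Lemma zariski_algebraic (f : {poly C}) : Phi f != 0 ->
  (forall u, exists N, integralOver Phi (Phi f ^+ N * u)) ->
  exists2 q : {poly C}, map_poly phi q != 0 & root (map_poly phi q) al.
Proof.
move=> f0 h; apply: contrapT => nalg.
have tr q : Phi q = 0 -> map_poly phi q = 0.
  by move=> q0; apply: contrapT => /eqP nz; apply: nalg; exists q => //; apply/rootP.
pose F := map_poly phi f; pose g : {poly C} := 1 + 'X * f; pose G := map_poly phi g.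
have F0 : F != 0 by apply: contraNneq f0 => e; rewrite PhiE -/F e horner0.
have GE : G = 1 + 'X * F by rewrite /G rmorphD rmorphM /= rmorph1 map_polyX.
have sG : (1 < size G)%N.
  rewrite GE addrC size_polyDl ?size_poly1 mulrC size_mulX // ltnS size_poly_gt0 //.
have Phig : Phi g != 0.
  apply/eqP => /tr G0; by move: sG; rewrite /G G0 size_poly0.
have [N [P mP]] := h (Phi g)^-1.
set v := _ / _ => /rootP rP; set m := (size P).-1.
have sP : size P = m.+1 by rewrite prednK // size_poly_gt0 monic_neq0.
have sP' : (size (map_poly Phi P) <= m.+1)%N by rewrite -sP; apply: size_poly.
(* This is g^m P(f^N / g), cleared of denominators. All terms but the last, f^(N m), are divisible
   by g. *)
pose W := \sum_(i < m.+1) P`_i * f ^+ (N * i) * g ^+ (m - i).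
have : Phi W = 0.
  transitivity (Phi g ^+ m * (map_poly Phi P).[v]); last by rewrite rP mulr0.
  rewrite (horner_coef_wide _ sP') mulr_sumr rmorph_sum; apply: eq_bigr => i _.
  have im : (i <= m)%N by rewrite -ltnS.
  have -> : Phi g ^+ m = Phi g ^+ (m - i) * Phi g ^+ i by rewrite -exprD subnK.
  rewrite coef_map !(rmorphM Phi) !(rmorphXn Phi) /v expr_div_n exprM.
  field.
  by rewrite expf_neq0.
move/tr; rewrite /W big_ord_recr /= subnn mulr1.
have -> : P`_m = 1 by move/monicP: mP; rewrite lead_coefE.
rewrite mul1r rmorphD rmorphXn /= -/F => /eqP; rewrite addrC addr_eq0 => /eqP e.
have GF : G %| F ^+ (N * m).
  rewrite e dvdpNr rmorph_sum.
  apply: (big_ind (fun x => G %| x)) => [|x y|i _]; [exact: dvdp0|exact: dvdp_add|].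
  by rewrite -(subnSK (ltn_ord i)) exprS mulrCA rmorphM /= dvdp_mulr.
have cop : coprimep G (F ^+ (N * m)).
  apply: coprimep_expr; rewrite coprimep_sym GE addrC coprimep_addl_mul.
  exact: coprimep1.
have /coprimepP/(_ G (dvdpp _) GF) := cop.
by rewrite -size_poly_eq1 => /eqP s1; rewrite s1 in sG.
Qed.

(** Both conditions say that K is integral over the base with one element inverted. The new d is c
    b: c is the leading coefficient of an equation for al, and b makes b / (c^e f(al)) integral. *)
Lemma zariski_step :
  (exists2 f : {poly C}, Phi f != 0 &
     forall u, exists N, integralOver Phi (Phi f ^+ N * u)) ->
  exists2 d : C, phi d != 0 & forall u, exists N, integralOver phi (phi d ^+ N * u).
Proof.
move=> [f f0 h]; have [q q0 rq] := zariski_algebraic f0 h.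
have intc i (r : {poly C}) : integralOver phi (map_poly phi r)`_i.
  by rewrite coef_map; apply: integral_id.
pose c := q`_((size (map_poly phi q)).-1); pose a := phi c.
have aE : a = lead_coef (map_poly phi q) by rewrite lead_coefE coef_map.
have a0 : a != 0 by rewrite aE lead_coef_eq0.
have ia : integralOver phi a by apply: integral_id.
have iaal : integralOver phi (a * al) by rewrite aE; apply: integral_lead.
pose e := size f; pose be := Phi f.
have sle (r : {poly C}) e' : (size r <= e')%N -> (size (map_poly phi r) <= e'.+1)%N.
  by move=> h'; apply: leq_trans (leqW h'); apply: size_poly.
have ig : integralOver phi (a ^+ e * be).
  by apply: integral_scaled_horner => //; apply: sle.
have g0 : a ^+ e * be != 0 by rewrite mulf_neq0 ?expf_neq0.
have [b b0 ib] := integral_inverse ig g0.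
exists (c * b); first by rewrite rmorphM mulf_neq0.
move=> u; have [N [P mP rP]] := h u.
pose M := \max_(i < size P) size (P`_i)%R.
have iM : integralOver phi (a ^+ M * (be ^+ N * u)).
  apply: (integral_scale (P := map_poly Phi P)) => //; first by rewrite monic_map.
    exact: integral_exp.
  move=> i; rewrite coef_map; apply: integral_scaled_horner => //; apply: sle.
  have [iP|iP] := ltnP i (size P); last by rewrite nth_default ?size_poly0.
  exact: (leq_bigmax (Ordinal iP)).
exists (M + N)%N.
have -> : phi (c * b) ^+ (M + N) * u = a ^+ N * phi b ^+ M * a ^+ (e * N) *
    ((a ^+ M * (be ^+ N * u)) * (phi b / (a ^+ e * be)) ^+ N).
  rewrite rmorphM -/a expr_div_n !exprMn -!exprM !exprD; field.
  by rewrite !expf_neq0.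
apply: integral_mul; last by apply: integral_mul => //; apply: integral_exp.
by apply: integral_mul; [apply: integral_mul|]; apply: integral_exp => //; apply: integral_id.
Qed.
End ZariskiStep.

(** [zariski_step] removes the variables one at a time; the denominator left at the end lies in k
    and is invertible. *)
Lemma zariski_field (k K : fieldType) (f : {rmorphism k -> K}) n (s : nat -> K) :
  (forall u, exists q, tower_eval f s n q = u) -> forall u, integralOver f u.
Proof.
move=> surj.
have main j : (j <= n)%N -> exists2 d : tower k (n - j), tower_eval f s (n - j) d != 0 &
    forall u, exists N, integralOver (tower_eval f s (n - j)) (tower_eval f s (n - j) d ^+ N * u).
  elim: j => [|j IHj] jn.
    rewrite subn0; exists 1; first by rewrite rmorph1 oner_eq0.
    move=> u; exists 0%N; have [q <-] := surj u; rewrite mul1r; exact: integral_id.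
  have := IHj (ltnW jn); rewrite -subSS subSn //.
  exact: zariski_step.
have := main n (leqnn _); rewrite subnn => -[d d0 hd] u.
have [N hN] := hd u; rewrite /= in d0 hN.
have -> : u = f (d^-1 ^+ N) * (f d ^+ N * u).
  by rewrite rmorphXn fmorphV mulrA -exprMn mulVf // expr1n mul1r.
by apply: integral_mul => //; apply: integral_id.
Qed.

(* Zariski's lemma for R / p. *)
Lemma maximal_algebraic (k : fieldType) (R : comNzRingType) (f : {rmorphism k -> R})
    n (s : nat -> R) (p : prime_idealr R) :
  (forall r, exists q, tower_eval f s n q = r) -> maximal_ideal p ->
  forall th, exists2 P : {poly k}, P \is monic & (map_poly f P).[th] \in p.
Proof.
move=> surj pmax th.
have inv b : b \notin p -> exists c, c * b - 1 \in p.
  move=> bp; pose J x := exists2 u, u \in p & exists r, x = u + r * b.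
  have idJ : prop_ideal J.
    split; first by exists 0; rewrite ?rpred0 //; exists 0; rewrite mul0r addr0.
    - move=> _ _ [u pu [r ->]] [v pv [t ->]]; exists (u + v); first exact: rpredD.
      by exists (r + t); ring.
    - move=> a _ [u pu [r ->]]; exists (a * u); first exact: idealMr.
      by exists (a * r); ring.
  have [[u pu [c e]]|J1] := pselect (J 1).
    by exists c; rewrite -rpredN opprB e addrK.
  have [] := negP bp; rewrite -(pmax (mk_idealr idJ J1)).
    by apply/mem_mk_idealr; exists 0; rewrite ?rpred0 //; exists 1; rewrite mul1r add0r.
  by move=> x px; apply/mem_mk_idealr; exists x => //; exists 0; rewrite mul0r addr0.
pose Q : comNzRingType := {ideal_quot p}.
have piE x : ((\pi_{ideal_quot p}%qT x : Q) == 0) = (x \in p).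
  have := Quotient.idealrBE p x 0; rewrite subr0 => ->.
  by rewrite -[0 : Q](rmorph0 \pi_{ideal_quot p}%qT).
have /choice[inv' hinv] (a : Q) : exists b : Q, (a != 0 -> b * a = 1) /\ (a = 0 -> b = 0).
  have [->|] := eqVneq a 0; first by exists 0; split=> // /eqP.
  elim/quotW: a => a; rewrite piE => ap; have [c cp] := inv a ap.
  exists (\pi_{ideal_quot p}%qT c); split=> [_|e].
    by apply/eqP; rewrite -subr_eq0 -rmorphM -(rmorph1 \pi_{ideal_quot p}%qT) -rmorphB piE.
  by case/negP: ap; rewrite -piE e.
pose K : fieldType := HB.pack_for fieldType {ideal_quot p}
  (GRing.ComNzRing_isField.Build {ideal_quot p} (fun a => (hinv a).1) ((hinv 0).2 erefl)).
pose g : {rmorphism R -> K} := GRing.RMorphism.clone _ _ (\pi_{ideal_quot p}%qT : R -> K) _.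
have g0 x : g x = 0 -> x \in p by move=> gx; rewrite -piE; apply/eqP.
have gsurj u : exists x, g x = u by elim/quotW: u => x; exists x.
have [u|P mP /rootP rP] := @zariski_field k K (GRing.RMorphism.clone _ _ (g \o f) _) n
   (g \o s) _ (g th).
  have [x <-] := gsurj u; have [q <-] := surj x; exists q.
  apply: (tower_ext (h := GRing.RMorphism.clone _ _ (g \o tower_eval f s n) _)) => [c|i i_n].
    by rewrite tower_eval_const -[RHS]/(g (tower_eval _ _ _ _)) tower_eval_const.
  by rewrite tower_eval_var // -[RHS]/(g (tower_eval _ _ _ _)) tower_eval_var.
exists P => //; apply: g0; rewrite -horner_map -map_poly_comp; exact: rP.
Qed.

Section IdealCons.
Variable R : comNzRingType.

Lemma in_ideal_nil (x : R) : in_ideal [::] x -> x = 0.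
Proof. by move=> [c ->]; rewrite big_ord0. Qed.

Lemma in_ideal_cons (s : seq R) a x :
  in_ideal (a :: s) x -> exists r, exists2 y, in_ideal s y & x = r * a + y.
Proof.
move: x; apply: in_ideal_ind.
  by exists 0, 0; [exact: in_ideal0|rewrite mul0r addr0].
move=> b f _ fs [r [y ys ->]]; move: fs; rewrite inE => /orP[/eqP->|fs].
  by exists (b + r), y => //; ring.
exists r, (b * f + y); first by apply/in_idealD/ys/in_idealMl/in_ideal_mem.
by rewrite addrCA.
Qed.

Lemma in_ideal1 (a x : R) : in_ideal [:: a] x -> exists r, x = r * a.
Proof.
by move=> /in_ideal_cons[r [y /in_ideal_nil-> ->]]; exists r; rewrite addr0.
Qed.

Lemma in_ideal2 (a b x : R) : in_ideal [:: a; b] x -> exists r s, x = r * a + s * b.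
Proof. by move=> /in_ideal_cons[r [y /in_ideal1[s ->] ->]]; exists r, s. Qed.

Lemma in_ideal3 (a b c x : R) : in_ideal [:: a; b; c] x ->
  exists r s t, x = r * a + s * b + t * c.
Proof.
by move=> /in_ideal_cons[r [y /in_ideal2[s [t ->]] ->]]; exists r, s, t; rewrite addrA.
Qed.
End IdealCons.

Section ReesCoefficients.
Variable k : fieldType.
Local Notation S := {mpoly k[3]}.
Local Notation pw := (ideal_pow (fun x => x \in I25 k)).
Local Notation R := (rees (I25 k)).

Definition cf (r : R) (n : nat) : S := (rees_val r)`_n.

Lemma cf_pow r n : pw n (cf r n).
Proof. exact: (elimT (rees_predP _) (rees_valP r)). Qed.

Lemma cfD r s n : cf (r + s) n = cf r n + cf s n.
Proof. exact: coefD. Qed.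
Lemma cfB r s n : cf (r - s) n = cf r n - cf s n.
Proof. exact: coefB. Qed.
Lemma cfC a r n : cf (reesC a * r) n = a * cf r n.
Proof. exact: coefCM. Qed.
Lemma cfM m (a : S) (ha : pw m a) r n :
  cf (reesM ha * r) n = if (n < m)%N then 0 else a * cf r (n - m).
Proof.
rewrite /cf -[rees_val _]/((a *: 'X^m) * rees_val r) -scalerAl coefZ coefXnM.
by case: ifP; rewrite ?mulr0.
Qed.
Lemma cf_reesM m (a : S) (ha : pw m a) n : cf (reesM ha) n = if n == m then a else 0.
Proof. by rewrite /cf /= coefZ coefXn; case: eqP; rewrite ?mulr1 ?mulr0. Qed.
Lemma cf_reesC a n : cf (reesC a) n = if n == 0%N then a else 0.
Proof. exact: coefC. Qed.

Lemma cf_inj r s : (forall n, cf r n = cf s n) -> r = s.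
Proof. by move=> h; apply/val_inj/polyP. Qed.

Lemma prop_ideal_cf (J : R -> Prop) r : prop_ideal J ->
  (forall n, J (reesM (cf_pow r n))) -> J r.
Proof.
move=> [J0 JD _] h.
have -> : r = \sum_(i < size (rees_val r)) reesM (cf_pow r i).
  by apply: val_inj; rewrite rmorph_sum /= -[LHS]coefK poly_def.
by elim/big_ind: _.
Qed.

Lemma reesM_eq m (a b : S) (ha : pw m a) (hb : pw m b) : a = b -> reesM ha = reesM hb.
Proof. by move=> e; apply: val_inj; rewrite /= e. Qed.

Lemma reesMD m (a b : S) (ha : pw m a) (hb : pw m b) (hab : pw m (a + b)) :
  reesM hab = reesM ha + reesM hb.
Proof. by apply: val_inj; rewrite /= scalerDl. Qed.

Lemma reesMM m n (a b : S) (ha : pw m a) (hb : pw n b) (hab : pw (m + n) (a * b)) :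
  reesM ha * reesM hb = reesM hab.
Proof. by apply: val_inj; rewrite /= -scalerAl -scalerAr scalerA -exprD. Qed.

Lemma reesCM n (a b : S) (hb : pw n b) (hab : pw n (a * b)) :
  reesC a * reesM hb = reesM hab.
Proof. by apply: val_inj; rewrite /= mul_polyC scalerA. Qed.

Lemma powS n (a : S) : pw n.+1 a -> pw n a.
Proof. by move=> [s hs ->]; rewrite big_seq; apply: pow_sum => u /hs[_]; apply: ideal_powZ. Qed.
End ReesCoefficients.

(** * Maximal ideals containing I and IT *)

Section IrrelevantIdeal.
Variable k : fieldType.
Local Notation S := {mpoly k[3]}.
Local Notation pw := (ideal_pow (fun x => x \in I25 k)).
Local Notation R := (rees (I25 k)).
Local Notation w := (vw k).
Local Notation b := (vb k).
Local Notation c := (vc k).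
Local Notation u := (vu k).

Lemma vw_I25 : w \in I25 k.
Proof. by apply/I25P/in_ideal_mem; rewrite mem_head. Qed.

Lemma vb_I25 : b \in I25 k.
Proof.
apply/I25P; apply: in_idealB; apply: in_ideal_mem.
  by rewrite !inE eqxx !orbT.
by rewrite !inE eqxx !orbT.
Qed.

Lemma vc_I25 : c \in I25 k.
Proof.
apply/I25P; apply: in_idealB; apply: in_ideal_mem.
  by rewrite !inE eqxx !orbT.
by rewrite !inE eqxx !orbT.
Qed.

#[local] Opaque vw vb vc vu.

Definition wT : R := reesM (pow1 vw_I25).
Definition bT : R := reesM (pow1 vb_I25).
Definition cT : R := reesM (pow1 vc_I25).

(** A Valabrega-Valla condition for b and w: by [pow_divb] the part of g outside I^n is a multiple
    of w, which moves to the other cofactor. *)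
Lemma pow_split n (a g h : S) : pw n.+1 a -> a = b * g + w * h ->
  exists g' h', [/\ pw n g', pw n h' & a = b * g' + w * h'].
Proof.
move=> ha e; have [|q [g' [eg hg']]] := @pow_divb k n g (- h) a _ ha.
  by rewrite e; ring.
exists g', (h + b * q).
have e' : a = b * g' + w * (h + b * q) by rewrite e eg; ring.
split=> //; apply: pow_divw.
have -> : w * (h + b * q) = a + - 1 * (b * g') by rewrite e'; ring.
by apply: ideal_powD => //; apply/ideal_powZ/pow_mem => //; apply: vb_I25.
Qed.

Section Moves.
Variable J : R -> Prop.
Hypothesis idJ : prop_ideal J.

Lemma move_w n (f : S) (hf : pw n.+1 (w * f)) : J wT -> pw n f -> J (reesM hf).
Proof.
move=> hw h; have -> : reesM hf = reesM h * wT.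
  by apply: val_inj; rewrite /= -scalerAl -scalerAr scalerA -exprD addn1 (mulrC f).
by case: idJ => _ _; apply.
Qed.

Lemma J_addr (x y : R) : J y -> J (x + y) -> J x.
Proof.
case: idJ => _ JD JM Jy Jxy; rewrite -(addrK y x).
by apply: JD => //; rewrite -mulN1r; apply: JM.
Qed.

Lemma move_b0 (f : S) (hf : pw 1 (b * f)) : J (reesC w - bT) -> J (reesC (w * f)) ->
  J (reesM hf).
Proof.
move=> hb hw; apply: (J_addr (y := reesC f * (reesC w - bT))).
  by case: idJ => _ _; apply.
suff -> : reesM hf + reesC f * (reesC w - bT) = reesC (w * f) by [].
apply: cf_inj => n; rewrite cfD cfC cfB !cf_reesC !cf_reesM.
by case: n => [|[|n]] /=; ring.
Qed.

(** Modulo w - bT the element becomes w f T^(n+1), a multiple of wT because f lies in I^n. In degree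
    1 only w f in degree 0 would be left, out of reach of wT; hence the separate [move_b0]. *)
Lemma move_b n (f : S) (hf : pw n.+2 (b * f)) : J wT -> J (reesC w - bT) ->
  pw n.+1 f -> J (reesM hf).
Proof.
move=> hw hb h; have hwf : pw n.+1 (w * f) by apply: ideal_powZ.
apply: (J_addr (y := reesM h * (reesC w - bT))); first by case: idJ => _ _; apply.
suff -> : reesM hf + reesM h * (reesC w - bT) = reesM hwf.
  by apply: move_w => //; apply: powS.
apply: cf_inj => i; rewrite cfD cfM cfB cf_reesC !cf_reesM.
case: (ltngtP i n.+1) => [i1|i1|->] /=.
- by rewrite (ltn_eqF (ltn_trans i1 (ltnSn _))); ring.
- have [->|i2] := eqVneq i n.+2.
    by rewrite subSnn /=; ring.
  have -> : (i - n.+1 == 0)%N = false by apply/negbTE; lia.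
  have -> : (i - n.+1 == 1)%N = false by apply/negbTE; move: i2; lia.
  by ring.
- by rewrite subnn (ltn_eqF (ltnSn _)) /=; ring.
Qed.

Lemma move_c n (f : S) (hf : pw n.+1 (c * f)) (hbf : pw n (b * f)) :
  J (reesC b - cT) -> pw n f -> J (reesM hbf) -> J (reesM hf).
Proof.
move=> hc h hb; apply: (J_addr (y := reesM h * (reesC b - cT))).
  by case: idJ => _ _; apply.
suff -> : reesM hf + reesM h * (reesC b - cT) = reesM hbf by [].
apply: cf_inj => i; rewrite cfD cfM cfB cf_reesC !cf_reesM.
case: (ltngtP i n) => [i1|i1|->] /=.
- by rewrite (ltn_eqF (ltn_trans i1 (ltnSn _))); ring.
- have [->|i2] := eqVneq i n.+1; first by rewrite subSnn /=; ring.
  have -> : (i - n == 0)%N = false by apply/negbTE; lia.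
  have -> : (i - n == 1)%N = false by apply/negbTE; move: i2; lia.
  by ring.
- by rewrite subnn (ltn_eqF (ltnSn _)) /=; ring.
Qed.
End Moves.

Lemma cf_pow1 (q : S) (hq : pw 1 q) (a : R) n :
  cf (a * reesM hq) n = if n is n'.+1 then q * cf a n' else 0.
Proof. by rewrite mulrC cfM; case: n => //= n; rewrite subn1. Qed.

Lemma cf_lin (p q : S) (hq : pw 1 q) (a : R) n :
  cf (a * (reesC p - reesM hq)) n = p * cf a n - (if n is n'.+1 then q * cf a n' else 0).
Proof. by rewrite mulrBr cfB cf_pow1 mulrC cfC. Qed.

(** Comparison of coefficients gives w a_0 = 0 and b a_n in (w); b is regular modulo w, and the
    cofactor of w drops exactly one power of I. *)
Lemma reg_step1 (a : R) : in_ideal [:: wT] ((reesC w - bT) * a) -> in_ideal [:: wT] a.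
Proof.
move=> /in_ideal1[e ae].
rewrite mulrC in ae.
have eq n : w * cf a n.+1 - b * cf a n = w * cf e n.
  by have := congr1 (fun r : R => cf r n.+1) ae; rewrite cf_lin cf_pow1.
have eq0 : cf a 0 = 0.
  have := congr1 (fun r : R => cf r 0) ae; rewrite cf_lin cf_pow1 subr0 => /eqP.
  by rewrite mulf_eq0 (negbTE (vw_neq0 k)) => /eqP.
apply: prop_ideal_cf => [|[|n]]; first exact: prop_ideal_in.
  have -> : reesM (cf_pow a 0) = 0 by apply: val_inj; rewrite /= eq0 scale0r.
  exact: in_ideal0.
have [g eg] : exists g, cf a n.+1 = w * g.
  apply: (@divb k _ (cf a n.+2 - cf e n.+1)); move: (eq n.+1) => e1.
  by rewrite mulrBr -e1; ring.
have hg : pw n.+1 (w * g) by rewrite -eg; apply: cf_pow.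
rewrite (reesM_eq _ hg eg); apply: move_w; first exact: prop_ideal_in.
  by apply: in_ideal_mem; rewrite mem_head.
exact: pow_divw.
Qed.

Lemma reg_step2 (a : R) : in_ideal [:: wT; reesC w - bT] ((reesC b - cT) * a) ->
  in_ideal [:: wT; reesC w - bT] a.
Proof.
set s := [:: _; _]; have ids := prop_ideal_in s.
have sw : in_ideal s wT by apply: in_ideal_mem; rewrite mem_head.
have sb : in_ideal s (reesC w - bT) by apply: in_ideal_mem; rewrite !inE eqxx orbT.
move=> /in_ideal2[e [h ae]].
rewrite mulrC in ae.
have eq n : b * cf a n.+1 - c * cf a n = w * cf e n + (w * cf h n.+1 - b * cf h n).
  by have := congr1 (fun r : R => cf r n.+1) ae; rewrite cfD !cf_lin cf_pow1.
have eq0 : b * cf a 0 = w * cf h 0.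
  by have := congr1 (fun r : R => cf r 0) ae; rewrite cfD !cf_lin cf_pow1 !subr0 add0r.
have [sg esg] := divb eq0.
have h0 : cf h 0 = b * sg.
  by apply: (mulfI (vw_neq0 k)); rewrite -eq0 esg mulrCA.
(* The relation b a_0 = w h_0 is a multiple of the Koszul one, so a multiple of w - bT removes the
   constant term of a. *)
pose a' := a - reesC sg * (reesC w - bT).
suff : in_ideal s a'.
  move=> ha'; rewrite -(subrK (reesC sg * (reesC w - bT)) a).
  by apply: in_idealD => //; apply: in_idealMl.
have a'0 : cf a' 0 = 0 by rewrite /a' cfB cf_lin !cf_reesC esg /=; ring.
have a'1 : cf a' 1 = cf a 1 + b * sg by rewrite /a' cfB cf_lin !cf_reesC /=; ring.
have a'n n : cf a' n.+2 = cf a n.+2 by rewrite /a' cfB cf_lin !cf_reesC /=; ring.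
apply: prop_ideal_cf => // -[|[|n]].
- have -> : reesM (cf_pow a' 0) = 0 by apply: val_inj; rewrite /= a'0 scale0r.
  exact: in_ideal0.
- have [g eg] : exists g, cf a' 1 = w * g.
    rewrite a'1; apply: (@divb k _ (cf e 0 + cf h 1 + c * sg)).
    have := eq 0%N; rewrite h0 esg => e0.
    transitivity (b * cf a 1 - c * (w * sg) + (c * (w * sg) + b * (b * sg))); first by ring.
    by rewrite e0; ring.
  have hg : pw 1 (w * g) by rewrite -eg; apply: cf_pow.
  by rewrite (reesM_eq _ hg eg); apply: move_w.
have [g [q eg]] : exists g q, cf a' n.+2 = b * g + w * q.
  rewrite a'n; apply: (@pow_divc k _ (cf a n.+3 + cf h n.+2) (- cf e n.+2 - cf h n.+3)).
  transitivity (b * cf a n.+3 - (b * cf a n.+3 - c * cf a n.+2)); first by ring.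
  by rewrite eq; ring.
have [g' [q' [hg hq eg']]] := pow_split (cf_pow a' n.+2) eg.
have hbg : pw n.+2 (b * g') by apply: pow_mem => //; apply: vb_I25.
have hwq : pw n.+2 (w * q') by apply: pow_mem => //; apply: vw_I25.
rewrite (reesM_eq _ (ideal_powD hbg hwq) eg') (reesMD hbg hwq).
by apply: in_idealD; [apply: move_b|apply: move_w].
Qed.

Section ThirdStep.
Local Notation J := (in_ideal [:: wT; reesC w - bT; reesC b - cT]).
Let idJ : prop_ideal J := prop_ideal_in _.

Let Jw : J wT. Proof. by apply: in_ideal_mem; rewrite mem_head. Qed.
Let Jb : J (reesC w - bT). Proof. by apply: in_ideal_mem; rewrite !inE eqxx orbT. Qed.
Let Jc : J (reesC b - cT). Proof. by apply: in_ideal_mem; rewrite !inE eqxx !orbT. Qed.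

Lemma reg3_eqs (a : R) : J (reesC c * a) -> exists e h g : nat -> S,
  c * cf a 0 = w * h 0%N + b * g 0%N /\ forall n,
    c * cf a n.+1 = w * e n + (w * h n.+1 - b * h n) + (b * g n.+1 - c * g n).
Proof.
move=> /in_ideal3[e [h [g ae]]]; exists (cf e), (cf h), (cf g); split=> [|n].
  by have := congr1 (fun r : R => cf r 0) ae; rewrite cfC !cfD !cf_lin cf_pow1 !subr0 add0r.
by have := congr1 (fun r : R => cf r n.+1) ae; rewrite cfC !cfD !cf_lin cf_pow1.
Qed.

Lemma reg3_init (g0 h0 : S) : 0 = w * h0 + b * g0 -> exists2 t, g0 = w * t & h0 = - (b * t).
Proof.
move=> e; have [|t et] := @divb k g0 (- h0).
  by apply: subr0_eq; rewrite mulrN opprK addrC -e.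
exists t => //; apply: (mulfI (vw_neq0 k)); apply: subr0_eq.
by rewrite [RHS]e et; ring.
Qed.

Lemma reg3_high (a : R) : cf a 0 = 0 -> cf a 1 = 0 -> J (reesC c * a) -> J (reesC u * a).
Proof.
move=> a0 a1 /reg3_eqs[e [h [g [eq0 eq]]]].
have [t g0 h0] : exists2 t, g 0%N = w * t & h 0%N = - (b * t).
  by apply: reg3_init; rewrite -eq0 a0 mulr0.
have [l el] : exists l, b * t + g 1%N = w * l.
  apply: (@divb k _ (c * t - e 0%N - h 1%N)); apply: subr0_eq.
  by have := eq 0%N; rewrite a1 mulr0 g0 h0 => e1; rewrite [RHS]e1; ring.
have g1 : g 1%N = w * l - b * t by rewrite -el; ring.
apply: prop_ideal_cf => // -[|[|[|n]]].
- have e0 : cf (reesC u * a) 0 = 0 by rewrite cfC a0 mulr0.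
  rewrite (reesM_eq _ (ideal_pow0 _ 0) e0).
  have -> : reesM (ideal_pow0 _ 0) = 0 :> R by apply: val_inj; rewrite /= scale0r.
  exact: in_ideal0.
- have e0 : cf (reesC u * a) 1 = 0 by rewrite cfC a1 mulr0.
  rewrite (reesM_eq _ (ideal_pow0 _ 1) e0).
  have -> : reesM (ideal_pow0 _ 1) = 0 :> R by apply: val_inj; rewrite /= scale0r.
  exact: in_ideal0.
(* In degree 2 a term with c would descend to a multiple of w in degree 0, so c is cancelled by
   [pow_divc] instead of applying [pow_red]. *)
- have [q [r er]] : exists q r, cf a 2 = b * q + w * r.
    apply: (@pow_divc k _ (g 2%N - h 1%N + c * t) (e 1%N + h 2%N - c * l)).
    by rewrite eq g1; ring.
  have [q' [r' [hq hr eqr]]] := pow_split (cf_pow a 2) er.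
  have hbq : pw 2 (b * q') by apply: pow_mem => //; apply: vb_I25.
  have hwr : pw 2 (w * r') by apply: pow_mem => //; apply: vw_I25.
  have h2 : pw 2 (u * (b * q' + w * r')) by apply/ideal_powZ/ideal_powD.
  have e2 : cf (reesC u * a) 2 = u * (b * q' + w * r') by rewrite cfC eqr.
  rewrite (reesM_eq _ h2 e2) -(reesCM (ideal_powD hbq hwr)) (reesMD hbq hwr).
  by apply/in_idealMl/in_idealD; [apply: move_b|apply: move_w].
(* From degree 3 on there is room to turn c into b and then b into w and still have a multiple of
   wT. *)
have [be [ga [de [hb hg ebg]]]] := pow_red (cf_pow a n.+3).
have hbb : pw n.+3 (b * be) by apply: pow_mem => //; apply: vb_I25.
have hcg : pw n.+3 (c * ga) by apply: pow_mem => //; apply: vc_I25.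
have hwd : pw n.+3 (w * de).
  have -> : w * de = u * cf a n.+3 + (- 1) * (b * be + c * ga) by rewrite ebg; ring.
  by apply: ideal_powD; apply: ideal_powZ; [apply: cf_pow|apply: ideal_powD].
have e3 : cf (reesC u * a) n.+3 = b * be + c * ga + w * de by rewrite cfC.
rewrite (reesM_eq _ (ideal_powD (ideal_powD hbb hcg) hwd) e3).
rewrite (reesMD (ideal_powD hbb hcg) hwd) (reesMD hbb hcg).
apply: in_idealD; last by apply: move_w => //; apply: pow_divw.
apply: in_idealD; first exact: move_b.
have hbg : pw n.+2 (b * ga) by apply: ideal_powZ.
by apply: (move_c idJ _ (hbf := hbg)) => //; apply: move_b => //; apply: powS.
Qed.

(** One factor u makes the coefficient of T removable; the other is spent on the higher degrees by
    [reg3_high]. *)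
Lemma reg3_pos (a : R) : cf a 0 = 0 -> J (reesC c * a) -> J (reesC u * (reesC u * a)).
Proof.
move=> a0 Ja; have [e [h [g [eq0 eq]]]] := reg3_eqs Ja.
have [t g0 h0] : exists2 t, g 0%N = w * t & h 0%N = - (b * t).
  by apply: reg3_init; rewrite -eq0 a0 mulr0.
have [ka [de ekd]] : exists ka de, cf a 1 = b * ka + w * de.
  apply: (@pow_divc k _ (b * t + g 1%N) (e 0%N + h 1%N - c * t)).
  by rewrite eq g0 h0; ring.
have [mu emu] : exists mu, c * ka - b * t - g 1%N = w * mu.
  apply: (@divb k _ (e 0%N + h 1%N - c * t - c * de)); apply: subr0_eq.
  have := eq 0%N; rewrite ekd g0 h0 => /eqP; rewrite -subr_eq0 => /eqP e1.
  by rewrite -[RHS]e1; ring.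
have g1 : g 1%N = c * ka - b * t - w * mu by rewrite -emu; ring.
have [la [rh elr]] : exists la rh, c * ka + cf a 2 = b * la + w * rh.
  apply: (@pow_divc k _ (g 2%N - h 1%N + c * t) (e 1%N + h 2%N + c * mu)).
  by rewrite mulrDr eq g1; ring.
(* As ga lies in I, the multiple ga T (b - cT) is available; it changes u ka into u ka + ga, which
   lies in (b, w). *)
have [be [ga [de' [_ hga ebg]]]] := pow_red (cf_pow a 2).
have [la' [rh' elr']] : exists la' rh', u * ka + ga = b * la' + w * rh'.
  apply: (@pow_divc k _ (u * la - be) (u * rh - de')).
  transitivity (u * (c * ka + cf a 2) - u * cf a 2 + c * ga); first by ring.
  by rewrite elr ebg; ring.
(* From w b = w (b - cT) + c wT; this is the degree 0 remainder that [move_b0] asks for. *)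
have Jwb : J (reesC (w * (b * la'))).
  have -> : reesC (w * (b * la')) = reesC (w * la') * (reesC b - cT) + reesC (c * la') * wT.
    apply: cf_inj => n; rewrite cfD cf_lin cf_pow1 !cf_reesC.
    by case: n => [|[|n]]; rewrite /= ?cf_reesC /=; ring.
  by apply: in_idealD; apply: in_idealMl.
have h1 : pw 1 (b * (b * la')) by apply: (pow_mem (n := 0)) => //; apply: vb_I25.
have h2 : pw 1 (w * (b * rh' + u * de)) by apply: (pow_mem (n := 0)) => //; apply: vw_I25.
pose y := reesM h1 + reesM h2.
have Jy : J y.
  by apply: in_idealD; [apply: move_b0|apply: move_w].
(* Its coefficients in degrees 0 and 1 vanish, and it differs from u a by an element of J. *)
pose a2 := reesC u * a + reesM hga * (reesC b - cT) - y.
have Ja2 : J (reesC u * a2).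
  apply: reg3_high.
  - by rewrite /a2 cfB !cfD cfC cf_lin a0 !cf_reesM /=; ring.
  - rewrite /a2 cfB !cfD cfC cf_lin !cf_reesM ekd /=.
    transitivity (b * (u * ka + ga) + u * (w * de) - (b * (b * la') + w * (b * rh' + u * de))).
      by ring.
    by rewrite elr'; ring.
  rewrite /a2 mulrBr mulrDr; apply: in_idealB; last exact: in_idealMl.
  apply: in_idealD; last by apply/in_idealMl/in_idealMl.
  by rewrite mulrCA; apply: in_idealMl.
have -> : reesC u * a = a2 + y - reesM hga * (reesC b - cT) by rewrite /a2; ring.
rewrite mulrBr mulrDr; apply: in_idealB; last by apply/in_idealMl/in_idealMl.
by apply: in_idealD => //; apply: in_idealMl.
Qed.

(** c a_0 lies in (b, w), hence so does a_0, and multiples of w - bT and b - cT remove it. *)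
Lemma reg_step3 (a : R) : J (reesC c * a) -> J (reesC u * (reesC u * a)).
Proof.
move=> Ja; have [e [h [g [eq0 _]]]] := reg3_eqs Ja.
have [si [si' es]] : exists si si', cf a 0 = b * si + w * si'.
  by apply: (@pow_divc k _ (g 0%N) (h 0%N)); rewrite addrC.
pose y := reesC si' * (reesC w - bT) + reesC si * (reesC b - cT).
have Jy : J y by apply: in_idealD; apply: in_idealMl.
rewrite -(subrK y a) [X in J (_ * X)]mulrDr mulrDr.
apply: in_idealD; last by apply/in_idealMl/in_idealMl.
apply: reg3_pos; last by rewrite mulrBr; apply: in_idealB => //; apply: in_idealMl.
by rewrite cfB cfD !cf_lin !cf_reesC es /=; ring.
Qed.
End ThirdStep.
End IrrelevantIdeal.

(** * Regular sequences at the other maximal ideals *)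

Section FilteredRegularity.
Variables (A : comNzRingType) (dg : nat -> A -> Prop).
Hypothesis dg0 : forall m, dg m 0.
Hypothesis dgB : forall m x y, dg m x -> dg m y -> dg m (x - y).
Hypothesis dgS : forall m x, dg m x -> dg m.+1 x.
Hypothesis dg_eq0 : forall x, dg 0 x -> x = 0.
Hypothesis dg_ex : forall x, exists m, dg m x.

(** [dg m] stands for degree less than m; this is the induced filtration on A/J. *)
Definition filt (J : A -> Prop) m x := exists2 r, dg m r & J (x - r).
(** The leading form of t, in degree 1, acts injectively on the associated graded module of A/J. *)
Definition filt_reg (J : A -> Prop) t := forall m x, filt J m.+1 (t * x) -> filt J m x.
Definition ideal_adj (J : A -> Prop) v x := exists y, J (x - v * y).
Definition deg1 t := forall m x, dg m x -> dg m.+1 (t * x).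
Definition deg0 c := forall m x, dg m x -> dg m (c * x).

(* The values at t of the monic polynomials with coefficients of degree 0. *)
Inductive monic_value (t : A) : A -> Prop :=
| monic_value1 : monic_value t 1
| monic_valueX v c : monic_value t v -> deg0 c -> monic_value t (t * v + c).

Lemma monic_value_horner (C : nzRingType) (f : {rmorphism C -> A}) (P : {poly C}) (t : A) :
  (forall c, deg0 (f c)) -> P \is monic -> monic_value t (map_poly f P).[t].
Proof.
move=> hf; elim/poly_ind: P => [|p a IHp].
  by rewrite monicE lead_coef0 eq_sym oner_eq0.
have [->|p0] := eqVneq p 0.
  rewrite mul0r add0r monicE lead_coefC => /eqP->.
  by rewrite rmorph1 hornerC; constructor.
rewrite monicE lead_coefDl ?size_mulX // ?lead_coefMX; last first.
  by rewrite size_polyC ltnS; apply: leq_trans (leq_b1 _) _; rewrite size_poly_gt0.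
rewrite -monicE => /IHp hp; rewrite rmorphD rmorphM /= map_polyX map_polyC /= hornerMXaddC mulrC.
exact: monic_valueX.
Qed.

Lemma prop_ideal_adj J v : prop_ideal J -> prop_ideal (ideal_adj J v).
Proof.
move=> [J0 JD JM]; split.
- by exists 0; rewrite mulr0 subrr.
- move=> x y [x' hx] [y' hy]; exists (x' + y').
  have -> : x + y - v * (x' + y') = x - v * x' + (y - v * y') by ring.
  by apply: JD.
- move=> a x [x' hx]; exists (a * x').
  have -> : a * x - v * (a * x') = a * (x - v * x') by ring.
  by apply: JM.
Qed.

Lemma ideal_adj_sub J v x : J x -> ideal_adj J v x.
Proof. by exists 0; rewrite mulr0 subr0. Qed.

Lemma ideal_adj_gen J v x : prop_ideal J -> ideal_adj J v (v * x).
Proof. by move=> [J0 _ _]; exists x; rewrite subrr. Qed.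

Section OneIdeal.
Variable J : A -> Prop.
Hypothesis idJ : prop_ideal J.

Let JB x y : J x -> J y -> J (x - y).
Proof. by case: idJ => _ JD JM hx hy; apply: JD => //; rewrite -mulN1r; apply: JM. Qed.

Lemma filt_in m x : J x -> filt J m x.
Proof. by exists 0; rewrite ?subr0. Qed.
Lemma filt_dg m x : dg m x -> filt J m x.
Proof. by exists x; rewrite // subrr; case: idJ. Qed.
Lemma filtB m x y : filt J m x -> filt J m y -> filt J m (x - y).
Proof.
move=> [r hr hx] [s hs hy]; exists (r - s); first exact: dgB.
have -> : x - y - (r - s) = x - r - (y - s) by ring.
by apply: JB.
Qed.
Lemma filtD m x y : filt J m x -> filt J m y -> filt J m (x + y).
Proof.
move=> hx hy; rewrite -[y]opprK -[- y]sub0r; apply: filtB => //; apply: filtB => //.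
by apply: filt_dg.
Qed.
Lemma filtS m x : filt J m x -> filt J m.+1 x.
Proof. by move=> [r hr hx]; exists r => //; apply: dgS. Qed.
Lemma filt_addn i m x : filt J m x -> filt J (m + i) x.
Proof. by move=> h; elim: i => [|i IHi]; rewrite ?addn0 // addnS; apply: filtS. Qed.
Lemma filt_deg1 t m x : deg1 t -> filt J m x -> filt J m.+1 (t * x).
Proof.
move=> ht [r hr hx]; exists (t * r); first exact: ht.
by rewrite -mulrBr; case: idJ => _ _; apply.
Qed.
Lemma filt_deg0 c m x : deg0 c -> filt J m x -> filt J m (c * x).
Proof.
move=> ht [r hr hx]; exists (c * r); first exact: ht.
by rewrite -mulrBr; case: idJ => _ _; apply.
Qed.
Lemma filt0 x : filt J 0 x -> J x.
Proof. by move=> [r /dg_eq0->]; rewrite subr0. Qed.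

(** Every x lies in some step of the filtration, so going down one step at a time suffices. *)
Lemma filt_descent v : (forall n x, filt J n.+1 x -> filt J n.+1 (v * x) -> filt J n x) ->
  filt_reg J v.
Proof.
move=> h m x hx; have [M /filt_dg hM] := dg_ex x.
suff step i : filt J (m + i) x -> filt J m x.
  by apply: (step M); rewrite addnC; apply: filt_addn.
elim: i => [|i IHi]; rewrite ?addn0 // addnS => hi; apply: IHi; apply: h => //.
by rewrite -addSn; apply: filt_addn.
Qed.

Lemma filt_reg_top v : (forall n x, dg n.+1 x -> filt J n.+1 (v * x) -> filt J n x) ->
  filt_reg J v.
Proof.
move=> h; apply: filt_descent => n x [r hr hx] hvx.
have -> : x = r + (x - r) by ring.
apply: filtD; last exact: filt_in.
apply: h => //; have -> : v * r = v * x - v * (x - r) by ring.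
by apply: filtB => //; apply: filt_in; case: idJ => _ _; apply.
Qed.

Section Monic.
Variable t : A.
Hypothesis tJ : filt_reg J t.

Lemma filt_reg_monic_step v c : (forall m x, filt J m (v * x) -> filt J m x) -> deg0 c ->
  filt_reg J (t * v + c).
Proof.
move=> hv hc; apply: filt_descent => n x hx hvx; apply: hv; apply: tJ.
have -> : t * (v * x) = (t * v + c) * x - c * x by ring.
by apply: filtB => //; apply: filt_deg0.
Qed.

Lemma filt_monic v : monic_value t v -> forall m x, filt J m (v * x) -> filt J m x.
Proof.
elim=> [m x|{}v c _ IHv hc m x hx]; first by rewrite mul1r.
exact: filt_reg_monic_step IHv hc _ _ (filtS hx).
Qed.

Lemma monic_regular v x : monic_value t v -> J (v * x) -> J x.
Proof. by move=> hv hx; apply: filt0; apply: (filt_monic hv); apply: filt_in. Qed.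
End Monic.
End OneIdeal.

(** The leading form of v is a power of t1, and an element regular modulo a regular t1 is regular
    modulo its powers. The induction on v carries this out without forming the graded ring. *)
Lemma filt_reg_adj J t1 t2 v : prop_ideal J -> deg1 t1 -> deg1 t2 -> filt_reg J t1 ->
  filt_reg (ideal_adj J t1) t2 -> monic_value t1 v -> filt_reg (ideal_adj J v) t2.
Proof.
move=> idJ d1 d2 r1 r2; have idA u := prop_ideal_adj u idJ; have [J0 JD JM] := idJ.
have JA u m x : filt J m x -> filt (ideal_adj J u) m x.
  by move=> [r hr hx]; exists r => //; apply: ideal_adj_sub.
have adjJ u m x : filt (ideal_adj J u) m x -> exists y, filt J m (x - u * y).
  by move=> [r hr [y hy]]; exists y, r => //; rewrite addrAC.
elim=> [m x _|{}v c hv IHv hc].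
  by exists 0 => //; exists x; rewrite subr0 mul1r subrr.
have regv := filt_monic idJ r1 hv.
apply: (filt_reg_top (idA _)) => n x hx /adjJ[y hy].
have vy : filt J n.+1 y.
  apply: (filt_reg_monic_step idJ r1 regv hc); rewrite -[_ * y](subKr (t2 * x)).
  by apply: filtB => //; [apply/(filt_dg idJ)/d2|apply: filtS].
have hy' : filt J n.+1 (t2 * x - t1 * (v * y)).
  have -> : t2 * x - t1 * (v * y) = (t2 * x - (t1 * v + c) * y) + c * y by ring.
  by apply: filtD => //; apply: filt_deg0.
have /adjJ[z hz] : filt (ideal_adj J t1) n x.
  apply: r2; rewrite -(subrK (t1 * (v * y)) (t2 * x)).
  by apply: (filtD (idA _)); [apply: JA|apply/(filt_in _)/ideal_adj_gen].
have zn : filt J n z.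
  apply: r1; rewrite -[_ * z](subKr x).
  by apply: filtB => //; [apply: filt_dg|apply: filtS].
have : filt J n (t2 * z - v * y).
  apply: r1.
  have -> : t1 * (t2 * z - v * y) = (t2 * x - t1 * (v * y)) - t2 * (x - t1 * z) by ring.
  by apply: filtB => //; apply: filt_deg1.
(* For n = 0 the element z lies in J; otherwise the induction hypothesis on v divides it by v up to
   smaller degree. *)
case: n => [|n] in hx vy hy' hz zn hy * => hzy.
  apply: JA; rewrite -(subrK (t1 * z) x); apply: (filtD idJ) => //.
  by apply: filt_in; apply: JM; apply: filt0.
have /adjJ[y1 hy1] : filt (ideal_adj J v) n z.
  apply: IHv; rewrite -(subrK (v * y) (t2 * z)).
  by apply: (filtD (idA _)); [apply: JA|apply/(filt_in _)/ideal_adj_gen].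
have y1n : filt J n.+1 y1.
  apply: regv; rewrite -[_ * y1](subKr z).
  by apply: filtB => //; apply: filtS.
have -> : x = (x - t1 * z) + t1 * (z - v * y1) - c * y1 + (t1 * v + c) * y1 by ring.
apply: (filtD (idA _)); last by apply/(filt_in _)/ideal_adj_gen.
apply: JA; apply: filtB => //; last exact: filt_deg0.
by apply: filtD => //; apply: filt_deg1.
Qed.
End FilteredRegularity.

(** * The associated graded ring of I *)

Section ReesFiltration.
Variable k : fieldType.
Local Notation S := {mpoly k[3]}.
Local Notation pw := (ideal_pow (fun x => x \in I25 k)).
Local Notation R := (rees (I25 k)).
Local Notation x := (vx k).
Local Notation w := (vw k).
Local Notation b := (vb k).
Local Notation c := (vc k).
Local Notation u := (vu k).
Local Notation wT := (wT k).
Local Notation bT := (bT k).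
Local Notation cT := (cT k).

(** u is a unit modulo I because x^10 lies in I, so it can be cancelled on the associated graded
    ring without localizing. *)
Lemma vu_cofactor : (1 + x ^+ 5) * u = 1 - x ^+ 10.
Proof. by rewrite /vu; ring. Qed.

#[local] Opaque vw vb vc vu.

Definition rees_deg (m : nat) (r : R) : Prop := (size (rees_val r) <= m)%N.
Local Notation dg := rees_deg.

Lemma rees_degP m r : dg m r <-> forall i, (m <= i)%N -> cf r i = 0.
Proof. by split=> [/leq_sizeP|h]; [|apply/leq_sizeP]. Qed.

Lemma rees_deg0 m : dg m 0.
Proof. by rewrite /dg size_poly0. Qed.
Lemma rees_degB m r s : dg m r -> dg m s -> dg m (r - s).
Proof.
by move=> /rees_degP hr /rees_degP hs; apply/rees_degP => i mi; rewrite cfB hr ?hs ?subrr.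
Qed.
Lemma rees_degS m r : dg m r -> dg m.+1 r.
Proof. exact: leqW. Qed.
Lemma rees_deg_eq0 r : dg 0 r -> r = 0.
Proof. by rewrite /dg leqn0 size_poly_eq0 => /eqP h; apply: val_inj. Qed.
Lemma rees_deg_ex r : exists m, dg m r.
Proof. by exists (size (rees_val r)); apply: leqnn. Qed.
Lemma rees_deg_reesC a : deg0 dg (reesC a).
Proof.
by move=> m r /rees_degP h; apply/rees_degP => i mi; rewrite cfC h ?mulr0.
Qed.
Lemma rees_deg_reesM (q : S) (hq : pw 1 q) : deg1 dg (reesM hq).
Proof.
move=> m r /rees_degP h; apply/rees_degP => i mi; rewrite cfM; case: ifP => // _.
by rewrite h ?mulr0 //; lia.
Qed.

(** Only the top coefficient matters: if a T^n lies in J, subtracting it lowers the degree. *)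
Lemma filt_reg_graded (J : R -> Prop) (q : S) (hq : pw 1 q) : prop_ideal J ->
  (forall n a (ha : pw n a) z, J z -> cf z n.+1 = q * a -> J (reesM ha)) ->
  filt_reg dg J (reesM hq).
Proof.
move=> idJ h; apply: (filt_reg_top rees_deg0 rees_degB rees_degS rees_deg_ex idJ).
move=> n r /rees_degP hr [s /rees_degP hs Js].
exists (r - reesM (cf_pow r n)); last first.
  rewrite subKr; apply: h Js _.
  by rewrite cfB cfM hs // subr0 /= subn1.
apply/rees_degP => i; rewrite leq_eqVlt => /orP[/eqP<-|ni].
  by rewrite cfB cf_reesM eqxx subrr.
by rewrite cfB cf_reesM hr // gtn_eqF // subrr.
Qed.

(* I R(I): its quotient is the associated graded ring of I. *)
Definition extended (r : R) : Prop := forall n, pw n.+1 (cf r n).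
Local Notation K := extended.

Lemma prop_ideal_extended : prop_ideal K.
Proof.
split=> [n|r s hr hs n|r s hs].
- have -> : cf 0 n = 0 :> S by rewrite /cf coef0.
  exact: ideal_pow0.
- by rewrite cfD; apply: ideal_powD.
elim/rees_ind: r => [n|r r' hr hr' n|m a ha n].
- by rewrite mul0r /cf coef0; apply: ideal_pow0.
- by rewrite mulrDl cfD; apply: ideal_powD.
rewrite cfM; case: ltnP => mn; first exact: ideal_pow0.
have -> : n.+1 = (m + (n - m).+1)%N by rewrite addnS subnKC.
exact: ideal_powM.
Qed.
Let idK := prop_ideal_extended.

Lemma extended_reesM n (a : S) (ha : pw n a) : pw n.+1 a -> K (reesM ha).
Proof.
by move=> h i; rewrite cf_reesM; case: eqP => [->//|_]; apply: ideal_pow0.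
Qed.

(** In degree 0 the term q g is no multiple of qT, but it lies in I and so in [K]; this is why
    [n.-1] is enough. *)
Lemma adj_reesM (J : R -> Prop) (q : S) (hq : pw 1 q) n (a a' g : S) (ha : pw n a)
    (ha' : pw n a') : prop_ideal J -> (forall r, K r -> J r) ->
  J (reesM ha') -> a = a' + q * g -> pw n.-1 g -> ideal_adj J (reesM hq) (reesM ha).
Proof.
move=> idJ KJ Ja' e; case: n => [|n] in ha ha' Ja' * => hg.
  have hqg : pw 0 (q * g) by [].
  rewrite (reesM_eq _ (ideal_powD ha' hqg) e) (reesMD ha' hqg).
  apply: ideal_adj_sub; have [_ JD _] := idJ; apply: JD => //; apply: KJ.
  by apply: extended_reesM; rewrite mulrC; apply: ideal_powZ.
have hqg : pw n.+1 (q * g) := ideal_powM (m := 1) hq hg.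
exists (reesM hg); rewrite (reesM_eq _ (ideal_powD ha' hqg) e) (reesMD ha' hqg).
by rewrite (reesMM hq hg hqg) addrK.
Qed.

Lemma cf_subM (q : S) (hq : pw 1 q) (r s : R) n :
  cf (r - reesM hq * s) n.+1 = cf r n.+1 - q * cf s n.
Proof. by rewrite cfB cfM /= subn1. Qed.

Lemma pow_divw_pred n (g : S) : pw n (w * g) -> pw n.-1 g.
Proof. by case: n => // n; apply: pow_divw. Qed.

Lemma extended_regw : filt_reg dg K wT.
Proof.
apply: filt_reg_graded => // n a ha z hz e; apply: extended_reesM.
by apply: pow_divw; rewrite -e; apply: hz.
Qed.

Lemma extended_w_regb : filt_reg dg (ideal_adj K wT) bT.
Proof.
apply: filt_reg_graded => [|n a ha z [y hz] e]; first exact: prop_ideal_adj.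
have [|g [h [ea hh]]] := @pow_divb k n.+1 a (cf y n) (cf (z - wT * y) n.+1) _ (hz _).
  by rewrite cf_subM e; ring.
apply: (@adj_reesM _ _ (pow1 (vw_I25 k)) _ _ _ g _ (powS hh) idK) => //.
- exact: extended_reesM.
- by rewrite addrC.
apply: pow_divw_pred.
have -> : w * g = a + - 1 * h by rewrite ea; ring.
by apply: ideal_powD => //; apply: ideal_powZ; apply: powS.
Qed.

(** The order b, w is also needed: [filt_reg_adj] replaces only the element adjoined last, and w
    must be replaced with b still present. *)
Lemma extended_b_regw : filt_reg dg (ideal_adj K bT) wT.
Proof.
apply: filt_reg_graded => [|n a ha z [y hz] e]; first exact: prop_ideal_adj.
have hz1 := hz n.+1; rewrite cf_subM e in hz1.
have [||g [h [ey hh]]] := @pow_divb k n.+1 (cf y n) a (- (w * a - b * cf y n)).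
- by ring.
- by rewrite -mulN1r; apply: ideal_powZ.
have ha' : pw n.+1 (a - b * g).
  apply: pow_divw.
  have -> : w * (a - b * g) = w * a - b * cf y n + b * h by rewrite ey; ring.
  by apply: ideal_powD => //; apply: pow_mem => //; apply: vb_I25.
apply: (@adj_reesM _ _ (pow1 (vb_I25 k)) _ _ _ g _ (powS ha') idK) => //.
- exact: extended_reesM.
- by ring.
apply: pow_divw_pred.
have -> : w * g = cf y n + - 1 * h by rewrite ey; ring.
by apply: ideal_powD; [apply: cf_pow|apply: ideal_powZ; apply: powS].
Qed.

Lemma vx10_I25 : x ^+ 10 \in I25 k.
Proof.
apply/I25P; have -> : x ^+ 10 = x ^+ 3 * x ^+ 7 by rewrite -exprD.
by apply: in_idealMl; apply: in_ideal_mem; rewrite !inE eqxx !orbT.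
Qed.

(** [pow_red] puts u a in ga + (b, w) with ga in I^(n+1), and u is cancelled as a unit modulo I. *)
Lemma extended_bw_regc : filt_reg dg (ideal_adj (ideal_adj K bT) wT) cT.
Proof.
have idKb := prop_ideal_adj bT idK; have idJ := prop_ideal_adj wT idKb.
apply: filt_reg_graded => // n a ha z [y [y' hz]] e.
have := hz n.+1; rewrite !cf_subM e; set h := (X in pw _ X) => hh.
have [be [ga [de [hb hg ebg]]]] := pow_red hh.
have [la [rh elr]] : exists la rh, u * a - ga = b * la + w * rh.
  apply: (@pow_divc k _ (u * cf y' n + be) (u * cf y n + de)).
  transitivity (u * h + u * (w * cf y n + b * cf y' n) - c * ga); first by rewrite /h; ring.
  by rewrite ebg; ring.
have hua : pw n (u * a - ga).
  have -> : u * a - ga = u * a + - 1 * ga by ring.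
  by apply: ideal_powD; [apply: ideal_powZ|apply: ideal_powZ; apply: powS].
have [la' [rh' [hl hr elr']]] : exists la' rh',
    [/\ pw n.-1 la', pw n.-1 rh' & u * a - ga = b * la' + w * rh'].
  case: (n) hua => [|m] hua; first by exists la, rh.
  by have [g [g' [? ? ?]]] := pow_split hua elr; exists g, g'.
have hu : pw n (u * a) by apply: ideal_powZ.
have hbl : pw n (ga + b * la').
  case: (n) hl hg => // m hl hg; apply: ideal_powD; first exact: powS.
  by apply: pow_mem => //; apply: vb_I25.
have Ju : ideal_adj (ideal_adj K bT) wT (reesM hu).
  apply: (@adj_reesM _ _ (pow1 (vw_I25 k)) _ _ _ rh' _ (hbl) idKb) => //.
  - by move=> r; apply: ideal_adj_sub.
  - apply: (@adj_reesM _ _ (pow1 (vb_I25 k)) _ _ _ la' _ (powS hg) idK) => //.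
    exact: extended_reesM.
  - by rewrite -addrA -elr'; ring.
have hx : pw n.+1 (x ^+ 10 * a) by apply: pow_mem => //; apply: vx10_I25.
have ea : a = (1 + x ^+ 5) * (u * a) + x ^+ 10 * a.
  by rewrite [X in X + _]mulrA vu_cofactor mulrBl mul1r subrK.
have hua' : pw n ((1 + x ^+ 5) * (u * a)) by apply: ideal_powZ.
rewrite (reesM_eq _ (ideal_powD hua' (powS hx)) ea) (reesMD hua' (powS hx)).
have [_ JD JM] := idJ; apply: JD; first by rewrite -(reesCM hu); apply: JM.
by do 2!apply: ideal_adj_sub; apply: extended_reesM.
Qed.

Section ExtendedRegular.
Variables (f : S) (hf : f \in I25 k).
Let fT : R := reesM (pow1 hf).

Lemma extended_reesC r : K (r * reesC f).
Proof. by move=> n; rewrite mulrC cfC; apply: pow_mem => //; apply: cf_pow. Qed.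

(** For a in I^(n+1) one has fT (a T^n) = f (a T^(n+1)); so f generates I R(I) once fT is
    inverted. *)
Lemma extended_fT r : K r -> exists s, fT * r = s * reesC f.
Proof.
move=> hr; exists (\sum_(i < size (rees_val r)) reesM (hr i)).
have er : r = \sum_(i < size (rees_val r)) reesM (cf_pow r i).
  by apply: val_inj; rewrite rmorph_sum /= -[LHS]coefK poly_def.
rewrite {1}er mulr_sumr mulr_suml; apply: eq_bigr => i _; apply: cf_inj => n.
rewrite [in RHS]mulrC cfC cfM !cf_reesM; case: n => [|n]; first by rewrite mulr0.
by rewrite subSS subn0 eqSS /=; case: ifP; rewrite ?mulr0.
Qed.

Variables v1 v2 v3 : R.
Hypotheses (h1 : monic_value dg wT v1) (h2 : monic_value dg bT v2)
  (h3 : monic_value dg cT v3).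

Lemma loc_regular_extended (p : prime_idealr R) : reesC f \in p -> fT \notin p ->
  loc_regular p [:: reesC f; v1; v2; v3].
Proof.
move=> fp fTp.
have dgw : deg1 dg wT := rees_deg_reesM _.
have dgb : deg1 dg bT := rees_deg_reesM _.
have dgc : deg1 dg cT := rees_deg_reesM _.
have idK1 := prop_ideal_adj v1 idK; have idK2 := prop_ideal_adj v2 idK1.
have idKb := prop_ideal_adj bT idK.
pose reg := monic_regular rees_deg0 rees_degB rees_degS rees_deg_eq0 rees_deg_ex.
pose regadj := filt_reg_adj rees_deg0 rees_degB rees_degS rees_deg_eq0 rees_deg_ex.
have r1b : filt_reg dg (ideal_adj K v1) bT.
  exact: regadj idK dgw dgb extended_regw extended_w_regb h1.
have r2c : filt_reg dg (ideal_adj (ideal_adj K v1) v2) cT.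
  apply: (regadj _ _ _ _ idK1 dgb dgc r1b _ h2).
  (* Replace wT by v1 on top of bT, exchange the two by [comm], and then replace bT by v2. *)
  have := regadj _ _ _ _ idKb dgw dgc extended_b_regw extended_bw_regc h1.
  have comm J a a' r : ideal_adj (ideal_adj J a) a' r <-> ideal_adj (ideal_adj J a') a r.
    by split=> -[y [y' h]]; exists y', y; rewrite addrAC.
  move=> h m r [s hs Js]; have [|s' hs' Js'] := h m r; first by exists s => //; apply/comm.
  by exists s' => //; apply/comm.
case=> [|[|[|[|//]]]] _ a /= ha.
- exists 1; first exact: notin_prime1.
  move: ha => /in_ideal_nil/eqP; rewrite mulf_eq0 => /orP[/eqP f0|/eqP->]; last first.
    by rewrite mulr0; apply: in_ideal0.
  case/negP: fTp; have f00 : f = 0.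
    by have := congr1 (fun r : R => cf r 0) f0; rewrite cf_reesC /cf coef0.
  have -> : fT = 0 by apply: val_inj; rewrite /= f00 scale0r.
  exact: idealr0.
- exists fT => //; case/in_ideal1: ha => r er.
  have /extended_fT[s ->] : K a.
    by apply: (reg K idK _ extended_regw _ a h1); rewrite er; apply: extended_reesC.
  by apply/in_idealMl/in_ideal_mem; rewrite mem_head.
- exists fT => //; case/in_ideal2: ha => r [r' er].
  have [y /extended_fT[s es]] : ideal_adj K v1 a.
    apply: (reg _ idK1 _ r1b _ a h2); exists r'.
    by rewrite er (mulrC v1) addrK; apply: extended_reesC.
  have -> : fT * a = s * reesC f + fT * y * v1 by rewrite -es; ring.
  by apply: in_idealD; apply/in_idealMl/in_ideal_mem; rewrite !inE eqxx ?orbT.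
exists fT => //; case/in_ideal3: ha => r [r' [r'' er]].
have [y [y' /extended_fT[s es]]] : ideal_adj (ideal_adj K v1) v2 a.
  apply: (reg _ idK2 _ r2c _ a h3); exists r'', r'.
  rewrite er; have -> : r * reesC f + r' * v1 + r'' * v2 - v2 * r'' - v1 * r' = r * reesC f.
    by ring.
  exact: extended_reesC.
have -> : fT * a = s * reesC f + fT * y' * v1 + fT * y * v2 by rewrite -es; ring.
by do 2?[apply: in_idealD]; apply/in_idealMl/in_ideal_mem; rewrite !inE eqxx ?orbT.
Qed.
End ExtendedRegular.
End ReesFiltration.

(** * Monic polynomials in separate variables *)

Section TowerRegular.

Lemma in_ideal_map (A B : comNzRingType) (h : {rmorphism A -> B}) (s : seq A) a :
  in_ideal s a -> in_ideal (map h s) (h a).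
Proof.
move: a; apply: in_ideal_ind => [|a f g fs hg]; first by rewrite rmorph0; apply: in_ideal0.
rewrite rmorphD rmorphM; apply: in_idealD => //.
by apply/in_idealMl/in_ideal_mem/map_f.
Qed.

Lemma in_ideal_polyC (A : comNzRingType) (s : seq A) (q : {poly A}) :
  in_ideal (map polyC s) q <-> forall i, in_ideal s q`_i.
Proof.
split=> [|h].
  move: q; apply: in_ideal_ind => [i|a f g /mapP[c cs ->] hg i].
    by rewrite coef0; apply: in_ideal0.
  by rewrite coefD coefMC; apply: in_idealD => //; apply/in_idealMl/in_ideal_mem.
rewrite -[q]coefK poly_def; apply: in_ideal_sum => i _; rewrite -mul_polyC.
by apply: in_idealMr; apply: (in_ideal_map polyC).
Qed.

(** X is regular modulo J[X] for the filtration by degree, hence so are its monic polynomials. *)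
Lemma monic_coef_ideal (A : comNzRingType) (J : A -> Prop) (p q : {poly A}) :
  prop_ideal J -> p \is monic -> (forall i, J (p * q)`_i) -> forall i, J q`_i.
Proof.
move=> [J0 JD JM] pm.
pose dg m (r : {poly A}) := is_true (size r <= m)%N.
pose J' (r : {poly A}) := forall i, J r`_i.
have dgP m r : dg m r <-> forall i, (m <= i)%N -> r`_i = 0.
  by split=> [/leq_sizeP|h]; [|apply/leq_sizeP].
have dg0 m : dg m 0 by apply/dgP => i _; rewrite coef0.
have dgB m r s : dg m r -> dg m s -> dg m (r - s).
  by move=> /dgP hr /dgP hs; apply/dgP => i mi; rewrite coefB hr ?hs ?subrr.
have dgS m r : dg m r -> dg m.+1 r by exact: leqW.
have dg_eq0 r : dg 0 r -> r = 0 by rewrite /dg leqn0 size_poly_eq0 => /eqP.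
have dg_ex r : exists m, dg m r by exists (size r); apply: leqnn.
have dgC c : deg0 dg c%:P.
  by move=> m r /dgP h; apply/dgP => i mi; rewrite coefCM h ?mulr0.
have idJ' : prop_ideal J'.
  split=> [i|r s hr hs i|r s hs i]; first by rewrite coef0.
    by rewrite coefD; apply: JD.
  by rewrite coefM; elim/big_ind: _ => // j _; apply: JM.
have hX : filt_reg dg J' 'X.
  apply: (filt_reg_top dg0 dgB dgS dg_ex idJ') => n r /dgP hr [s /dgP hs Js].
  exists (r - r`_n *: 'X^n); last first.
    move=> i; rewrite subKr coefZ coefXn; case: eqP => _; last by rewrite mulr0.
    by have := Js n.+1; rewrite coefB coefXM hs // subr0 mulr1.
  apply/dgP => i; rewrite leq_eqVlt coefB coefZ coefXn => /orP[/eqP->|ni].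
    by rewrite eqxx mulr1 subrr.
  by rewrite (hr i ni) gtn_eqF // mulr0 subrr.
have pv : monic_value dg 'X p.
  have := monic_value_horner (f := polyC) 'X dgC pm.
  by rewrite -/(comp_poly 'X p) comp_polyXr.
exact: (monic_regular dg0 dgB dgS dg_eq0 dg_ex idJ' hX pv).
Qed.

Variables (k : fieldType) (P : nat -> {poly k}).
Hypothesis P_monic : forall i, P i \is monic.

Definition tower_at n i : tower k n := (map_poly (tower_const k n) (P i)).[tower_var k n i].
Definition tower_seq n m := map (tower_at n) (iota 0 m).

Lemma tower_at_polyC n i : (i < n)%N -> tower_at n.+1 i = (tower_at n i)%:P.
Proof.
move=> i_n; rewrite /tower_at /= (ltn_eqF i_n).
by rewrite (map_poly_comp polyC (tower_const k n)) horner_map.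
Qed.

Lemma tower_at_last n : tower_at n.+1 n = map_poly (tower_const k n) (P n).
Proof.
rewrite /tower_at /= eqxx (map_poly_comp polyC (tower_const k n)).
by rewrite -/(comp_poly 'X _) comp_polyXr.
Qed.

Lemma tower_regular n i : (i < n)%N -> forall a, in_ideal (tower_seq n i) (tower_at n i * a) ->
  in_ideal (tower_seq n i) a.
Proof.
elim: n i => // n IHn i i_n.
have -> : tower_seq n.+1 i = map polyC (tower_seq n i).
  rewrite /tower_seq -map_comp; apply/eq_in_map => j; rewrite mem_iota add0n /= => ji.
  by rewrite tower_at_polyC // (leq_trans ji).
move=> a /in_ideal_polyC ha; apply/in_ideal_polyC.
move: i_n; rewrite ltnS leq_eqVlt => /orP[/eqP i_n|i_n].
  apply: (monic_coef_ideal (prop_ideal_in _) _ ha).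
  by rewrite i_n tower_at_last map_monic.
by move=> j; apply: IHn => //; have := ha j; rewrite tower_at_polyC // coefCM.
Qed.

Section Transfer.
Variables (n : nat) (B : comNzRingType) (h : {rmorphism tower k n -> B}).
Variables (p : prime_idealr B) (t : tower k n).
Hypotheses (h_inj : injective h) (tp : h t \notin p).
Hypothesis h_surj : forall b, exists N a, h t ^+ N * b = h a.

Lemma in_ideal_lift s b : in_ideal (map h s) b ->
  exists N, exists2 a, in_ideal s a & h t ^+ N * b = h a.
Proof.
move: b; apply: in_ideal_ind => [|b _ g /mapP[f fs ->] [N [a ha e]]].
  by exists 0%N, 0; [apply: in_ideal0|rewrite mulr0 rmorph0].
have [M [c ec]] := h_surj b; exists (N + M)%N, (t ^+ N * c * f + t ^+ M * a).
  apply: in_idealD; last exact: in_idealMl.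
  by apply/in_idealMl/in_ideal_mem.
by rewrite rmorphD !rmorphM !rmorphXn -ec -e exprD; ring.
Qed.

(** h becomes an isomorphism once t is inverted, and h t is a unit at p, so regularity transfers
    from the polynomial ring. *)
Lemma loc_regular_tower : loc_regular p (map h (tower_seq n n)).
Proof.
move=> i; rewrite !size_map size_iota => i_n b.
have -> : take i (map h (tower_seq n n)) = map h (tower_seq n i).
  by rewrite -map_take /tower_seq -map_take take_iota (minn_idPl (ltnW i_n)).
rewrite (nth_map 0) ?size_map ?size_iota // (nth_map 0%N) ?size_iota // nth_iota // add0n.
move=> /in_ideal_lift[N [a ha e]]; have [M [c ec]] := h_surj b.
have htN m : h t ^+ m \notin p.
  by elim: m => [|m IHm]; rewrite ?notin_prime1 // exprS notin_primeM.
exists (h t ^+ (N + M)) => //.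
have -> : h t ^+ (N + M) * b = h (t ^+ N * c) by rewrite rmorphM rmorphXn -ec exprD mulrA.
apply: in_ideal_map; apply: (tower_regular i_n).
have -> : tower_at n i * (t ^+ N * c) = t ^+ M * a; last exact: in_idealMl.
by apply: h_inj; rewrite !rmorphM !rmorphXn -e -ec; ring.
Qed.
End Transfer.
End TowerRegular.

(** * The three kinds of maximal ideals *)

Section MaximalIdeals.
Variable k : fieldType.
Local Notation S := {mpoly k[3]}.
Local Notation pw := (ideal_pow (fun x => x \in I25 k)).
Local Notation R := (rees (I25 k)).

Section OffIdeal.
Variables (f : S) (hf : f \in I25 k).
Hypothesis f0 : f != 0.
Let fT : R := reesM (pow1 hf).

Definition off_gen (i : nat) : R :=
  if (i < 3)%N then reesC (nth 0 [:: vx k; vy k; vz k] i) else fT.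
Definition off_eval : {rmorphism tower k 4 -> R} := tower_eval (@rees_k k) off_gen 4.

Lemma off_eval_const q : tower_eval (@rees_k k) off_gen 3 q = reesC (@of_tower k 3 q).
Proof.
move: q; apply: (tower_ext (g := tower_eval (@rees_k k) off_gen 3)
  (h := GRing.RMorphism.clone _ _ (@reesC k \o @of_tower k 3) _)) => [a|i i3].
  rewrite tower_eval_const -[RHS]/(reesC (of_tower k 3 (tower_const k 3 a))).
  by rewrite /of_tower tower_eval_const.
rewrite tower_eval_var // -[RHS]/(reesC (of_tower k 3 _)) /of_tower.
rewrite tower_eval_var // insubT /off_gen i3.
by congr reesC; case: i i3 => [|[|[|//]]] i3; congr ('X_ _); apply: val_inj.
Qed.

Lemma cf_off_eval (q : {poly tower k 3}) n :
  cf (off_eval q) n = @of_tower k 3 q`_n * f ^+ n.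
Proof.
elim/poly_ind: q n => [|q a IHq] n.
  by rewrite rmorph0 coef0 rmorph0 mul0r /cf coef0.
have -> : off_eval (q * 'X + a%:P) = fT * off_eval q + reesC (@of_tower k 3 a).
  rewrite rmorphD rmorphM mulrC /= -off_eval_const; congr (_ * _ + _).
    exact: tower_evalX.
  exact: tower_evalC.
rewrite cfD cfM cf_reesC coefD coefMX coefC; case: n => [|n] /=.
  by rewrite !add0r expr0 mulr1.
by rewrite !addr0 subn1 IHq exprS mulrCA.
Qed.

Lemma off_eval_inj : injective off_eval.
Proof.
apply: raddf_inj => q h; apply/polyP => i; rewrite coef0.
have := congr1 (fun r : R => cf r i) h; rewrite cf_off_eval /cf coef0 => /eqP.
rewrite mulf_eq0 expf_eq0 (negbTE f0) andbF orbF => /eqP e.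
by rewrite -[_`_i](@of_towerK k 3) e rmorph0.
Qed.

Definition off_elt : tower k 4 := (to_tower k 3 f)%:P.

Lemma off_eval_elt : off_eval off_elt = reesC f.
Proof.
have -> : off_eval off_elt = tower_eval (@rees_k k) off_gen 3 (to_tower k 3 f).
  exact: tower_evalC.
by rewrite off_eval_const to_towerK.
Qed.

(** From f^N a T^i = (f^(N - i) a) (fT)^i, a large power of f carries each element of R(I) into
    k[x, y, z, fT]. *)
Lemma off_eval_surj (r : R) : exists N q, off_eval off_elt ^+ N * r = off_eval q.
Proof.
rewrite off_eval_elt; exists (size (rees_val r)).
exists (\poly_(i < size (rees_val r)) to_tower k 3 (f ^+ (size (rees_val r) - i) * cf r i)).
apply: cf_inj => n; rewrite -rmorphXn cfC cf_off_eval coef_poly.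
case: ltnP => nr; last by rewrite rmorph0 mul0r /cf nth_default ?mulr0.
by rewrite to_towerK mulrAC -exprD subnK // ltnW.
Qed.
End OffIdeal.

Lemma rees_dependence (s : nat -> R) : exists2 q : tower k 5, q != 0 &
  tower_eval (@rees_k k) s 5 q = 0.
Proof.
have [q q0 e] := algebraic_dependence (n := 3) (fun i => rees_val (s i)).
exists (to_tower k 5 q).
  by apply: contraNneq q0 => h; rewrite -[q]to_towerK h rmorph0.
apply: val_inj; rewrite -[RHS]e; move: q {q0 e}.
apply: (mpoly_ext
  (f := GRing.RMorphism.clone _ _ (val \o tower_eval (@rees_k k) s 5 \o to_tower k 5) _)) => [a|i];
   rewrite -[LHS]/(val (tower_eval (@rees_k k) s 5 (mmap _ _ _))) -[RHS]/(mmap _ _ _).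
  by rewrite !mmapC tower_eval_const.
by rewrite !mmapX !mmap1U tower_eval_var.
Qed.

Lemma rees_algebraic (p : prime_idealr R) : maximal_ideal p -> forall th,
  exists P : {poly k}, P \is monic /\ (map_poly (@rees_k k) P).[th] \in p.
Proof.
move=> pmax th.
have [P Pm hP] := maximal_algebraic (rees_gen_surj (leqnn 10)) pmax th.
by exists P.
Qed.

Lemma regular_off_ideal (p : prime_idealr R) : maximal_ideal p ->
  (exists2 f, f \in I25 k & reesC f \notin p) ->
  exists2 s : seq R, loc_regular p s & {subset s <= p} /\ size s = 4.
Proof.
move=> pmax [f hf fp].
have f0 : f != 0 by apply: contraNneq fp => ->; rewrite rmorph0 idealr0.
have /choice[P hP] := fun i : nat => rees_algebraic pmax (off_gen hf i).
exists (map (off_eval hf) (tower_seq P 4 4)).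
  apply: (loc_regular_tower (fun i => (hP i).1) (off_eval_inj f0) _ (off_eval_surj hf)).
  by rewrite off_eval_elt.
split; last by rewrite !size_map size_iota.
move=> _ /mapP[_ /mapP[i hi ->] ->]; rewrite mem_iota add0n /= in hi.
have := (hP i).2; rewrite /tower_at -horner_map -map_poly_comp.
rewrite (eq_map_poly (g := @rees_k k)); last by move=> a; apply: tower_eval_const.
by rewrite /off_eval tower_eval_var.
Qed.

Lemma regular_on_ideal (p : prime_idealr R) : maximal_ideal p ->
  (forall f, f \in I25 k -> reesC f \in p) ->
  (exists f, exists hf : f \in I25 k, reesM (pow1 hf) \notin p) ->
  exists2 s : seq R, loc_regular p s & {subset s <= p} /\ size s = 4.
Proof.
move=> pmax Ip [f [hf fTp]].
have alg th : exists2 v, monic_value (@rees_deg k) th v & v \in p.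
  have [P [Pm hP]] := rees_algebraic pmax th.
  exists (map_poly (@rees_k k) P).[th] => //.
  by apply: monic_value_horner => // a; apply: rees_deg_reesC.
have [v1 h1 p1] := alg (wT k); have [v2 h2 p2] := alg (bT k); have [v3 h3 p3] := alg (cT k).
exists [:: reesC f; v1; v2; v3].
  exact: (@loc_regular_extended k f hf v1 v2 v3 h1 h2 h3 p (Ip f hf) fTp).
by split=> // r; rewrite !inE => /or4P[]/eqP-> //; apply: Ip.
Qed.

Lemma regular_irrelevant (p : prime_idealr R) :
  (forall f, f \in I25 k -> reesC f \in p) ->
  (forall f (hf : f \in I25 k), reesM (pow1 hf) \in p) ->
  exists2 s : seq R, loc_regular p s & {subset s <= p} /\ size s = 4.
Proof.
move=> Ip ITp.
(* x^7 lies in I, so x lies in p and 1 - x^5 does not. *)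
have xp : reesC (vx k) \in p.
  have : reesC (vx k ^+ 7) \in p.
    by apply/Ip/I25P/in_ideal_mem; rewrite !inE eqxx !orbT.
  rewrite rmorphXn; elim: 7%N => [|m IHm]; first by rewrite expr0 idealr1.
  by rewrite exprS prime_idealrM => /orP[|/IHm].
have up : reesC (vu k) \notin p.
  apply: contra (notin_prime1 p) => hu.
  have -> : 1 = reesC (vu k) + reesC (vx k) ^+ 4 * reesC (vx k) :> R.
    by rewrite -exprSr -rmorphXn -rmorphD subrK rmorph1.
  by apply: rpredD => //; apply: idealMr.
exists [:: wT k; reesC (vw k) - bT k; reesC (vb k) - cT k; reesC (vc k)].
  case=> [|[|[|[|//]]]] _ a /= ha.
  - exists 1; first exact: notin_prime1.
    move: ha => /in_ideal_nil/eqP; rewrite mulf_eq0 => /orP[/eqP w0|/eqP->]; last first.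
      by rewrite mulr0; apply: in_ideal0.
    have := congr1 (fun r : R => cf r 1) w0; rewrite cf_reesM /cf coef0 /= => /eqP.
    by rewrite (negbTE (vw_neq0 k)).
  - by exists 1; [exact: notin_prime1|rewrite mul1r; apply: reg_step1].
  - by exists 1; [exact: notin_prime1|rewrite mul1r; apply: reg_step2].
  exists (reesC (vu k) * reesC (vu k)); first exact: notin_primeM.
  by rewrite -mulrA; apply: reg_step3.
split=> // r; rewrite !inE => /or4P[]/eqP->.
- exact: ITp.
- by apply: rpredB; [apply/Ip/vw_I25|apply: ITp].
- by apply: rpredB; [apply/Ip/vb_I25|apply: ITp].
by apply/Ip/vc_I25.
Qed.

Theorem cohen_macaulay_rees : cohen_macaulay R.
Proof.
apply: (cohen_macaulay_criterion (f := rees_k k) (d := 4) (@noeth_rees k) rees_dependence).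
move=> p pmax.
have [[f hf fp]|off] := pselect (exists2 f, f \in I25 k & reesC f \notin p).
  by apply: regular_off_ideal => //; exists f.
have Ip f : f \in I25 k -> reesC f \in p.
  by move=> hf; apply: contrapT => /negP fp; apply: off; exists f.
have [on|on] := pselect (exists f, exists hf : f \in I25 k, reesM (pow1 hf) \notin p).
  exact: regular_on_ideal.
apply: regular_irrelevant => // f hf; apply: contrapT => /negP fp.
by apply: on; exists f, hf.
Qed.
End MaximalIdeals.

Theorem theorem5p3 (k : fieldType) :
  (forall f : {mpoly k[3]}, f \in I25 k <-> in_ideal (I25_gens k) f)
  /\ cohen_macaulay (rees (I25 k))
  /\ normal_domain (rees (I25 k)).
Proof.
split; first exact: I25P.
split; first exact: cohen_macaulay_rees.
exact: completely_closed_normal (@completely_closed_rees k).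
Qed.
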